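(* Let $R$ be a set and let $P=x_1x_2\ldots x_{n+1}$ be an $R$-deco polygon of weight $n\ge2$, with $\sigma P=x_2\ldots x_{n+1}x_1$. Let $A_P=x_2\ldots x_{n+1}$ and $B_P=x_2\ldots x_nx_1$, and for $2\le i\le n$ let $$A^l_{P,\alpha_{i-1}}=x_ix_{i+1}\ldots x_{n+1},\quad A^r_{P,\alpha_{i-1}}=x_2\ldots x_i,\quad B^l_{P,\sigma\alpha_i}=x_{i+1}\ldots x_nx_i,\quad B^r_{P,\sigma\alpha_i}=x_2\ldots x_ix_1$$ (a sequence of length one, i.e. $A^r_{P,\alpha_{1}}$ and $B^l_{P,\sigma\alpha_n}$, denotes the trivial polygon $1$). Then $$\tilde r_n\big(\Lambda_{\phi_{fv}}(P)-\Lambda_{\phi_{\sigma fv}}(\sigma P)\big)=\sum_{i=2}^{n}\tilde r_n\Big((x_ix_{n+1}-x_{n+1}x_i)\star_{\prec\{\alpha_{i-1},A_P\}}\big(\Lambda_{\phi_4}(A^r_{P,\alpha_{i-1}})\sqcup\!\sqcup\Lambda_{\phi_{fv}}(A^l_{P,\alpha_{i-1}})\big)-(x_ix_1-x_1x_i)\star_{\succ\{\sigma\alpha_i,B_P\}}\big(\Lambda_{\phi_4}(B^l_{P,\sigma\alpha_i})\sqcup\!\sqcup\Lambda_{\phi_{\sigma fv}}(B^r_{P,\sigma\alpha_i})\big)\Big).$$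
   Context: **Polygons.** An $R$-deco polygon of weight $n\ge1$ is a convex oriented $(n+1)$-gon with sides labelled by elements of $R$, a distinguished root side, and a marked first vertex which is an endpoint of the root side; the orientation starts at the first vertex and ends with the root side. It is written $x_1\ldots x_{n+1}$, listing the labels along the orientation (drawn counterclockwise), so $x_{n+1}$ labels the root side. Side $j$ goes from vertex $j$ to vertex $j+1$ (indices mod $n+1$); vertex $1$ is the first vertex and vertex $n+1$ the last vertex. $V_n(R)$ is the $\mathbb{Q}$-vector space with basis the polygons of weight $n$; $V_0(R)=\mathbb{Q}$ is spanned by the trivial polygon $1$; $V_\bullet(R)=\bigoplus_{n\ge0}V_n(R)$. The rotation is $\sigma(x_1x_2\ldots x_{n+1})=x_2\ldots x_{n+1}x_1$. Thus $x_ix_j$ denotes a 2-gon (weight 1) with root label $x_j$. **Arrows and dissections.** An arrow ${}_i\alpha_j$ of $P$ goes from vertex $i$ to side $j$; it is non-trivial if $j\not\equiv i,i-1\pmod{n+1}$. A dissection of $P$ is a set $d$ of pairwise non-intersecting non-trivial arrows, i.e. arrows that can be drawn in the polygon with no common points except possibly a common starting vertex (arrows ending on the same side end at different points). $D(P)$ is the set of dissections, including the empty one. An arrow divides $P$ into two regions, to its left and right (as seen travelling along the arrow), with subpolygons $P^l,P^r$: for $P=x_1\ldots x_{n+1}$ and the arrow ${}_i\alpha_j$, if $i<j$ then $P^l=x_1\ldots x_{i-1}x_j\ldots x_{n+1}$, $P^r=x_ix_{i+1}\ldots x_j$; if $j<i$ then $P^l=x_{j+1}\ldots x_{i-1}x_j$,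 $P^r=x_1\ldots x_jx_i\ldots x_{n+1}$. Contracting all arrows of $d$ (in any order) gives $|d|+1$ subpolygons, one for each region cut out by $d$. **Words and linearization.** $\bar T(V_\bullet(R))=\bigoplus_{k\ge0}V_{\ge1}(R)^{\otimes k}$ is spanned by words $[Q_1|\ldots|Q_k]$ in polygons; $\sqcup\!\sqcup$ is the shuffle product. For a finite tree (or forest) $T$ with oriented edges and vertices labelled by polygons (a tree may have several roots), $\Lambda(T)$ is the sum, over all total orderings of the vertices in which the initial vertex of each edge precedes its final vertex, of the words obtained by writing the labels in that order; $\Lambda$ is extended linearly (also in the labels). **Generating sets.** For $d\in D(P)$, $T_{\phi_4,d}(P)$ is the tree (with sign $+1$) whose vertices are the regions of $d$ labelled by their subpolygons, with one edge for each arrow $\alpha\in d$, oriented from the region bordering $\alpha$ on its left to the region bordering $\alpha$ on its right. $T_{\phi_{fv},d}(P)$ is obtained from $T_{\phi_4,d}(P)$ by reversing the edges corresponding to the arrows of $d$ that start at the first vertex of $P$ and multiplying by $(-1)^m$, $m$ being the number of these arrows. $T_{\phi_{\sigma fv},d}(P)$ is obtained from $T_{\phi_4,d}(P)$ in the same way, using instead the arrows of $d$ that start at the last vertex of $P$. For $\phi\in\{\phi_4,\phi_{fv},\phi_{\sigma fv}\}$, $\Lambda_\phi(P)=\sum_{d\in D(P)}\Lambda(T_{\phi,d}(P))$, and $\Lambda_\phi(1)=1$. **Insertion.** For $u\in V_1(R)$ and signed trees $T,T'$ with chosen vertices $v,v'$, let $u\star_{\prec\{v,v'\}}(\Lambda(T)\sqcup\!\sqcup\Lambda(T'))=\Lambda(S)$,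 where $S$ is the tree obtained from the disjoint union of $T$ and $T'$ by adding a new vertex labelled $u$ and edges from $u$ to $v$ and from $u$ to $v'$; and $u\star_{\succ\{v,v'\}}(\Lambda(T)\sqcup\!\sqcup\Lambda(T'))=\Lambda(S')$, where $S'$ is obtained by adding a new vertex labelled $u$ and edges from $v$ to $u$ and from $v'$ to $u$. Signs multiply. If one of the two trees is empty (trivial polygon), $u$ is joined only to the chosen vertex of the other. Then, with $\alpha_{i-1}$ the (possibly trivial) arrow of $A_P$ from its first vertex to the side labelled $x_i$ (its $(i-1)$-st side), $$u\star_{\prec\{\alpha_{i-1},A_P\}}\big(\Lambda_{\phi_4}(A^r)\sqcup\!\sqcup\Lambda_{\phi_{fv}}(A^l)\big)=\sum_{d^r\in D(A^r),\,d^l\in D(A^l)}u\star_{\prec\{v_r,v_l\}}\big(\Lambda(T_{\phi_4,d^r}(A^r))\sqcup\!\sqcup\Lambda(T_{\phi_{fv},d^l}(A^l))\big),$$ where $A^r=A^r_{P,\alpha_{i-1}}$, $A^l=A^l_{P,\alpha_{i-1}}$, and $v_r,v_l$ are the vertices for the regions bordering $\alpha_{i-1}$ on its right and left in the dissection $d^r\cup d^l\cup\{\alpha_{i-1}\}$ of $A_P$; explicitly, $v_r$ is the region of $d^r$ containing the part of the root side $x_i$ of $A^r$ near the first vertex of $A^r$, and $v_l$ is the region of $d^l$ containing the part of the side $x_i$ (the first side) of $A^l$ near the first vertex of $A^l$. Similarly, with $\sigma\alpha_i$ the (possibly trivial) arrow of $B_P$ from its last vertex to the side labelled $x_i$ (its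 $(i-1)$-st side), $$u\star_{\succ\{\sigma\alpha_i,B_P\}}\big(\Lambda_{\phi_4}(B^l)\sqcup\!\sqcup\Lambda_{\phi_{\sigma fv}}(B^r)\big)=\sum_{d^l\in D(B^l),\,d^r\in D(B^r)}u\star_{\succ\{v_l,v_r\}}\big(\Lambda(T_{\phi_4,d^l}(B^l))\sqcup\!\sqcup\Lambda(T_{\phi_{\sigma fv},d^r}(B^r))\big),$$ where $B^l=B^l_{P,\sigma\alpha_i}$, $B^r=B^r_{P,\sigma\alpha_i}$, and $v_l,v_r$ are the regions bordering $\sigma\alpha_i$ on its left and right; explicitly, $v_l$ is the region of $d^l$ containing the part of the root side $x_i$ of $B^l$ near the last vertex of $B^l$, and $v_r$ is the region of $d^r$ containing the part of the (last non-root) side $x_i$ of $B^r$ near the last vertex of $B^r$. **The quotient.** $J_k\subset V_k(R)$ is the span of $\{Q-\sigma Q:Q\text{ a polygon of weight }k\}$, and $\tilde J_1\subset V_1(R)$ is the span of the elements $ac-ca+cb-bc-ab+ba$ with $a,b,c\in R$. The map $\tilde r_n:\bar T(V_\bullet(R))\to\bar T(V_\bullet(R))/(\tilde J_1+\sum_{k=2}^nJ_k)$ is the quotient map by the two-sided ideal for concatenation generated by $\tilde J_1+\sum_{k=2}^nJ_k$. *)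

(* Defs.v *)
From HB Require Import structures.
From mathcomp Require Import all_boot all_order all_algebra.
From mathcomp Require Import boolp monalg.

Set Implicit Arguments.
Unset Strict Implicit.
Unset Printing Implicit Defensive.

Import GRing.Theory.
Local Open Scope ring_scope.
Local Open Scope quotient_scope.

(** An R-deco polygon is the sequence of its side labels, root label last.  A
    sequence of length one stands for the trivial polygon 1 of weight 0; the
    polygons of positive weight, which index the letters of the words, are
    the sequences of length at least two. *)
Definition polygon (R : choiceType) := {s : seq R | (1 < size s)%N}.

(** The free associative Q-algebra on the polygons of positive weight, i.e.
    the tensor algebra of V_{>=1}(R); its product is the concatenation. *)
Notation words R := {malg rat[{fmonom (polygon R)}]}.

(** The image in [words R] of a polygon: the one-letter word [P] in positive
    weight, and the unit 1 for the trivial polygon. *)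
Definition pword (R : choiceType) (P : seq R) : words R :=
  if insub P is Some Q then << fmu (Q : polygon R) >> else 1.

(** Sides and vertices of an N-gon are numbered from 0 to N-1; side j goes from
    vertex j to vertex j+1 mod N, so 0 is the first vertex, N-1 the last vertex
    and N-1 the root side.  The pair (i, j) is the arrow from vertex i to
    side j.

    The polygon is drawn with N * N points on its boundary, in the order of the
    orientation: vertex j is the point N * j, and the arrow (i, j) ends at the
    point N * j + ((j - i) mod N).  Arrows with distinct starting vertices
    thereby end at distinct points of a common side, in the only order that
    does not force them to cross. *)
Definition arrow (N : nat) := ('I_N * 'I_N)%type.

Definition astart (N : nat) (a : arrow N) : nat := (a.1 * N)%N.
Definition aend (N : nat) (a : arrow N) : nat :=
  (a.2 * N + (a.2 + N - a.1) %% N)%N.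

Definition nontrivial (N : nat) (a : arrow N) : bool :=
  (a.2 != a.1) && (ordS a.2 != a.1).

(** The part of the boundary between the points k and k+1 lies to the left of
    the arrow a, i.e. on the way from the end of a to its start when following
    the (counterclockwise) orientation. *)
Definition on_left (N : nat) (a : arrow N) (k : nat) : bool :=
  if (astart a < aend a)%N then (k < astart a)%N || (aend a <= k)%N
  else (aend a <= k < astart a)%N.

(** When the starting vertices are distinct, b has no end point in common with
    a, and so crosses a iff its two end points are on different sides of a. *)
Definition crosses (N : nat) (a b : arrow N) : bool :=
  (a.1 != b.1) && (on_left a (astart b) != on_left a (aend b)).

Definition dissections (N : nat) : {set {set arrow N}} :=
  [set d : {set arrow N} | [forall a in d, nontrivial a &&
             [forall b in d, (a != b) ==> ~~ crosses a b]]].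

(** The gap (j, t) is the t-th of the N elementary parts of side j. *)
Definition gap (N : nat) := ('I_N * 'I_N)%type.
Definition gpos (N : nat) (h : gap N) : nat := (h.1 * N + h.2)%N.

(** A region is represented by the set of the gaps on its boundary, which is
    never empty since the gaps on both sides of the end of an arrow belong to
    the two regions bordering this arrow.  [region_at d k] is the region of d
    with the part of the boundary between the points k and k+1. *)
Definition region_at (N : nat) (d : {set arrow N}) (k : nat) : {set gap N} :=
  [set h | [forall a in d, on_left a (gpos h) == on_left a k]].

(** The trivial polygon has no region, so that its tree is empty. *)
Definition regions (N : nat) (d : {set arrow N}) : {set {set gap N}} :=
  [set region_at d (gpos h) | h : gap N & (1 < N)%N].

Definition left_region (N : nat) (d : {set arrow N}) (a : arrow N) :=
  region_at d (aend a).
Definition right_region (N : nat) (d : {set arrow N}) (a : arrow N) :=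
  region_at d (aend a).-1.

(** A subpolygon of an N-gon is given by the list of its gaps, root side last.
    [contract r Q a] contracts the arrow a in the subpolygon Q, and keeps the
    one of the two resulting subpolygons which contains the region r: the root
    side is that of Q if (part of) it is still there, and otherwise it is the
    side a.2 where a ends.  This is the common form of the four formulas
    x_1..x_{i-1}x_j..x_{n+1}, x_i..x_j (i < j) and x_{j+1}..x_{i-1}x_j,
    x_1..x_jx_i..x_{n+1} (j < i) for P^l and P^r. *)
Definition contract (N : nat) (r : {set gap N}) (Q : seq (gap N))
    (a : arrow N) : seq (gap N) :=
  let Q' :=
    [seq h <- Q | [forall g in r, on_left a (gpos h) == on_left a (gpos g)]] in
  if last a.2 (unzip1 Q) \in unzip1 Q' then Q'
  else [seq h <- Q' | h.1 != a.2] ++ [seq h <- Q' | h.1 == a.2].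

Definition all_gaps (N : nat) : seq (gap N) :=
  [seq (j, t) | j <- enum 'I_N, t <- enum 'I_N].

(** The sides of the subpolygon of the region r, root side last, obtained by
    contracting all the arrows of d. *)
Definition subpolygon (N : nat) (d : {set arrow N}) (r : {set gap N}) :
    seq 'I_N :=
  undup (unzip1 (foldl (contract r) (all_gaps N) (enum d))).

(** The vertices of the tree form the subset [nodes] of the type [node]; edges
    and labels are only relevant on this subset.  Labels live in [words R], so
    that the linearization is linear in them. *)
Record stree (R : choiceType) := STree {
  node : finType;
  nodes : {set node};
  edge : rel node;
  label : node -> words R;
  sgn : rat
}.

Definition linear_ext (T : finType) (e : rel T) (s : seq T) : bool :=
  all (fun v => all (fun w => e v w ==> (index v s < index w s)%N) s) s.

Definition Lambda (R : choiceType) (T : stree R) : words R :=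
  sgn T *: \sum_(s <- permutations (enum (nodes T)) | linear_ext (@edge R T) s)
             \prod_(v <- s) label v.

Inductive genset := phi4 | phifv | phisfv.

Definition reversed (phi : genset) (N : nat) (a : arrow N) : bool :=
  match phi with
  | phi4 => false
  | phifv => a.1 == 0 :> nat
  | phisfv => a.1 == N.-1 :> nat
  end.

Definition diss_tree (R : choiceType) (phi : genset) (N : nat) (P : N.-tuple R)
    (d : {set arrow N}) : stree R :=
  {| node := {set gap N};
     nodes := regions d;
     edge := fun r r' => [exists a in d,
       if reversed phi a then (r == right_region d a) && (r' == left_region d a)
       else (r == left_region d a) && (r' == right_region d a)];
     label := fun r => pword [seq tnth P j | j <- subpolygon d r];
     sgn := (-1) ^+ #|[set a in d | reversed phi a]| |}.

Definition Lambda_gen (R : choiceType) (phi : genset) (P : seq R) : words R :=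
  \sum_(d in dissections (size P)) Lambda (diss_tree phi (in_tuple P) d).

(** The disjoint union of T, T' and a new vertex [None] labelled u, joined to v
    and v': the new edges leave u if [out] is true and end at u otherwise.  When
    T (resp. T') is empty, v (resp. v') is not a vertex of the new tree and the
    corresponding edge is not there. *)
Definition graft (R : choiceType) (out : bool) (u : words R) (T T' : stree R)
    (v : node T) (v' : node T') : stree R :=
  let chosen (w : node T + node T') :=
    match w with inl a => a == v | inr b => b == v' end in
  {| node := option (node T + node T')%type;
     nodes := [set w : option (node T + node T')%type |
       match w with
       | None => true
       | Some (inl a) => a \in nodes T
       | Some (inr b) => b \in nodes T'
       end];
     edge := fun w w' =>
       match w, w' with
       | Some (inl a), Some (inl a') => edge a a'
       | Some (inr b), Some (inr b') => edge b b'
       | None, Some z => out && chosen z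
       | Some z, None => ~~ out && chosen z
       | _, _ => false
       end;
     label := fun w =>
       match w with
       | None => u
       | Some (inl a) => label a
       | Some (inr b) => label b
       end;
     sgn := sgn T * sgn T' |}.

(** u *_{< {alpha_{i-1}, A_P}} (Lambda_phi4 (A^r) sh Lambda_phifv (A^l)): the
    chosen regions contain the last part of the root side of A^r, which is the
    one near its first vertex, and the first part of the first side of A^l. *)
Definition insert_prec (R : choiceType) (u : words R) (Ar Al : seq R) :
    words R :=
  \sum_(dr in dissections (size Ar)) \sum_(dl in dissections (size Al))
    Lambda (@graft R true u
      (diss_tree phi4 (in_tuple Ar) dr) (diss_tree phifv (in_tuple Al) dl)
      (region_at dr (size Ar * size Ar).-1) (region_at dl 0)).

(** u *_{> {sigma alpha_i, B_P}} (Lambda_phi4 (B^l) sh Lambda_phisfv (B^r)): the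
    last vertex of an N-gon being the point N * (N - 1), the chosen regions
    contain the first part of the root side of B^l, and the last part of the
    last non-root side of B^r. *)
Definition insert_succ (R : choiceType) (u : words R) (Bl Br : seq R) :
    words R :=
  \sum_(dl in dissections (size Bl)) \sum_(dr in dissections (size Br))
    Lambda (@graft R false u
      (diss_tree phi4 (in_tuple Bl) dl) (diss_tree phisfv (in_tuple Br) dr)
      (region_at dl (size Bl * (size Bl).-1))
      (region_at dr (size Br * (size Br).-1).-1)).

(** Only the spanning families of J_k and of tilde J_1; they generate the same
    ideal as the subspaces. *)
Definition J (R : choiceType) (k : nat) (z : words R) : Prop :=
  exists Q : seq R, size Q = k.+1 /\ z = pword Q - pword (rot 1 Q).

Definition tildeJ1 (R : choiceType) (z : words R) : Prop :=
  exists a b c : R,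
    z = pword [:: a; c] - pword [:: c; a] + pword [:: c; b] - pword [:: b; c]
        - pword [:: a; b] + pword [:: b; a].

Definition ideal_gen (R : choiceType) (n : nat) (z : words R) : Prop :=
  tildeJ1 z \/ exists2 k, (2 <= k <= n)%N & J k z.

(** The two-sided ideal generated by tilde J_1 + J_2 + ... + J_n. *)
Definition in_ideal (R : choiceType) (n : nat) (z : words R) : Prop :=
  exists s : seq (words R * words R * words R),
    (forall t, t \in s -> ideal_gen n t.1.2) /\
    z = \sum_(t <- s) t.1.1 * t.1.2 * t.2.

Definition J_ideal (R : choiceType) (n : nat) : {pred words R} :=
  fun z => `[< in_ideal n z >].

Lemma ideal_zmod_closed (R : choiceType) (n : nat) : zmod_closed (@J_ideal R n).
Proof.
split; first by apply/asboolP; exists [::]; split=> //; rewrite big_nil.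
move=> y z /asboolP[s [sG ->]] /asboolP[t [tG ->]]; apply/asboolP.
exists (s ++ [seq (- p.1.1, p.1.2, p.2) | p <- t]); split.
  by move=> p; rewrite mem_cat => /orP[/sG //|/mapP[q /tG qG ->]].
rewrite big_cat big_map -sumrN /=; congr (_ + _).
by apply: eq_bigr => p _; rewrite !mulNr.
Qed.

HB.instance Definition _ (R : choiceType) (n : nat) :=
  GRing.isZmodClosed.Build (words R) (@J_ideal R n) (ideal_zmod_closed R n).

Definition r_tilde (R : choiceType) (n : nat) (z : words R) :
  Quotient.quot (@J_ideal R n) := \pi z.

(* Main.v *)
(** The rotation identifies the dissections of P with those of sigma P, and sends
    the arrows starting at the first vertex of P to those starting at the last
    vertex of sigma P.  The trees of P and sigma P attached to a dissection thus
    differ only by their labels: the root side of the subpolygon of a region is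
    the one towards the root side x_(n+1) in P, and towards x_1 in sigma P.
    Modulo the ideal, this only matters for the 2-gons which lie between a side
    x_a and a side x_b, a < b, as seen from the first vertex; such a 2-gon has
    the labels x_a x_b and x_b x_a, and one other vertex v with a < v <= b.
    Changing the labels one region at a time expresses the difference as the
    signed sum over (a, v, b) of the sums G_avb (x_a x_b - x_b x_a) over the
    dissections of the four polygons around this 2-gon.

    By the relations in tilde J_1, x_a x_b - x_b x_a is f_a - f_b with
    f_a = x_a x_1 - x_1 x_a.  For v fixed, the alternating sum of G_avb over b
    vanishes if v is not the last vertex, and that over a vanishes if v is not
    the second one: both are instances of a cancellation over the ways of
    splitting the first vertex of a polygon, where each word occurs twice with
    opposite signs.  What remains are the terms of the right-hand side. *)

Require Import Defs.
From HB Require Import structures.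
From mathcomp Require Import all_boot all_order all_algebra.
From mathcomp Require Import boolp monalg zify.

Set Implicit Arguments.
Unset Strict Implicit.
Unset Printing Implicit Defensive.

Import GRing.Theory.
Local Open Scope ring_scope.

(** * Congruence modulo the ideal *)

(** The order in which the labels are changed is what makes the cancellation possible. Regions are
    taken by their first gap, so that when the 2-gon on [x_a], [x_b] is reached, the labels already
    changed are those of the polygon with sides [x_1, ..., x_a]. The regions between [x_a] and [v]
    keep the labels of [P], but their polygon is cut off by an arrow ending on [x_a], its first
    side, so that their root sides are those towards [x_a]. The two polygons before [v] thus follow
    the rule of [sigma P], the two after [v] that of [P], and each pair fits together into one
    polygon, whose first vertex is the one being split. The cancellation needs an inserted element
    that does not depend on the summation index, which is why the 2-gons are written [f_a - f_b]. It
    leaves, at the second vertex, a sum over [b] with [f_b] inserted. One more cancellation there,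
    with the constant element [f_(n+1)], replaces the term [b = n + 1] by the others and turns each
    [f_b] into [f_b - f_(n+1)], that is, into [x_b x_(n+1) - x_(n+1) x_b]; it needs [n >= 2]. *)

Section Congruence.
Variables (R : choiceType) (n : nat).
Implicit Types x y z w : words R.

(** Labels are replaced inside products, whereas the target of [r_tilde] is only an additive group;
    hence a congruence on words instead of equality in the quotient. *)
Definition eqm x y := x - y \in @J_ideal R n.

Lemma ideal_sum_gen z : ideal_gen n z -> z \in @J_ideal R n.
Proof.
move=> zG; apply/asboolP; exists [:: (1, z, 1)]; split.
  by move=> t; rewrite inE => /eqP ->.
by rewrite big_seq1 mul1r mulr1.
Qed.

Lemma idealMl w z : z \in @J_ideal R n -> w * z \in @J_ideal R n.
Proof.
move=> /asboolP[s [sG ->]]; apply/asboolP.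
exists [seq (w * p.1.1, p.1.2, p.2) | p <- s]; split.
  by move=> t /mapP[q /sG qG ->].
by rewrite big_map mulr_sumr; apply: eq_bigr => p _; rewrite !mulrA.
Qed.

Lemma idealMr w z : z \in @J_ideal R n -> z * w \in @J_ideal R n.
Proof.
move=> /asboolP[s [sG ->]]; apply/asboolP.
exists [seq (p.1.1, p.1.2, p.2 * w) | p <- s]; split.
  by move=> t /mapP[q /sG qG ->].
by rewrite big_map mulr_suml; apply: eq_bigr => p _; apply: esym (mulrA _ _ _).
Qed.

Lemma eqm_refl x : eqm x x.
Proof. by rewrite /eqm subrr rpred0. Qed.

Lemma eqm_eq x y : x = y -> eqm x y.
Proof. by move=> ->; apply: eqm_refl. Qed.

Lemma eqm_sym x y : eqm x y -> eqm y x.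
Proof. by rewrite /eqm -opprB rpredN. Qed.

Lemma eqm_trans y x z : eqm x y -> eqm y z -> eqm x z.
Proof. by move=> xy yz; rewrite /eqm -(subrKA y) rpredD. Qed.

Lemma eqmD x y z w : eqm x y -> eqm z w -> eqm (x + z) (y + w).
Proof. by move=> xy zw; rewrite /eqm opprD addrACA rpredD. Qed.

Lemma eqmN x y : eqm x y -> eqm (- x) (- y).
Proof. by move=> xy; rewrite /eqm -opprD rpredN. Qed.

Lemma eqmB x y z w : eqm x y -> eqm z w -> eqm (x - z) (y - w).
Proof. by move=> xy zw; apply: eqmD => //; apply: eqmN. Qed.

Lemma eqmM x y z w : eqm x y -> eqm z w -> eqm (x * z) (y * w).
Proof.
move=> xy zw; apply: (@eqm_trans (y * z)).
  by rewrite /eqm -mulrBl idealMr.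
by rewrite /eqm -mulrBr idealMl.
Qed.

Lemma eqmZ (c : rat) x y : eqm x y -> eqm (c *: x) (c *: y).
Proof. by move=> xy; rewrite -(mulr_algl c x) -(mulr_algl c y); apply: eqmM => //; apply: eqm_refl. Qed.

Lemma eqm_sum (I : Type) (r : seq I) (P : pred I) (F G : I -> words R) :
  (forall i, P i -> eqm (F i) (G i)) ->
  eqm (\sum_(i <- r | P i) F i) (\sum_(i <- r | P i) G i).
Proof.
move=> FG; elim/big_ind2: _ => //; first exact: eqm_refl.
by move=> *; apply: eqmD.
Qed.

Lemma eqm_prod (I : eqType) (r : seq I) (F G : I -> words R) :
  {in r, forall i, eqm (F i) (G i)} ->
  eqm (\prod_(i <- r) F i) (\prod_(i <- r) G i).
Proof.
move=> FG; rewrite !big_seq; elim/big_ind2: _ => //; first exact: eqm_refl.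
by move=> *; apply: eqmM.
Qed.

Lemma eqm_pi x y : eqm x y -> r_tilde n x = r_tilde n y.
Proof. by move=> xy; apply/eqquotP. Qed.

End Congruence.

(** * Sums over linear extensions *)

Section LinearExtensions.
Variable (R : choiceType).

Lemma linear_extP (T : finType) (e : rel T) (V : {set T}) (s : seq T) :
  perm_eq s (enum V) ->
  reflect {in V &, forall x y, e x y -> (index x s < index y s)%N}
          (linear_ext e s).
Proof.
move=> sV; have mE x : (x \in s) = (x \in V) by rewrite (perm_mem sV) mem_enum.
apply: (iffP allP) => [h x y xV yV exy|h x xs].
  have := h x; rewrite mE => /(_ xV) /allP /(_ y); rewrite mE => /(_ yV).
  by move/implyP; apply.
apply/allP => y ys; apply/implyP; apply: h; by rewrite -mE.
Qed.

(** [Lambda] without its sign, with nodes, edges and labels as separate arguments, so that each can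
    be changed alone. *)
Definition LamE (T : finType) (V : {set T}) (e : rel T) (lab : T -> words R) :=
  \sum_(s <- permutations (enum V) | linear_ext e s) \prod_(v <- s) lab v.

Lemma LambdaE (T : stree R) : Lambda T = sgn T *: LamE (nodes T) (@edge R T) (@label R T).
Proof. by []. Qed.

Lemma perm_map_permutations (T T' : finType) (f : T -> T') (V : {set T}) :
  {in V &, injective f} ->
  perm_eq (permutations (enum (f @: V))) (map (map f) (permutations (enum V))).
Proof.
move=> f_inj.
have pV : perm_eq (enum (f @: V)) (map f (enum V)).
  apply: uniq_perm; rewrite ?enum_uniq ?map_inj_in_uniq ?enum_uniq //.
    by move=> x y; rewrite !mem_enum; apply: f_inj.
  move=> y; rewrite mem_enum; apply/imsetP/mapP => -[x xV ->]; exists x => //.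
    by rewrite mem_enum.
  by rewrite -mem_enum.
apply: uniq_perm; rewrite ?permutations_uniq //.
  rewrite map_inj_in_uniq ?permutations_uniq // => s t.
  rewrite !mem_permutations => sV tV.
  have sub u : perm_eq u (enum V) -> {in u, forall x, x \in V}.
    by move=> uV x; rewrite (perm_mem uV) mem_enum.
  have {sV tV} := (sub _ sV, sub _ tV); move=> [].
  elim: s t => [|x s IH] [|y t] //= sV tV [fxy fst].
  have xV : x \in V by apply: sV; rewrite inE eqxx.
  have yV : y \in V by apply: tV; rewrite inE eqxx.
  congr (_ :: _); first exact: f_inj.
  by apply: IH => // z zs; [apply: sV|apply: tV]; rewrite inE zs orbT.
move=> s; rewrite mem_permutations; apply/idP/mapP => [sV|[t tV ->]]; last first.
  rewrite mem_permutations in tV; apply: perm_trans (perm_map f tV) _.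
  by rewrite perm_sym.
(* As [f] is injective only on [V], a partial inverse is used to recover the preimage of a word. *)
have [g' g'K] : exists g' : T' -> option T, {in V, forall x, g' (f x) = Some x}.
  exists (fun y => [pick x in V | f x == y]) => x xV.
  case: pickP => [z /andP[zV /eqP /f_inj ->]|/(_ x)] //.
  by rewrite xV eqxx.
exists (pmap g' s).
  rewrite mem_permutations.
  apply: perm_trans (perm_pmap g' (perm_trans sV pV)) _.
  have: {in enum V, forall x, g' (f x) = Some x}.
    by move=> x; rewrite mem_enum; apply: g'K.
  elim: (enum V) => //= x u IH h; rewrite h ?inE ?eqxx //= perm_cons.
  by apply: IH => z zu; apply: h; rewrite inE zu orbT.
have: {in s, forall y, exists2 x, x \in V & y = f x}.
  move=> y; rewrite (perm_mem sV) mem_enum => /imsetP[x xV ->]; by exists x.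
elim: s {sV} => //= y s IH h.
have [x xV ->] := h y (mem_head _ _).
rewrite g'K //= -IH // => z zs; by apply: h; rewrite inE zs orbT.
Qed.
End LinearExtensions.

(** * Forests attached to a vertex *)

Section LamEIso.
Variables (R : choiceType) (n : nat).

(** Labels only have to be congruent, so that renaming nodes and changing representatives of labels
    are one operation. *)
Lemma LamE_iso (T T' : finType) (f : T -> T') (V : {set T}) (V' : {set T'})
    (e : rel T) (e' : rel T') (lab : T -> words R) (lab' : T' -> words R) :
  {in V &, injective f} -> f @: V = V' ->
  {in V &, forall x y, e x y = e' (f x) (f y)} ->
  {in V, forall x, eqm n (lab x) (lab' (f x))} ->
  eqm n (LamE V e lab) (LamE V' e' lab').
Proof.
move=> f_inj <- ee' ll'.
rewrite /LamE (perm_big _ (perm_map_permutations f_inj)) big_map /=.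
rewrite big_seq_cond [X in eqm _ _ X]big_seq_cond.
set F := (X in eqm _ X _).
rewrite (_ : F = \sum_(s <- permutations (enum V) |
    (s \in permutations (enum V)) && linear_ext e' (map f s)) \prod_(v <- s) lab v).
  apply: eqm_sum => s /andP[]; rewrite mem_permutations => sV _; rewrite big_map.
  apply: eqm_prod => x; rewrite (perm_mem sV) mem_enum; exact: ll'.
apply: eq_bigl => s; case: (boolP (s \in _)) => //=; rewrite mem_permutations => sV.
have mE x : (x \in s) = (x \in V) by rewrite (perm_mem sV) mem_enum.
rewrite /linear_ext all_map; apply: eq_in_all => x; rewrite mE => xV /=.
rewrite all_map; apply: eq_in_all => y; rewrite mE => yV /=.
have idx z : z \in V -> index (f z) (map f s) = index z s.
  move=> zV; have {mE} : {subset s <= V} by move=> t; rewrite mE.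
  elim: (s) => //= t u IH sub; rewrite IH; last first.
    by move=> q qu; apply: sub; rewrite inE qu orbT.
  case: (eqVneq t z) => [->|tz]; first by rewrite eqxx.
  case: eqP => // /f_inj tz'; case/eqP: tz; apply: tz' => //.
  by rewrite sub ?mem_head.
by rewrite ee' // !idx.
Qed.

Lemma LamE_eq (T : finType) (V : {set T}) (e e' : rel T) (lab lab' : T -> words R) :
  {in V &, forall x y, e x y = e' x y} ->
  {in V, forall x, eqm n (lab x) (lab' x)} ->
  eqm n (LamE V e lab) (LamE V e' lab').
Proof. by move=> ee' ll'; apply: (@LamE_iso _ _ id); rewrite ?imset_id. Qed.

Lemma prod_replace (T : eqType) (s : seq T) (t : T) (F G H : T -> words R) :
  uniq s -> t \in s -> F t = G t - H t ->
  (forall x, x \in s -> x != t -> F x = G x /\ G x = H x) ->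
  \prod_(x <- s) F x = \prod_(x <- s) G x - \prod_(x <- s) H x.
Proof.
elim: s => //= a s IH /andP[as_ us]; rewrite inE !big_cons => /predU1P[->|ts] Ft h.
  have h' x : x \in s -> F x = G x /\ G x = H x.
    by move=> xs; apply: h; rewrite ?inE ?xs ?orbT //; apply: contraNneq as_ => <-.
  have -> : \prod_(x <- s) F x = \prod_(x <- s) G x by apply: eq_big_seq => x /h'[].
  have <- : \prod_(x <- s) G x = \prod_(x <- s) H x by apply: eq_big_seq => x /h'[].
  by rewrite Ft mulrBl.
have [||-> <-] := h a; rewrite ?mem_head //.
  by apply: contraNneq as_ => ->.
rewrite IH // ?mulrBr // => x xs xt; apply: h => //; by rewrite inE xs orbT.
Qed.

(** Linearity in the label of [t], which occurs exactly once in every word. *)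
Lemma LamE_replace (T : finType) (V : {set T}) (e : rel T) (t : T)
    (F G H : T -> words R) :
  t \in V -> F t = G t - H t ->
  (forall x, x \in V -> x != t -> F x = G x /\ G x = H x) ->
  LamE V e F = LamE V e G - LamE V e H.
Proof.
move=> tV Ft h; rewrite /LamE -sumrB big_seq_cond [RHS]big_seq_cond; apply: eq_bigr => s.
rewrite mem_permutations => /andP[sV _].
have mE x : (x \in s) = (x \in V) by rewrite (perm_mem sV) mem_enum.
apply: (@prod_replace _ _ t) => //; rewrite ?mE ?(perm_uniq sV) ?enum_uniq //.
by move=> x; rewrite mE; apply: h.
Qed.

End LamEIso.

Section Forests.
Variable (R : choiceType).

(** The nodes to be joined to a new vertex are given by a predicate [fc], since there may be none,
    for a trivial polygon, or several, one in each component of a disjoint union. *)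
Record ftree := FTree {
  ft : finType; fV : {set ft}; fe : rel ft; fl : ft -> words R; fc : pred ft }.

Definition gstar_V (F X : ftree) : {set option (ft F + ft X)} :=
  [set w | match w with None => true | Some (inl a) => a \in fV F | Some (inr b) => b \in fV X end].

Definition gstar_e (out : bool) (F X : ftree) : rel (option (ft F + ft X)) :=
  fun w w' => match w, w' with
  | Some (inl a), Some (inl a') => fe a a'
  | Some (inr b), Some (inr b') => fe b b'
  | None, Some (inl a) => out && fc a
  | None, Some (inr b) => ~~ out && fc b
  | Some (inl a), None => ~~ out && fc a
  | Some (inr b), None => out && fc b
  | _, _ => false
  end.

Definition gstar_l (u : words R) (F X : ftree) (w : option (ft F + ft X)) : words R :=
  match w with None => u | Some (inl a) => fl a | Some (inr b) => fl b end.

(** A new vertex u, with edges to the chosen vertices of F and from those of X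
    if [out] holds, and in the opposite directions otherwise. *)
Definition gstar out u F X := LamE (gstar_V F X) (@gstar_e out F X) (@gstar_l u F X).

Definition fsum (F X : ftree) : ftree := {|
  ft := (ft F + ft X)%type;
  fV := [set w | match w with inl a => a \in fV F | inr b => b \in fV X end];
  fe := fun w w' => match w, w' with
    | inl a, inl a' => fe a a' | inr b, inr b' => fe b b' | _, _ => false end;
  fl := fun w => match w with inl a => fl a | inr b => fl b end;
  fc := fun w => match w with inl a => fc a | inr b => fc b end |}.

Variable n : nat.

Definition fiso (F F' : ftree) :=
  exists f : ft F -> ft F', [/\ {in fV F &, injective f}, f @: fV F = fV F',
    {in fV F &, forall x y, fe x y = fe (f x) (f y)},
    {in fV F, forall x, eqm n (fl x) (fl (f x))} &
    {in fV F, forall x, fc x = fc (f x)}].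

Lemma fiso_refl F : fiso F F.
Proof. by exists id; split=> //; rewrite ?imset_id // => x _; apply: eqm_refl. Qed.

Lemma fiso_sum F1 F1' F2 F2' : fiso F1 F1' -> fiso F2 F2' ->
  fiso (fsum F1 F2) (fsum F1' F2').
Proof.
move=> [f [fi fV_ fe_ fl_ fc_]] [g [gi gV ge gl gc]].
exists (fun w => match w with inl a => inl (f a) | inr b => inr (g b) end); split.
- case=> [a|b] [a'|b']; rewrite !inE //= => aV bV [].
    by move/fi => ->.
  by move/gi => ->.
- apply/setP => w; rewrite !inE; apply/imsetP/idP.
    by case=> -[a|b]; rewrite inE => abV -> /=; rewrite -?fV_ -?gV imset_f.
  case: w => [a|b]; rewrite -?fV_ -?gV => /imsetP[x xV ->].
    by exists (inl x); rewrite ?inE.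
  by exists (inr x); rewrite ?inE.
- by case=> [a|b] [a'|b']; rewrite !inE //= => aV bV; rewrite ?fe_ ?ge.
- by case=> [a|b]; rewrite !inE /= => aV; [apply: fl_|apply: gl].
- by case=> [a|b]; rewrite !inE /= => aV; [apply: fc_|apply: gc].
Qed.

Lemma gstar_iso out u u' F F' X X' : eqm n u u' -> fiso F F' -> fiso X X' ->
  eqm n (gstar out u F X) (gstar out u' F' X').
Proof.
move=> uu' [f [fi fV_ fe_ fl_ fc_]] [g [gi gV ge gl gc]].
apply: (@LamE_iso _ _ _ _ (fun w => match w with
  | None => None | Some (inl a) => Some (inl (f a)) | Some (inr b) => Some (inr (g b)) end)).
- case=> [[a|b]|] [[a'|b']|]; rewrite !inE //= => aV bV [].
    by move/fi => ->.
  by move/gi => ->.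
- apply/setP => w; rewrite !inE; apply/imsetP/idP.
    by case=> -[[a|b]|]; rewrite inE => abV -> //=; rewrite -?fV_ -?gV imset_f.
  case: w => [[a|b]|]; rewrite -?fV_ -?gV.
  + by move=> /imsetP[x xV ->]; exists (Some (inl x)); rewrite ?inE.
  + by move=> /imsetP[x xV ->]; exists (Some (inr x)); rewrite ?inE.
  + by exists None; rewrite ?inE.
- by case=> [[a|b]|] [[a'|b']|]; rewrite !inE //= => aV bV; rewrite ?fe_ ?ge ?fc_ ?gc.
- by case=> [[a|b]|]; rewrite !inE /= => aV //; [apply: fl_|apply: gl].
Qed.

(** Lets one cancellation serve for the incoming and for the outgoing polygons around a 2-gon. *)
Lemma gstar_swap out u F X : eqm n (gstar out u F X) (gstar (~~ out) u X F).
Proof.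
apply: (@LamE_iso _ _ _ _ (fun w => match w with
  | None => None | Some (inl a) => Some (inr a) | Some (inr b) => Some (inl b) end)).
- by case=> [[a|b]|] [[a'|b']|]; rewrite !inE //= => aV bV [->].
- apply/setP => w; rewrite !inE; apply/imsetP/idP.
    by case=> -[[a|b]|]; rewrite inE => abV ->.
  case: w => [[a|b]|] wV; [exists (Some (inr a))|exists (Some (inl b))|exists None];
    by rewrite ?inE.
- by case=> [[a|b]|] [[a'|b']|]; rewrite //= ?negbK.
- by case=> [[a|b]|] _ /=; apply: eqm_refl.
Qed.

Lemma gstarB out u u' F X : gstar out (u - u') F X = gstar out u F X - gstar out u' F X.
Proof.
apply: (@LamE_replace _ _ _ _ None); rewrite ?inE //.
by case=> [[a|b]|].
Qed.

End Forests.

(** * Cancellation along a chain *)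

Section Valley.
Variables (m c : nat) (x : nat -> nat).

(** [x p] is the position in a word of the [p]-th node of a chain and [c] that of a new vertex. The
    chain is cut before node [j]; positions increase away from the cut, and the new vertex precedes
    the nodes next to it. For [j = 0] and [j = m.+1] one of the two parts is empty. *)
Definition vchain (j : nat) : bool :=
  [&& (0 < j)%N ==> (c < x j.-1)%N, (j <= m)%N ==> (c < x j)%N &
    [forall p : 'I_m, ((p.+1 < j)%N ==> (x p.+1 < x p)%N) &&
                      ((j < p.+1)%N ==> (x p < x p.+1)%N)]].

Definition vmin (j : nat) : bool :=
  [&& (j <= m)%N, (c < x j)%N &
    [forall p : 'I_m, ((p < j)%N ==> (x p.+1 < x p)%N) &&
                      ((j <= p)%N ==> (x p < x p.+1)%N)]].

Hypothesis x_inj : forall p, (p < m)%N -> x p != x p.+1.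

(** The special elements of a word counted by [vchain j] have their positions
    decreasing, then increasing, so that its lowest one is [j.-1] or [j]; it is
    thus counted for exactly two consecutive values of [j]. *)
Lemma vchain_min j : (j <= m.+1)%N ->
  (vchain j : nat) = (((0 < j)%N && vmin j.-1) + vmin j)%N.
Proof.
move=> jm.
have chainP : reflect [/\ (0 < j)%N -> (c < x j.-1)%N, (j <= m)%N -> (c < x j)%N &
    forall p, (p < m)%N -> ((p.+1 < j)%N -> (x p.+1 < x p)%N) /\ ((j < p.+1)%N -> (x p < x p.+1)%N)]
    (vchain j).
  apply: (iffP and3P) => -[h1 h2 h3]; split; try exact/implyP.
    by move=> p pm; have /forallP /(_ (Ordinal pm)) /andP[/implyP h /implyP h'] := h3.
  by apply/forallP => p; have [h h'] := h3 p (ltn_ord p); apply/andP; split; apply/implyP.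
have minP k : reflect [/\ (k <= m)%N, (c < x k)%N &
    forall p, (p < m)%N -> ((p < k)%N -> (x p.+1 < x p)%N) /\ ((k <= p)%N -> (x p < x p.+1)%N)]
    (vmin k).
  apply: (iffP and3P) => -[h1 h2 h3]; split => //.
    by move=> p pm; have /forallP /(_ (Ordinal pm)) /andP[/implyP h /implyP h'] := h3.
  by apply/forallP => p; have [h h'] := h3 p (ltn_ord p); apply/andP; split; apply/implyP.
case: j => [|j] /= in jm chainP *.
  by rewrite add0n; congr (nat_of_bool _).
case: (ltnP j m) => [lt_jm|le_mj]; last first.
  have -> : vmin j.+1 = false by apply/minP => -[]; lia.
  rewrite addn0; congr (nat_of_bool _); apply/chainP/minP => -[h1 h2 h3].
    split; [lia|by apply: h1|] => p pm; have [h h'] := h3 p pm.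
    by split=> pj; [apply: h; lia|lia].
  split=> //; first lia.
  by move=> p pm; have [h h'] := h3 p pm; split=> pj; [apply: h; lia|apply: h'; lia].
have := x_inj lt_jm; rewrite neq_ltn => /orP[lt|lt].
  have -> : vmin j.+1 = false.
    by apply/minP => -[h1 h2 h3]; have [h _] := h3 j lt_jm; have := h (ltnSn j); lia.
  rewrite addn0; congr (nat_of_bool _); apply/chainP/minP => -[h1 h2 h3].
    split; [lia|by apply: h1|] => p pm; have [h h'] := h3 p pm.
    split=> pj; first by apply: h; lia.
    have [->//|ne] := eqVneq p j; apply: h'; lia.
  split=> //; first lia.
  by move=> p pm; have [h h'] := h3 p pm; split=> pj; [apply: h; lia|apply: h'; lia].
have -> : vmin j = false.
  by apply/minP => -[h1 h2 h3]; have [_ h] := h3 j lt_jm; have := h (leqnn j); lia.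
rewrite add0n; congr (nat_of_bool _); apply/chainP/minP => -[h1 h2 h3].
  split=> //; first exact: h2.
  move=> p pm; have [h h'] := h3 p pm.
  split=> pj; last by apply: h'; lia.
  have [->//|ne] := eqVneq p j; apply: h; lia.
split=> //; first by move=> _ /=; lia.
by move=> p pm; have [h h'] := h3 p pm; split=> pj; [apply: h; lia|apply: h'; lia].
Qed.

(** By [vchain_min] the sum telescopes: the terms up to [k] add up to [(-1) ^+ k * (vmin k)%:R], and
    the chain has no node [m.+1]. *)
Lemma valley_sum : \sum_(j < m.+2) (-1) ^+ j * (vchain j)%:R = 0 :> rat.
Proof.
rewrite (eq_bigr (fun j : 'I_m.+2 => (-1) ^+ j *
    (((0 < j)%N && vmin j.-1)%:R + (vmin j)%:R))); last first.
  by move=> [j jm] _; rewrite /= vchain_min ?natrD.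
have tel k : \sum_(j < k.+1) (-1) ^+ j * (((0 < j)%N && vmin j.-1)%:R + (vmin j)%:R)
    = (-1) ^+ k * (vmin k)%:R :> rat.
  elim: k => [|k IH]; first by rewrite big_ord1 /= add0r.
  by rewrite big_ord_recr /= IH exprS mulN1r !mulNr mulrDr opprD addrA subrr add0r.
by rewrite tel (_ : vmin m.+1 = false) ?mulr0 // /vmin ltnn.
Qed.
End Valley.

(** * Alternating sums over the cuts of a chain of nodes *)

Section Antipode.
Variables (R : choiceType) (T : finType) (V : {set T}) (lab : T -> words R).
Variables (m : nat) (r : nat -> T) (w : T) (e0 : rel T) (out : bool).

(** The edges that change with the cut: [r 0, ..., r m] is a chain cut before [r j], both parts are
    oriented away from the cut, and [w] is joined to the nodes next to it. *)
Definition cut_edges (j : nat) : rel T := fun x y =>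
  [|| [exists p : 'I_m, ((p.+1 < j)%N && (x == r p.+1) && (y == r p))
                     || ((j < p.+1)%N && (x == r p) && (y == r p.+1))],
      (0 < j)%N && (x == w) && (y == r j.-1) | (j <= m)%N && (x == w) && (y == r j)].

Definition cut_rel (j : nat) : rel T := fun x y =>
  e0 x y || (if out then cut_edges j x y else cut_edges j y x).

Hypotheses (wV : w \in V) (rV : forall p, (p <= m)%N -> r p \in V).
Hypothesis r_inj : forall p q, (p <= m)%N -> (q <= m)%N -> r p = r q -> p = q.

(** When the edges of the chain are reversed, positions are counted from the end of the word, so
    that the same inequalities describe both orientations. *)
Lemma linear_ext_cut (s : seq T) (j : nat) : perm_eq s (enum V) -> (j <= m.+1)%N ->
  let pos t := if out then index t s else (size s - index t s)%N in
  linear_ext (cut_rel j) s =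
  linear_ext e0 s && vchain m (pos w) (fun p => pos (r p)) j.
Proof.
move=> sV jm pos.
have mE x : (x \in s) = (x \in V) by rewrite (perm_mem sV) mem_enum.
have idx x : x \in V -> (index x s < size s)%N by rewrite index_mem mE.
have posE x y : x \in V -> y \in V ->
    (pos x < pos y)%N = if out then (index x s < index y s)%N else (index y s < index x s)%N.
  move=> xV yV; rewrite /pos; case: (out) => //.
  have := idx _ xV; have := idx _ yV; lia.
have cutP : reflect {in V &, forall x y, cut_edges j x y -> (pos x < pos y)%N}
    (vchain m (pos w) (fun p => pos (r p)) j).
  apply: (iffP and3P).
    case=> h1 h2 /forallP h3 x y xV yV /or3P[/existsP[p]|/andP[/andP[jp /eqP->] /eqP->]|/andP[/andP[jp /eqP->] /eqP->]].
    - have /andP[/implyP h /implyP h'] := h3 p.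
      by case/orP => /andP[/andP[pj /eqP->] /eqP->]; [apply: h|apply: h'].
    - by move/implyP: h1; apply.
    - by move/implyP: h2; apply.
  move=> h; split.
  - apply/implyP => j0; apply: h; rewrite ?rV //; first lia.
    by rewrite /cut_edges j0 !eqxx orbT.
  - apply/implyP => j0; apply: h; rewrite ?rV //.
    by rewrite /cut_edges j0 !eqxx !orbT.
  - apply/forallP => p; have pm := ltn_ord p; apply/andP; split; apply/implyP => pj.
      apply: h; rewrite ?rV //; first lia.
      by apply/or3P; apply: Or31; apply/existsP; exists p; rewrite pj !eqxx.
    apply: h; rewrite ?rV //; first lia.
    by apply/or3P; apply: Or31; apply/existsP; exists p; rewrite pj !eqxx orbT.
apply/(linear_extP _ sV)/andP => [h|[/(linear_extP _ sV) h0 /cutP h] x y xV yV].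
  split; first by apply/(linear_extP _ sV) => x y xV yV e; apply: h; rewrite // /cut_rel e.
  apply/cutP => x y xV yV c; rewrite posE //.
  case E: out; apply: h => //; by rewrite /cut_rel E c orbT.
case/orP => [/h0|]; first exact.
by case E: out => /h; rewrite posE // E; apply.
Qed.

(** Once the sums are exchanged, the coefficient of each word is an alternating sum of [vchain]. If
    [w] and the chain are the only nodes and [e0] is empty, this is the antipode identity of the
    shuffle product: initial segments are reversed and shuffled with the remaining final ones. *)
Lemma antipode_sum : \sum_(j < m.+2) (-1) ^+ j *: LamE V (cut_rel j) lab = 0.
Proof.
pose F (s : seq T) := \prod_(v <- s) lab v.
pose C j s := linear_ext (cut_rel j) s.
have E j : LamE V (cut_rel j) lab =
    \sum_(s <- permutations (enum V)) (C j s)%:R *: F s.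
  rewrite /LamE big_mkcond; apply: eq_bigr => s _; rewrite /C.
  by case: ifP; rewrite ?scale1r ?scale0r.
rewrite (eq_bigr (fun j : 'I_m.+2 =>
    \sum_(s <- permutations (enum V)) ((-1) ^+ j * (C j s)%:R) *: F s)); last first.
  by move=> j _; rewrite E scaler_sumr; apply: eq_bigr => s _; rewrite scalerA.
rewrite exchange_big big_seq big1 // => s; rewrite mem_permutations => sV.
rewrite -scaler_suml.
have mE x : (x \in s) = (x \in V) by rewrite (perm_mem sV) mem_enum.
pose pos t := if out then index t s else (size s - index t s)%N.
rewrite (eq_bigr (fun j : 'I_m.+2 => (linear_ext e0 s)%:R *
    ((-1) ^+ j * (vchain m (pos w) (fun p => pos (r p)) j)%:R))); last first.
  move=> j _; rewrite /C linear_ext_cut //; last by case: j => j /=; lia.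
  by case: (linear_ext e0 s); rewrite ?mul1r ?mul0r ?mulr0.
rewrite -mulr_sumr valley_sum ?mulr0 ?scale0r // => p pm.
apply/negP => /eqP E'.
have rE: index (r p) s = index (r p.+1) s.
  have : (index (r p) s < size s)%N by rewrite index_mem mE rV // ltnW.
  have : (index (r p.+1) s < size s)%N by rewrite index_mem mE rV.
  by move: E'; rewrite /pos; case: (out) => //; lia.
have := @r_inj p p.+1 (ltnW pm) pm.
have : nth (r p) s (index (r p) s) = nth (r p) s (index (r p.+1) s) by rewrite rE.
rewrite !nth_index ?mE ?rV // ?(ltnW pm) // => -> /(_ erefl); lia.
Qed.
End Antipode.

(** * Changing labels one node at a time *)

Section Hybrid.
Variables (R : choiceType) (T : finType) (V : {set T}) (e : rel T).
Variables (lE lS : T -> words R) (rank : T -> nat).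

Definition hybrid k t := if (rank t < k)%N then lS t else lE t.

Lemma hybrid_telescope K : {in V, forall t, (rank t < K)%N} ->
  LamE V e lE - LamE V e lS =
  \sum_(k < K) (LamE V e (hybrid k) - LamE V e (hybrid k.+1)).
Proof.
move=> rK; rewrite -(big_mkord xpredT (fun k => LamE V e (hybrid k) - LamE V e (hybrid k.+1))).
under eq_bigr do rewrite -opprB.
rewrite sumrN telescope_sumr // opprB; congr (_ - _).
rewrite /LamE big_seq_cond [RHS]big_seq_cond; apply: eq_bigr => s.
rewrite mem_permutations => /andP[sV _]; apply: eq_big_seq => t.
by rewrite /hybrid (perm_mem sV) mem_enum => /rK ->.
Qed.
End Hybrid.

Local Close Scope ring_scope.

(** * Arrows and gaps in coordinates *)

(** [lft N i j J t]: the gap [(J, t)] is on the left of the arrow [(i, j)]. *)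
Definition lft (N i j J t : nat) : bool :=
  if i <= j then ~~ ((i <= J) && ((J < j) || ((J == j) && (t < j - i))))
  else ((j < J) || ((J == j) && (j + N - i <= t))) && (J < i).

(** [j - i] modulo [N], the offset of the end of the arrow within side [j], in a form suited to
    linear arithmetic. *)
Definition aoff (N i j : nat) := if i <= j then j - i else j + N - i.

(** The chords of the arrows [(i, j)] and [(i', j')] cross: vertex [i'] and side
    [j'] are on different sides of the former. *)
Definition interleave (i j i' j' : nat) : bool :=
  [&& i != i', j != j' &
      if i <= j then (i < i' <= j) != (i <= j' < j) else (j < i' < i) != (j < j' < i)].

Lemma interleaveC i j i' j' : interleave i j i' j' = interleave i' j' i j.
Proof.
by rewrite /interleave; case: (leqP i j) => ij; case: (leqP i' j') => ij'; lia.
Qed.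

Lemma interleave_if i j i' j' : interleave i j i' j' = [&& i != i', j != j' &
    ((i <= j) && ((i < i' <= j) != (i <= j' < j))) ||
    ((j < i) && ((j < i' < i) != (j < j' < i)))].
Proof. by rewrite /interleave; case: (leqP i j) => h; lia. Qed.

Definition nontriv (N i j : nat) : bool :=
  (j != i) && ((if j.+1 == N then 0 else j.+1) != i).

(** Positions are products with the variable [N]; compared lexicographically they stay within linear
    arithmetic, to which the geometry below is reduced. *)
Lemma lex_ltn N J t J' t' : t < N -> t' < N ->
  (J * N + t < J' * N + t') = (J < J') || ((J == J') && (t < t')).
Proof.
move=> tN t'N; case: (ltngtP J J') => [lt|lt|->] /=.
- have : J.+1 * N <= J' * N by rewrite leq_mul2r lt orbT.
  rewrite mulSn; lia.
- have : J'.+1 * N <= J * N by rewrite leq_mul2r lt orbT.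
  rewrite mulSn; lia.
- by rewrite ltn_add2l.
Qed.

Lemma lex_leq N J t J' t' : t < N -> t' < N ->
  (J * N + t <= J' * N + t') = (J < J') || ((J == J') && (t <= t')).
Proof. by move=> tN t'N; rewrite leqNgt lex_ltn //; lia. Qed.

Lemma aoff_mod N i j : i < N -> j < N -> (j + N - i) %% N = aoff N i j.
Proof.
move=> iN jN; rewrite /aoff; case: leqP => ij.
  by rewrite -addnBAC // modnDr modn_small //; lia.
by rewrite modn_small //; lia.
Qed.

Section Gaps.
Variable N : nat.
Implicit Types (a b : arrow N) (h g : gap N) (d : {set arrow N}) (r : {set gap N}).

Lemma gpos_lt h : gpos h < N * N.
Proof.
have := ltn_ord h.1; have := ltn_ord h.2; rewrite /gpos => h2 h1.
have : h.1.+1 * N <= N * N by rewrite leq_mul2r h1 orbT.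
rewrite mulSn; lia.
Qed.

Lemma gpos_inj : injective (@gpos N).
Proof.
case=> [j t] [j' t']; rewrite /gpos /= => E.
have := @lex_ltn N j t j' t' (ltn_ord _) (ltn_ord _).
have := @lex_ltn N j' t' j t (ltn_ord _) (ltn_ord _).
rewrite E ltnn => h1 h2; congr (_, _); apply: val_inj => /=; lia.
Qed.

(** The gaps just after and just before the end of an arrow. *)
Definition endg a : gap N := (a.2, insubd a.1 (aoff N a.1 a.2)).
Definition preg a : gap N := (a.2, insubd a.1 (aoff N a.1 a.2).-1).

Lemma aoff_lt a : aoff N a.1 a.2 < N.
Proof. by rewrite -aoff_mod // ltn_pmod //; have := ltn_ord a.1; lia. Qed.

Lemma endg2 a : (endg a).2 = aoff N a.1 a.2 :> nat.
Proof. by rewrite val_insubd aoff_lt. Qed.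

Lemma preg2 a : (preg a).2 = (aoff N a.1 a.2).-1 :> nat.
Proof. by rewrite val_insubd ifT //; have := aoff_lt a; lia. Qed.

Lemma aendE a : aend a = gpos (endg a).
Proof. by rewrite /aend /gpos endg2 aoff_mod. Qed.

Lemma aend_predE a : a.1 != a.2 -> (aend a).-1 = gpos (preg a).
Proof.
rewrite -val_eqE /= => ne; rewrite /aend /gpos preg2 aoff_mod //=.
have : 0 < aoff N a.1 a.2.
  by have := ltn_ord a.2; have := ltn_ord a.1; rewrite /aoff; case: ifP; lia.
lia.
Qed.

Lemma on_leftE a h : a.1 != a.2 -> on_left a (gpos h) = lft N a.1 a.2 h.1 h.2.
Proof.
case: a h => i j [J t] /=; rewrite -val_eqE /= => ij.
have [[[iN jN] JN] tN] := (ltn_ord i, ltn_ord j, ltn_ord J, ltn_ord t).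
have N0 : 0 < N by lia.
have oN : aoff N i j < N by rewrite /aoff; case: ifP; lia.
rewrite /on_left /astart /aend /gpos /= aoff_mod // -(addn0 (i * N)).
rewrite !lex_ltn ?lex_leq // /lft /aoff.
case: (leqP i j) => h; first by rewrite ifT; lia.
by rewrite ifF; lia.
Qed.

Lemma nontrivialE a : nontrivial a = nontriv N a.1 a.2.
Proof.
case: a => i j; rewrite /nontrivial /nontriv -!val_eqE /=.
have jN := ltn_ord j; have [E|ne] := eqVneq j.+1 N; first by rewrite E modnn.
by rewrite modn_small //; lia.
Qed.

Lemma nontrivial_neq a : nontrivial a -> a.1 != a.2.
Proof. by case/andP; rewrite eq_sym. Qed.

Lemma astartE a : astart a = gpos (a.1, insubd a.1 0).
Proof. by rewrite /astart /gpos val_insubd /= ifT ?addn0 //; have := ltn_ord a.1; lia. Qed.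

Lemma lft_interleave i j i' j' : i < N -> j < N -> i' < N -> j' < N ->
  nontriv N i j -> nontriv N i' j' ->
  (i != i') && (lft N i j i' 0 != lft N i j j' (aoff N i' j')) = interleave i j i' j'.
Proof.
move=> iN jN i'N j'N; rewrite /nontriv /lft /aoff /interleave.
case: (leqP i j) => ij; case: (leqP i' j') => ij'; lia.
Qed.

Lemma crossesE a b : nontrivial a -> nontrivial b ->
  crosses a b = interleave a.1 a.2 b.1 b.2.
Proof.
move=> na nb; rewrite /crosses astartE aendE !on_leftE ?nontrivial_neq //.
rewrite /= val_insubd val_insubd aoff_lt (_ : 0 < N); last by have := ltn_ord a.1; lia.
by rewrite -val_eqE; apply: (@lft_interleave a.1 a.2 b.1 b.2); rewrite -?nontrivialE.
Qed.

Lemma dissP d : reflect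
  ({in d, forall a, nontrivial a} /\
   {in d &, forall a b, ~~ interleave a.1 a.2 b.1 b.2}) (d \in dissections N).
Proof.
rewrite inE; apply: (iffP forall_inP) => [h|[h1 h2] a ad].
  have h1 : {in d, forall a, nontrivial a} by move=> a /h /andP[].
  split=> // a b ad bd; have /andP[_ /forall_inP /(_ b bd)] := h a ad.
  have [->|/= _] := eqVneq a b; last by rewrite crossesE // h1.
  by move=> _; rewrite /interleave eqxx.
rewrite h1 //=; apply/forall_inP => b bd; apply/implyP => _.
by rewrite crossesE ?h1 // h2.
Qed.

(** [blo] and [bhi] bound the part of the boundary between the two ends of an arrow, whatever its
    direction; whether the arrow separates two gaps depends only on this interval. *)
Definition blo a := minn (astart a) (aend a).
Definition bhi a := maxn (astart a) (aend a).
Definition bey a k := (blo a <= k) && (k < bhi a).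

Lemma on_left_bey a k : on_left a k = bey a k (+) (astart a < aend a).
Proof. rewrite /on_left /bey /blo /bhi; case: ltnP => h; lia. Qed.

Lemma on_left_eq a k k' : (on_left a k == on_left a k') = (bey a k == bey a k').
Proof. rewrite !on_left_bey; case: bey; case: bey; case: (_ < _) => //. Qed.

(** Intervals of non-crossing arrows are nested or disjoint. The strict inequalities leave room for
    arrows with a common starting vertex. *)
Lemma laminar a b : nontrivial a -> nontrivial b -> ~~ interleave a.1 a.2 b.1 b.2 ->
  ~~ [&& blo a < blo b, blo b < bhi a & bhi a < bhi b].
Proof.
case: a b => i j [i' j'] na nb; have /= := nontrivialE (i, j); have /= := nontrivialE (i', j').
rewrite na nb => /esym nb' /esym na' /=; move: na' nb'.
have [[[iN jN] i'N] j'N] := (ltn_ord i, ltn_ord j, ltn_ord i', ltn_ord j').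
have N0 : 0 < N by lia.
have oN : aoff N i j < N by rewrite /aoff; case: ifP; lia.
have oN' : aoff N i' j' < N by rewrite /aoff; case: ifP; lia.
rewrite /blo /bhi /astart /aend /= !aoff_mod // -(addn0 (i * N)) -(addn0 (i' * N)).
rewrite /minn /maxn !lex_ltn // => na' nb' nx.
have E : ((i < j) || (i == j :> nat) && (0 < aoff N i j)) = (i <= j).
  by move: na'; rewrite /nontriv /aoff; case: ifP; lia.
have E' : ((i' < j') || (i' == j' :> nat) && (0 < aoff N i' j')) = (i' <= j').
  by move: nb'; rewrite /nontriv /aoff; case: ifP; lia.
rewrite E E'; move: nx na' nb'; rewrite /interleave /nontriv /aoff.
case: (leqP i j) => ij; case: (leqP i' j') => ij'; rewrite !lex_ltn //; lia.
Qed.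

Definition agree a h g := on_left a (gpos h) == on_left a (gpos g).

(** Non-crossing arrows do not cut the boundary into four parts. *)
Lemma quadrants a b h1 h2 h3 h4 : nontrivial a -> nontrivial b ->
  ~~ interleave a.1 a.2 b.1 b.2 ->
  agree a h1 h2 -> ~~ agree b h1 h2 -> ~~ agree a h1 h3 -> agree b h1 h3 ->
  ~~ agree a h1 h4 -> ~~ agree b h1 h4 -> False.
Proof.
move=> na nb nx; rewrite /agree !on_left_eq /bey.
have := laminar na nb nx; have := laminar nb na.
rewrite interleaveC => /(_ nx); lia.
Qed.

Lemma mem_region d k h :
  (h \in region_at d k) = [forall a in d, on_left a (gpos h) == on_left a k].
Proof. by rewrite inE. Qed.

Lemma regionP d g h :
  reflect {in d, forall a, agree a h g} (h \in region_at d (gpos g)).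
Proof. by rewrite mem_region; apply: forall_inP. Qed.

Lemma region_refl d g : g \in region_at d (gpos g).
Proof. by apply/regionP => a _; rewrite /agree. Qed.

Lemma region_eqP d g h :
  reflect (region_at d (gpos g) = region_at d (gpos h)) (g \in region_at d (gpos h)).
Proof.
apply: (iffP (regionP _ _ _)) => [gh|E a ad].
  apply/setP => k; rewrite !mem_region; apply: eq_forallb => a.
  by case: (boolP (a \in d)) => //= ad; rewrite (eqP (gh a ad)).
have: g \in region_at d (gpos h) by rewrite -E region_refl.
by move/regionP; apply.
Qed.

Lemma regionsP d r :
  reflect (1 < N /\ exists g, r = region_at d (gpos g)) (r \in regions d).
Proof.
apply: (iffP imsetP) => [[g]|[N1 [g ->]]]; last by exists g; rewrite ?inE.
by rewrite inE /= => N1 ->; split=> //; exists g.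
Qed.

Lemma endg_left a : nontrivial a -> on_left a (gpos (endg a)).
Proof.
move=> na; rewrite on_leftE ?nontrivial_neq // endg2 /=; rewrite nontrivialE in na.
have := ltn_ord a.1; have := ltn_ord a.2; move: na; rewrite /lft /aoff /nontriv.
by case: (leqP a.1 a.2) => h; lia.
Qed.

Lemma preg_right a : nontrivial a -> ~~ on_left a (gpos (preg a)).
Proof.
move=> na; rewrite on_leftE ?nontrivial_neq // preg2 /=; rewrite nontrivialE in na.
have := ltn_ord a.1; have := ltn_ord a.2; move: na; rewrite /lft /aoff /nontriv.
by case: (leqP a.1 a.2) => h; lia.
Qed.

(** The two gaps are adjacent, and no other arrow has an end at the point between them. *)
Lemma end_agree a b : nontrivial a -> nontrivial b -> a != b -> agree b (endg a) (preg a).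
Proof.
case: a b => i j [i' j'] na nb; rewrite /agree !on_leftE ?nontrivial_neq // endg2 preg2 /=.
move: na nb; rewrite !nontrivialE xpair_eqE -!val_eqE /=.
have [[[iN jN] i'N] j'N] := (ltn_ord i, ltn_ord j, ltn_ord i', ltn_ord j').
rewrite /nontriv /lft /aoff; case: (leqP i j) => ij; case: (leqP i' j') => ij'; lia.
Qed.

Lemma same_side_agree a h g : nontrivial a -> h.1 = g.1 -> h.1 != a.2 -> agree a h g.
Proof.
case: a h g => i j [J t] [J' t'] na /= <-; rewrite -val_eqE /= => ne.
by rewrite /agree !on_leftE ?nontrivial_neq //= /lft; case: (leqP i j) => h; lia.
Qed.

Lemma agree_sym a h g : agree a h g = agree a g h.
Proof. by rewrite /agree eq_sym. Qed.

Lemma agree_trans a g h k : agree a h g -> agree a g k -> agree a h k.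
Proof. by rewrite /agree => /eqP -> /eqP ->. Qed.

End Gaps.

(** * The root side of a region *)

(** The sides across the arrow from a gap of [c] form an arc with [j] at one end. Restarting the
    cyclic order after [j] instead of after [c] must only move [j] to the end: either no other side
    of the arc lies between [c] and [j], or the arc lies entirely after [c], or entirely before
    it. *)
Lemma arc_order N i j c tc : i < N -> j < N -> c < N -> tc < N ->
  nontriv N i j -> c != j ->
  let S J := exists2 t, t < N & (J < N) && (lft N i j J t != lft N i j c tc) in
  [\/ forall J, S J -> ((c < J) && (J != j) = (j < J)) /\ ((J < c) && (J != j) = (J < j)),
      forall J, S J -> (c < J) /\ (J <= j) |
      forall J, S J -> (J < c) /\ (j <= J)].
Proof.
rewrite /nontriv /lft; move=> iN jN cN tN ij cj; cbv zeta.
case: (leqP i j) => h.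
  case: (ltnP c i) => ci.
    by apply: Or32 => J [t tN' /andP[JN]]; lia.
  case: (ltnP j c) => jc; apply: Or31 => J [t tN' /andP[JN]]; lia.
case: (ltnP c j) => cj'.
  by apply: Or31 => J [t tN' /andP[JN]]; lia.
case: (ltnP c i) => ci.
  by apply: Or31 => J [t tN' /andP[JN]]; lia.
by apply: Or33 => J [t tN' /andP[JN]]; lia.
Qed.

Section Subpolygon.
Variable N : nat.
Implicit Types (a b : arrow N) (h g : gap N) (d : {set arrow N}) (r : {set gap N}).

(** Contracting arrows leaves the root side [rho] in [r], or else the side where
    the last arrow separating [r] from it ends. *)
Definition is_root d r (rho : nat) (c : 'I_N) : Prop :=
  (exists2 h, h \in r & h.1 = c) /\
  (c = rho :> nat \/ {in r, forall h, h.1 != rho :> nat} /\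
   exists2 a, a \in d & a.2 = c /\
     forall h g, h \in r -> g.1 = rho :> nat -> ~~ agree a h g).

Lemma mem_all_gaps h : h \in all_gaps N.
Proof. by case: h => j t; apply/allpairsP; exists (j, t); rewrite !mem_enum. Qed.

(** The gaps in [G] in cyclic order, those of the side [c] last. *)
Definition gap_split (G : pred (gap N)) (c : 'I_N) : seq (gap N) :=
  [seq h <- all_gaps N | G h && (c < h.1)] ++
  [seq h <- all_gaps N | G h && (h.1 < c)] ++ [seq h <- all_gaps N | G h && (h.1 == c)].

Lemma mem_unzip1 (G : pred (gap N)) (s : seq (gap N)) (c : 'I_N) :
  (forall h, (h \in s) = G h) -> (c \in unzip1 s) = [exists t, G (c, t)].
Proof.
move=> sG; apply/mapP/existsP => [[[j t] hs /= ->]|[t Gt]].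
  by exists t; rewrite -sG.
by exists (c, t) => //; rewrite sG.
Qed.

Lemma mem_gap_split G c h : (h \in gap_split G c) = G h.
Proof.
rewrite !mem_cat !mem_filter mem_all_gaps -val_eqE /=.
by case: (G h) => //=; rewrite !andbT; case: ltngtP.
Qed.

Lemma last_gap_split x (G : pred (gap N)) c : (exists2 h, G h & h.1 = c) ->
  last x (unzip1 (gap_split G c)) = c.
Proof.
move=> [h Gh hc]; rewrite /unzip1 !map_cat !last_cat.
set s := map fst [seq h <- all_gaps N | G h && (h.1 == c)].
have : c \in s by apply/mapP; exists h; rewrite // mem_filter mem_all_gaps Gh hc eqxx.
have : {in s, forall y, y = c}.
  by move=> y /mapP[k]; rewrite mem_filter => /andP[/andP[_ /eqP <-] _].
case: s => //= y s sc _.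
by apply: sc; rewrite mem_last.
Qed.

Lemma filter_gap_split (p : pred (gap N)) G c :
  [seq h <- gap_split G c | p h] = gap_split (fun h => G h && p h) c.
Proof.
rewrite /gap_split !filter_cat -!filter_predI.
by congr (_ ++ (_ ++ _)); apply: eq_filter => h /=; case: (G h) => //=; rewrite ?andbT ?andbF.
Qed.

Lemma eq_gap_split G G' c : G =1 G' -> gap_split G c = gap_split G' c.
Proof. by move=> E; congr (_ ++ (_ ++ _)); apply: eq_filter => h; rewrite E. Qed.

(** [contract] only moves the new root side to the end and does not rotate the rest; in the three
    cases of [arc_order] the result is nevertheless the cyclic order ending with [c']. *)
Lemma move_gap_split (G : pred (gap N)) (c c' : 'I_N) :
  c != c' -> (forall h, G h -> h.1 != c) ->
  [\/ forall h, G h -> ((c < h.1) && (h.1 != c') = (c' < h.1)) /\ ((h.1 < c) && (h.1 != c') = (h.1 < c')),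
      forall h, G h -> (c < h.1) /\ (h.1 <= c') |
      forall h, G h -> (h.1 < c) /\ (c' <= h.1)] ->
  [seq h <- gap_split G c | h.1 != c'] ++ [seq h <- gap_split G c | h.1 == c'] =
  gap_split G c'.
Proof.
move=> cc' Gc cases; rewrite !filter_gap_split /gap_split.
have F0 (p : pred (gap N)) : (forall h, p h = false) -> [seq h <- all_gaps N | p h] = [::].
  by move=> p0; rewrite (eq_filter p0) filter_pred0.
rewrite [in X in X ++ _](F0 (fun h => G h && (h.1 != c') && (h.1 == c))); last first.
  by move=> h; case Gh: (G h) => //=; rewrite (negbTE (Gc h Gh)) andbF.
rewrite (F0 (fun h => G h && (h.1 == c') && (h.1 == c))); last first.
  by move=> h; case Gh: (G h) => //=; rewrite (negbTE (Gc h Gh)) andbF.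
rewrite !cats0 catA.
have -> : [seq h <- all_gaps N | G h && (h.1 == c') & c < h.1] ++
   [seq h <- all_gaps N | G h && (h.1 == c') & h.1 < c] = [seq h <- all_gaps N | G h && (h.1 == c')].
  move: cc'; rewrite -val_eqE /= neq_ltn => /orP[lt|lt].
    rewrite (F0 (fun h => G h && (h.1 == c') && (h.1 < c))) ?cats0.
      by apply: eq_filter => h; rewrite -val_eqE /=; case: (G h) => //=; lia.
    by move=> h; rewrite -val_eqE /=; case: (G h) => //=; lia.
  rewrite (F0 (fun h => G h && (h.1 == c') && (c < h.1))) ?cat0s.
    by apply: eq_filter => h; rewrite -val_eqE /=; case: (G h) => //=; lia.
  by move=> h; rewrite -val_eqE /=; case: (G h) => //=; lia.
congr (_ ++ _).
case: cases => H.
- congr (_ ++ _); apply: eq_filter => h; case Gh: (G h) => //=.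
    by have [<- _] := H h Gh; rewrite andbC.
  by have [_ <-] := H h Gh; rewrite andbC.
- rewrite (F0 (fun h => G h && (h.1 != c') && (h.1 < c))) ?cats0; last first.
    by move=> h; case Gh: (G h) => //=; have := H h Gh; lia.
  rewrite (F0 (fun h => G h && (c' < h.1))) ?cat0s; last first.
    by move=> h; case Gh: (G h) => //=; have := H h Gh; lia.
  by apply: eq_filter => h; case Gh: (G h) => //=; have := H h Gh; rewrite -val_eqE /=; lia.
- rewrite (F0 (fun h => G h && (h.1 != c') && (c < h.1))) ?cat0s; last first.
    by move=> h; case Gh: (G h) => //=; have := H h Gh; lia.
  rewrite (F0 (fun h => G h && (h.1 < c'))) ?cats0; last first.
    by move=> h; case Gh: (G h) => //=; have := H h Gh; lia.
  by apply: eq_filter => h; case Gh: (G h) => //=; have := H h Gh; rewrite -val_eqE /=; lia.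
Qed.

Lemma all_gaps_pairwise : pairwise (fun h g : gap N => h.1 <= g.1) (all_gaps N).
Proof.
rewrite /all_gaps; have : pairwise (fun i j : 'I_N => i <= j) (enum 'I_N).
  rewrite -(pairwise_map val leq) val_enum_ord -sorted_pairwise ?iota_sorted //.
  exact: leq_trans.
move: {2}(enum 'I_N) => u; elim: (enum 'I_N) => //= i s IH /andP[iS ss].
rewrite pairwise_cat IH // andbT; apply/andP; split.
  apply/allrelP => h g /mapP[t _ ->] /allpairsP [[j t'] [/= js _ ->]] /=.
  by move/allP: iS; apply.
by rewrite pairwise_map; elim: u {IH} => //= t u ->; rewrite andbT; apply/allP => t' _ /=.
Qed.

Lemma undup_sides (G : pred (gap N)) :
  undup (unzip1 [seq h <- all_gaps N | G h]) = [seq j <- enum 'I_N | [exists t, G (j, t)]].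
Proof.
apply: (inj_map val_inj); apply: (irr_sorted_eq ltn_trans ltnn).
- rewrite ltn_sorted_uniq_leq map_inj_uniq ?undup_uniq /=; last exact: val_inj.
  apply: subseq_sorted (map_subseq _ (undup_subseq _)) _; first exact: leq_trans.
  rewrite (sorted_pairwise leq_trans) -map_comp pairwise_map pairwise_filter //.
  exact: all_gaps_pairwise.
- rewrite ltn_sorted_uniq_leq map_inj_uniq; last exact: val_inj.
  rewrite filter_uniq ?enum_uniq //.
  apply: subseq_sorted (map_subseq _ (filter_subseq _ _)) _; first exact: leq_trans.
  by rewrite val_enum_ord iota_sorted.
- move=> k; apply/mapP/mapP => -[j]; rewrite ?mem_undup ?mem_filter => jG ->; exists j => //.
    rewrite mem_filter mem_enum andbT -(@mem_unzip1 G [seq h <- all_gaps N | G h]) //.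
    by move=> h; rewrite mem_filter mem_all_gaps andbT.
  rewrite mem_undup (@mem_unzip1 G); first by case/andP: jG.
  by move=> h; rewrite mem_filter mem_all_gaps andbT.
Qed.

Lemma undup_cat_disjoint (T : eqType) (s t : seq T) : {in s, forall x, x \notin t} ->
  undup (s ++ t) = undup s ++ undup t.
Proof.
move=> st; rewrite undup_cat; congr (_ ++ _); apply/all_filterP/allP => x.
by rewrite mem_undup => /st.
Qed.

Lemma undup_gap_split (G : pred (gap N)) (c : 'I_N) : (exists2 h, G h & h.1 = c) ->
  undup (unzip1 (gap_split G c)) =
  [seq j <- enum 'I_N | [exists t, G (j, t)] && (c < j)] ++
  [seq j <- enum 'I_N | [exists t, G (j, t)] && (j < c)] ++ [:: c].
Proof.
case=> h Gh hc.
have exb (p : pred 'I_N) j : [exists t, G (j, t) && p j] = [exists t, G (j, t)] && p j.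
  case: (p j); rewrite ?andbT ?andbF.
    by apply: eq_existsb => t; rewrite andbT.
  by apply/existsP => -[t]; rewrite andbF.
have inE' (p : pred 'I_N) j :
    j \in unzip1 [seq h <- all_gaps N | G h && p h.1] = [exists t, G (j, t)] && p j.
  rewrite (@mem_unzip1 (fun h => G h && p h.1)) //=.
  by move=> k; rewrite mem_filter mem_all_gaps andbT.
rewrite /gap_split /unzip1 !map_cat -!/(unzip1 _) !undup_cat_disjoint.
- congr (_ ++ (_ ++ _)); rewrite undup_sides.
  + by apply: eq_filter => j; rewrite (exb (fun j => c < j)).
  + by apply: eq_filter => j; rewrite (exb (fun j => j < c)).
  + rewrite (eq_filter (a2 := pred1 c)); last first.
      move=> j; rewrite (exb (fun j => j == c)) /= andbC; case: eqP => //= ->.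
      by apply/existsP; exists h.2; rewrite -hc; case: (h) Gh.
    by rewrite filter_pred1_uniq ?enum_uniq ?mem_enum.
- move=> j; rewrite (inE' (fun j => j < c)) (inE' (fun j => j == c)) => /andP[_ jc].
  by rewrite negb_and; apply/orP; right; apply: contraL jc => /eqP ->; rewrite ltnn.
- move=> j; rewrite mem_cat (inE' (fun j => j < c)) (inE' (fun j => j == c)).
  rewrite (inE' (fun j => c < j)) => /andP[_ jc]; rewrite negb_or !negb_and.
  rewrite -leqNgt (ltnW jc) orbT /=; apply/orP; right.
  by apply: contraL jc => /eqP ->; rewrite ltnn.
Qed.

Section Fold.
Variables (d : {set arrow N}) (h0 : gap N).
Hypothesis dD : d \in dissections N.
Let r := region_at d (gpos h0).
Let dn a : a \in d -> nontrivial a. Proof. by have /dissP[h _] := dD; apply: h. Qed.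
Let dx a b : a \in d -> b \in d -> ~~ interleave a.1 a.2 b.1 b.2.
Proof. by have /dissP[_ h] := dD; apply: h. Qed.

Definition compat (l : seq (arrow N)) h := all (fun a => agree a h h0) l.

Lemma compat_rcons l a h : compat (rcons l a) h = compat l h && agree a h h0.
Proof. by rewrite /compat all_rcons andbC. Qed.

(** The invariant of the successive contractions: cyclic order, and the condition of [is_root] with
    respect to the arrows contracted so far. *)
Definition contracted (l : seq (arrow N)) (Q : seq (gap N)) := exists c : 'I_N,
  [/\ Q = gap_split (compat l) c, exists2 h, compat l h & h.1 = c &
   c = N.-1 :> nat \/ (forall h, compat l h -> h.1 != N.-1 :> nat) /\
   exists2 a, a \in l & a.2 = c /\
     forall h g, compat l h -> g.1 = N.-1 :> nat -> ~~ agree a h g].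

Lemma contract_step l a Q : {subset l <= d} -> a \in d -> contracted l Q ->
  contracted (rcons l a) (contract r Q a).
Proof.
move=> ld ad [c [-> [hc Ghc hcc] rootc]]; have na := dn ad.
have h0r : h0 \in r by apply: region_refl.
have filtE : [seq h <- gap_split (compat l) c |
    [forall g in r, on_left a (gpos h) == on_left a (gpos g)]] = gap_split (compat (rcons l a)) c.
  rewrite filter_gap_split; apply: eq_gap_split => h; rewrite compat_rcons; congr (_ && _).
  apply/forall_inP/idP => [|ah g /regionP /(_ a ad) ag]; first exact.
  by rewrite (eqP ah) eq_sym.
rewrite /contract filtE last_gap_split; last by exists hc.
rewrite (mem_unzip1 _ (mem_gap_split _ _)).
have sub h : compat (rcons l a) h -> compat l h by rewrite compat_rcons => /andP[].
case: existsP => [[t Gt]|noc].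
  exists c; split=> //; first by exists (c, t).
  case: rootc => [|[h1 [b bl [bc hb]]]]; first by left.
  right; split; first by move=> h /sub; apply: h1.
  exists b; first by rewrite mem_rcons inE bl orbT.
  by split=> // h g /sub; apply: hb.
have Gc h : compat (rcons l a) h -> h.1 != c.
  by case: h => j t Gh; apply/eqP => /= jc; apply: noc; exists t; rewrite -jc.
have ahc : ~~ agree a hc h0.
  apply/negP => ah; have := Gc hc; rewrite compat_rcons Ghc ah hcc eqxx => /(_ isT) //.
have al : a \notin l by apply/negP => al; move/allP: Ghc => /(_ a al); rewrite (negbTE ahc).
(* The two gaps around the end of [a], with [g0] on the side of the region. *)
have [g0 [g1 [g01 g02 g11 g12]]] : exists g0 g1,
    [/\ g0.1 = a.2, agree a g0 h0, ~~ agree a g1 h0 &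
     forall b, b \in l -> agree b g0 g1].
  have e1 := endg_left na; have e2 := preg_right na.
  have eq b : b \in l -> agree b (endg a) (preg a).
    move=> bl; apply: end_agree => //; first exact/dn/ld.
    by apply: contraNneq al => ->.
  case E: (on_left a (gpos h0)).
    by exists (endg a), (preg a); split=> //; rewrite /agree ?e1 ?(negbTE e2) E.
  by exists (preg a), (endg a); split=> //; rewrite /agree ?e1 ?(negbTE e2) ?E // => b /eq; rewrite agree_sym.
(* Otherwise an earlier arrow [b] separates [g0], hence also [g1], from the region, and [h0], [g0],
   [hc], [g1] lie in four different parts cut out by [a] and [b]. *)
have g0G : compat (rcons l a) g0.
  rewrite compat_rcons g02 andbT; apply/allP => b bl; apply/negPn/negP => bg.
  have bd := ld _ bl; have Gb := allP Ghc b bl.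
  have bpiece_ff_lt : ~~ agree b h0 g1.
    by apply: contra bg => h; apply: agree_trans (g12 b bl) _; rewrite agree_sym.
  apply: (@quadrants N a b h0 g0 hc g1); rewrite ?(agree_sym _ h0) ?(dn bd) ?dx //.
  by rewrite agree_sym.
have ca : c != a.2 by have := Gc g0 g0G; rewrite g01 eq_sym.
exists a.2; split.
- apply: move_gap_split => //.
  have [||||||H|H|H] := @arc_order N a.1 a.2 c hc.2; rewrite ?ltn_ord -?nontrivialE //.
  + apply: Or31 => h Gh; apply: H; exists h.2 => //; rewrite ltn_ord /=.
    move: Gh ahc; rewrite compat_rcons /agree !on_leftE ?nontrivial_neq // hcc.
    by move=> /andP[_ /eqP ->]; rewrite eq_sym.
  + apply: Or32 => h Gh; apply: H; exists h.2 => //; rewrite ltn_ord /=.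
    move: Gh ahc; rewrite compat_rcons /agree !on_leftE ?nontrivial_neq // hcc.
    by move=> /andP[_ /eqP ->]; rewrite eq_sym.
  + apply: Or33 => h Gh; apply: H; exists h.2 => //; rewrite ltn_ord /=.
    move: Gh ahc; rewrite compat_rcons /agree !on_leftE ?nontrivial_neq // hcc.
    by move=> /andP[_ /eqP ->]; rewrite eq_sym.
- by exists g0.
right; split.
  case: rootc => [cN h Gh|[h1 _] h /sub]; last exact: h1.
  by rewrite -cN; apply: Gc.
exists a; first by rewrite mem_rcons mem_head.
(* Suppose a gap [g] of the last side is on the region's side of [a]. If [c] is that side, [a]
   separates two gaps of a side where it does not end; otherwise [a] and the earlier arrow [b] that
   moved the root to [c] cut the boundary into four parts. *)
split=> // h g; rewrite compat_rcons => /andP[_ ah] gN; apply/negP => ahg.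
have a0g : agree a h0 g by apply: agree_trans ahg; rewrite agree_sym.
case: rootc => [cN|[h1 [b bl [bc hb]]]].
  have gc : g.1 = c by apply: val_inj; rewrite /= gN.
  have : agree a hc g by apply: same_side_agree; rewrite // ?hcc ?gc.
  move=> /agree_trans h'; case/negP: ahc; apply: h'; by rewrite agree_sym.
have bd := ld _ bl; have nb := dn bd; have Gb := allP Ghc b bl.
have hcg := hb _ _ Ghc gN.
have [k kc kb] : exists2 k, k.1 = c & ~~ agree b h0 k.
  have e1 := endg_left nb; have e2 := preg_right nb.
  case E: (on_left b (gpos h0)).
    by exists (preg b) => //; rewrite /agree E (negbTE e2).
  by exists (endg b) => //; rewrite /agree E e1.
have hck : agree a hc k by apply: same_side_agree; rewrite // hcc.
have ak : ~~ agree a h0 k.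
  by apply: contra ahc => h'; apply: agree_trans hck _; rewrite agree_sym.
have bg : ~~ agree b h0 g by apply: contra hcg; apply: agree_trans.
by apply: (@quadrants N a b h0 g hc k); rewrite // ?dx // agree_sym.
Qed.

Lemma contracted_enum : contracted (enum d) (foldl (contract r) (all_gaps N) (enum d)).
Proof.
have : {subset enum d <= d} by move=> a; rewrite mem_enum.
elim/last_ind: (enum d) => [_|l a IH sub]; last first.
  rewrite foldl_rcons; apply: contract_step.
  - by move=> b bl; apply: sub; rewrite mem_rcons inE bl orbT.
  - by apply: sub; rewrite mem_rcons mem_head.
  - by apply: IH => b bl; apply: sub; rewrite mem_rcons inE bl orbT.
have N0 : N.-1 < N by have := ltn_ord h0.1; lia.
exists (Ordinal N0); split; last by left.
  rewrite (@eq_gap_split (compat [::]) predT) // /gap_split; set s := all_gaps N; rewrite (eq_in_filter (a2 := pred0)); last first.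
    by case=> j t _ /=; have := ltn_ord j; lia.
  rewrite filter_pred0 /=.
  rewrite (eq_filter (a1 := fun h : gap N => h.1 == _) (a2 := fun h => ~~ (h.1 < N.-1))); last first.
    by case=> j t /=; rewrite -val_eqE /=; have := ltn_ord j; lia.
  have := all_gaps_pairwise; rewrite -/s.
  elim: s => //= h s IH /andP[hs ss]; case: ltnP => h1 /=; first by rewrite -IH.
  rewrite (eq_in_filter (a2 := pred0)) ?filter_pred0 /=; last first.
    by move=> g gs; have /= := allP hs g gs; case: (g) => j t /=; lia.
  congr (_ :: _); apply/esym/all_filterP/allP => g gs.
  by have := allP hs g gs; lia.
by exists (Ordinal N0, Ordinal N0).
Qed.

Lemma subpolygon_root : exists2 c, is_root d r N.-1 c &
  subpolygon d r = [seq j <- enum 'I_N | [exists t, (j, t) \in r] && (c < j)] ++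
    [seq j <- enum 'I_N | [exists t, (j, t) \in r] && (j < c)] ++ [:: c].
Proof.
have [c [QE [h Gh hc] rc]] := contracted_enum.
have cE k : compat (enum d) k = (k \in r).
  rewrite mem_region; apply/allP/forall_inP => H a ad; apply: H; by rewrite ?mem_enum // -mem_enum.
exists c.
  split; first by exists h; rewrite -?cE.
  case: rc => [|[h1 [a ad [ac ha]]]]; [by left|right; split].
    by move=> k; rewrite -cE; apply: h1.
  exists a; first by rewrite -mem_enum.
  by split=> // k g; rewrite -cE; apply: ha.
rewrite /subpolygon QE undup_gap_split; last by exists h.
by congr (_ ++ (_ ++ _)); apply: eq_filter => j; congr (_ && _); apply: eq_existsb => t;
  rewrite cE.
Qed.

End Fold.

(** Contraction follows the order of [enum d], but two arrows separating the region from [rho] and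
    ending on different sides would cut the boundary into four parts. The root side is thus
    intrinsic, and it can be compared between different polygons. *)
Lemma is_root_uniq d h0 rho c c' : d \in dissections N -> rho < N ->
  let r := region_at d (gpos h0) in
  is_root d r rho c -> is_root d r rho c' -> c = c'.
Proof.
move=> /dissP[dn dx] rN r [[h hr hc] rc] [[h' hr' hc'] rc'].
have key a (x : 'I_N) k : a \in d -> a.2 = x -> k \in r -> k.1 = x ->
    exists2 g, g.1 = x & ~~ agree a h0 g.
  move=> /dn na ax _ _; have e1 := endg_left na; have e2 := preg_right na.
  case E: (on_left a (gpos h0)).
    by exists (preg a) => //; rewrite /agree E (negbTE e2).
  by exists (endg a) => //; rewrite /agree E e1.
case: rc rc' => [cr|[rho_r [a ad [ac ha]]]] [cr'|[rho_r' [b bd [bc hb]]]].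
- by apply: val_inj; rewrite /= cr cr'.
- by have := rho_r' h hr; rewrite hc cr eqxx.
- by have := rho_r h' hr'; rewrite hc' cr' eqxx.
apply/eqP/negPn/negP => cc'.
have kap : exists k : gap N, k.1 = rho :> nat by exists (Ordinal rN, Ordinal rN).
have [k kr] := kap.
have h0r : h0 \in r by apply: region_refl.
have [g gc ga] := key _ _ _ ad ac hr hc; have [g' gc' gb] := key _ _ _ bd bc hr' hc'.
have hh (e : arrow N) l : e \in d -> l \in r -> agree e h0 l.
  by move=> ed /regionP /(_ e ed); rewrite agree_sym.
have gb' : agree b h0 g.
  apply: agree_trans (hh b h bd hr) _; apply: same_side_agree; rewrite ?dn //.
    by rewrite hc gc.
  by rewrite hc bc.
have ga' : agree a h0 g'.
  apply: agree_trans (hh a h' ad hr') _; apply: same_side_agree; rewrite ?dn //.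
    by rewrite hc' gc'.
  by rewrite hc' ac eq_sym.
exact: (@quadrants N a b h0 g' g k (dn _ ad) (dn _ bd) (dx _ _ ad bd) ga' gb ga gb'
  (ha _ _ h0r kr) (hb _ _ h0r kr)).
Qed.

End Subpolygon.

(** * Labels and rotation *)

Definition cyc_sides (N : nat) (S : pred nat) (c : nat) : seq nat :=
  [seq j <- iota 0 N | S j && (c < j)] ++ [seq j <- iota 0 N | S j && (j < c)] ++ [:: c].

Lemma cyc_sides_rot N (S : pred nat) c : c < N -> S c ->
  exists k, cyc_sides N S c = rot k [seq j <- iota 0 N | S j].
Proof.
move=> cN Sc.
have E : [seq j <- iota 0 N | S j] =
    ([seq j <- iota 0 N | S j && (j < c)] ++ [:: c]) ++ [seq j <- iota 0 N | S j && (c < j)].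
  have -> : iota 0 N = (iota 0 c ++ [:: c]) ++ iota c.+1 (N - c.+1).
    by rewrite -[[:: c]]/(iota (0 + c) 1) -iotaD addn1 -[in X in _ ++ X](add0n c.+1) -iotaD; congr iota; lia.
  rewrite !filter_cat /= Sc ltnn !andbF /=.
  have F0 s (p : pred nat) : {in s, forall j, p j = false} -> [seq j <- s | p j] = [::].
    by move=> h; rewrite (eq_in_filter h) filter_pred0.
  rewrite (F0 (iota c.+1 _) (fun j => S j && (j < c))); last first.
    by move=> j; rewrite mem_iota; lia.
  rewrite (F0 (iota 0 c) (fun j => S j && (c < j))); last first.
    by move=> j; rewrite mem_iota; lia.
  rewrite !cats0 /=; congr ((_ ++ _) ++ _); apply: eq_in_filter => j; rewrite mem_iota; lia.
rewrite /cyc_sides catA in E *.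
exists (size ([seq j <- iota 0 N | S j && (j < c)] ++ [:: c])).
by rewrite E rot_size_cat catA.
Qed.

Lemma cyc_sides_shift N M s (S S' : pred nat) c : s + M <= N ->
  (forall j, j < M -> S (s + j) = S' j) -> (forall j, S j -> s <= j < s + M) ->
  cyc_sides N S (s + c) = [seq s + j | j <- cyc_sides M S' c].
Proof.
move=> sMN SS' Ss; rewrite /cyc_sides !map_cat /=.
have key (p q : pred nat) : (forall j, p (s + j) = q j) ->
    [seq j <- iota 0 N | S j && p j] = [seq s + j | j <- [seq j <- iota 0 M | S' j && q j]].
  move=> pq; have -> : iota 0 N = iota 0 s ++ iota (s + 0) M ++ iota (s + M) (N - (s + M)).
    by rewrite addn0 -iotaD -{1}(add0n s) -iotaD; congr iota; lia.
  have F0 u : {in u, forall j, S j = false} -> [seq j <- u | S j && p j] = [::].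
    move=> h; rewrite (eq_in_filter (a2 := pred0)) ?filter_pred0 // => j ju.
    by rewrite h.
  rewrite !filter_cat (F0 (iota 0 s)) ?(F0 (iota (s + M) _)) ?cats0 /=.
  - rewrite iotaDl filter_map; congr map; apply: eq_in_filter => j; rewrite mem_iota => jM /=.
    by rewrite pq SS'.
  - by move=> j; rewrite mem_iota => js; apply/negP => /Ss; lia.
  - by move=> j; rewrite mem_iota => js; apply/negP => /Ss; lia.
by congr (_ ++ (_ ++ _)); apply: key => j; lia.
Qed.

(** The sides of a polygon are renumbered by the rotation [j |-> j - 1]. *)
Lemma cyc_sides_pred N (S S' : pred nat) c : c < N ->
  (forall j, j < N -> S' j = S (if j.+1 == N then 0 else j.+1)) -> S c ->
  [seq (if j.+1 == N then 0 else j.+1) | j <- cyc_sides N S' (if c == 0 then N.-1 else c.-1)]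
  = cyc_sides N S c.
Proof.
case: N => // N cN SS' Sc.
pose f j := if j.+1 == N.+1 then 0 else j.+1.
have fc : f (if c == 0 then N else c.-1) = c.
  rewrite /f; have [->|c0] := eqVneq c 0; first by rewrite eqxx.
  by rewrite prednK ?lt0n // ifF //; lia.
have key (p q : pred nat) : (forall j, j < N.+1 -> p j = q (f j)) ->
    [seq f j | j <- [seq j <- iota 0 N.+1 | S' j && p j]] =
    [seq j <- iota 1 N | S j && q j] ++ [seq j <- [:: 0] | S j && q j].
  move=> pq; have -> : [seq j <- iota 0 N.+1 | S' j && p j] =
      [seq j <- iota 0 N.+1 | (fun j => S j && q j) (f j)].
    by apply: eq_in_filter => j; rewrite mem_iota => jN /=; rewrite SS' ?pq.
  rewrite -(filter_map f (fun j => S j && q j)) -filter_cat; congr filter.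
  have -> : iota 0 N.+1 = iota 0 N ++ [:: N] by rewrite -[N.+1]addn1 iotaD.
  rewrite map_cat /=; congr (_ ++ _); last by rewrite /f eqxx.
  rewrite (_ : iota 1 N = [seq 1 + j | j <- iota 0 N]); last exact: iotaDl 1 0 N.
  by apply/eq_in_map => j; rewrite mem_iota /f => jN; rewrite add1n ifF //; lia.
have E3 : [seq f j | j <- [:: if c == 0 then N else c.-1]] = [:: c] by rewrite /= fc.
rewrite /cyc_sides !map_cat -/f E3.
rewrite (key _ (fun j => (c != 0) && ((j == 0) || (c < j)))); last first.
  by move=> j jN; rewrite /f; case: (eqVneq c 0) => [c0|c0]; case: (eqVneq j.+1 N.+1); lia.
rewrite (key _ (fun j => (0 < j) && ((c == 0) || (j < c)))); last first.
  by move=> j jN; rewrite /f; case: (eqVneq c 0) => [c0|c0]; case: (eqVneq j.+1 N.+1); lia.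
have F0 s (p : pred nat) : {in s, forall j, p j = false} -> [seq j <- s | p j] = [::].
  by move=> h; rewrite (eq_in_filter h) filter_pred0.
rewrite -[iota 0 N.+1]/([:: 0] ++ iota 1 N) !filter_cat.
have FE s (p q : pred nat) : {in s, p =1 q} -> [seq j <- s | p j] = [seq j <- s | q j].
  exact: eq_in_filter.
case: (eqVneq c 0) => [c0|c0].
  rewrite (F0 (iota 1 N) (fun j => S j && (~~ true && _))); last by move=> j _; rewrite andbF.
  rewrite (F0 (iota 1 N) (fun j => S j && (j < c))); last by move=> j _; rewrite c0 ltn0 andbF.
  rewrite (FE (iota 1 N) _ (fun j => S j && (c < j))); last first.
    by move=> j _; rewrite c0 /= andbT.
  by rewrite /= c0 !andbF /= !cats0.
rewrite (FE (iota 1 N) _ (fun j => S j && (c < j))); last first.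
  by move=> j; rewrite mem_iota => jN; case: (S j) => //=; lia.
rewrite (FE (iota 1 N) (fun j => S j && ((0 < j) && _)) (fun j => S j && (j < c))); last first.
  by move=> j; rewrite mem_iota => jN; case: (S j) => //=; lia.
by rewrite /= !andbF lt0n c0 !andbT cats0 -!catA.
Qed.

Section Labels.
Variables (R : choiceType) (n : nat).
Implicit Types (x : nat -> R).

Definition side_set N (r : {set gap N}) : pred nat := fun j => [exists h in r, h.1 == j :> nat].

Definition can_label x N (S : pred nat) c : words R := pword [seq x j | j <- cyc_sides N S c].

(** The generators contain the rotations from weight 2 up to weight [n] only, whence the bound; for
    2-gons there is just the weaker relation of [tildeJ1]. *)
Lemma eqm_rot (Q : seq R) k : size Q != 2 -> size Q <= n.+1 ->
  eqm n (pword (rot k Q)) (pword Q).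
Proof.
move=> Q2 Qn.
have step (Q' : seq R) : size Q' = size Q -> eqm n (pword (rot 1 Q')) (pword Q').
  move=> QQ'; case: (ltnP 2 (size Q)) => Q3; last first.
    by case: Q' QQ' => [|y [|z Q']] /= QQ'; try exact: eqm_refl; lia.
  apply: eqm_sym; apply: ideal_sum_gen; right; exists (size Q).-1; first lia.
  by exists Q'; split=> //; lia.
have it m : eqm n (pword (iter m (rot 1) Q)) (pword Q).
  elim: m => [|m IH]; first exact: eqm_refl.
  apply: eqm_trans IH; apply: step; elim: m => //= m IH; by rewrite size_rot.
case: (leqP k (size Q)) => kQ; last by rewrite rot_oversize; [exact: eqm_refl|exact: ltnW].
have -> : rot k Q = iter k (rot 1) Q; last exact: it.
elim: k kQ => [|k IH] kQ; first by rewrite rot0.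
by rewrite -addn1 addnC rotD ?IH //= ltnW.
Qed.

Lemma can_label_eqm x N (S : pred nat) c c' : N <= n.+1 -> c < N -> c' < N -> S c -> S c' ->
  size [seq j <- iota 0 N | S j] != 2 ->
  eqm n (can_label x N S c) (can_label x N S c').
Proof.
move=> Nn cN c'N Sc Sc' S2; rewrite /can_label.
have [k ->] := cyc_sides_rot cN Sc; have [k' ->] := cyc_sides_rot c'N Sc'.
have sz : size [seq j <- iota 0 N | S j] <= n.+1.
  by rewrite size_filter (leq_trans (count_size _ _)) ?size_iota.
by apply: eqm_trans (eqm_sym _); rewrite ?map_rot; apply: eqm_rot; rewrite size_map.
Qed.

Definition labE x N (d : {set arrow N}) (r : {set gap N}) : words R :=
  pword [seq x (val j) | j <- subpolygon d r].

Lemma labE_root x N (d : {set arrow N}) r : d \in dissections N -> r \in regions d ->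
  exists2 c : 'I_N, is_root d r N.-1 c & labE x d r = can_label x N (side_set r) c.
Proof.
move=> dD /regionsP[N1 [g ->]]; have [c rc E] := subpolygon_root g dD.
exists c => //; rewrite /labE E /can_label /cyc_sides (map_comp x val) !map_cat /=.
have key (p : pred nat) : [seq nat_of_ord j | j <- enum 'I_N &
    [exists t, (j, t) \in region_at d (gpos g)] && p j] =
    [seq j <- iota 0 N | side_set (region_at d (gpos g)) j && p j].
  rewrite -val_enum_ord filter_map; congr map; apply: eq_filter => j /=; congr (_ && _).
  apply/existsP/existsP => [[t jt]|[[j' t] /andP[jt /eqP/val_inj jj]]].
    by exists (j, t); rewrite jt /= eqxx.
  by exists t; rewrite -jj.
by rewrite (key (fun j => c < j)) (key (fun j => j < c)).
Qed.

End Labels.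

(** * Rotation of arrows, gaps and regions *)

Section Rotation.
Variable N : nat.
Implicit Types (a b : arrow N) (h g : gap N) (d : {set arrow N}) (r : {set gap N}).

Definition rota a : arrow N := (ord_pred a.1, ord_pred a.2).
(** The offset within the side is kept, since the offset [j - i] modulo [N] of the end of an arrow
    is invariant under rotation. *)
Definition rotg h : gap N := (ord_pred h.1, h.2).
Definition rotd d : {set arrow N} := rota @: d.
Definition rotreg r : {set gap N} := rotg @: r.

Definition npred (i : nat) := if i == 0 then N.-1 else i.-1.

Lemma ord_predE (i : 'I_N) : ord_pred i = npred i :> nat.
Proof.
rewrite /npred /=; have := ltn_ord i; case: eqP => [->|/eqP i0] iN.
  by rewrite add0n modn_small //; lia.
have -> : (i + N).-1 = i.-1 + N by lia.
by rewrite modnDr modn_small //; lia.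
Qed.

Lemma rota_inj : injective rota.
Proof.
case=> i j [i' j'] E; have [E1 E2] : ord_pred i = ord_pred i' /\ ord_pred j = ord_pred j'.
  by split; [rewrite -[LHS]/(rota (i, j)).1 E|rewrite -[LHS]/(rota (i, j)).2 E].
by congr (_, _); apply: (can_inj (@ord_predK N)).
Qed.

Lemma rotg_inj : injective rotg.
Proof.
case=> i t [i' t'] E; have [E1 E2] : ord_pred i = ord_pred i' /\ t = t'.
  by split; [rewrite -[LHS]/(rotg (i, t)).1 E|rewrite -[LHS]/(rotg (i, t)).2 E].
by congr (_, _) => //; apply: (can_inj (@ord_predK N)).
Qed.

Lemma mem_rotd d a : (rota a \in rotd d) = (a \in d).
Proof. exact: mem_imset rota_inj. Qed.

Lemma mem_rotreg r h : (rotg h \in rotreg r) = (h \in r).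
Proof. exact: mem_imset rotg_inj. Qed.

Lemma rota_surj a : exists b, a = rota b.
Proof. by exists (ordS a.1, ordS a.2); case: a => i j; rewrite /rota /= !ordSK. Qed.

Lemma rotg_surj h : exists g, h = rotg g.
Proof. by exists (ordS h.1, h.2); case: h => i j; rewrite /rotg /= !ordSK. Qed.

Lemma nontrivial_rota a : nontrivial (rota a) = nontrivial a.
Proof.
rewrite !nontrivialE !ord_predE /npred /nontriv.
have := ltn_ord a.1; have := ltn_ord a.2; case: a => i j /= jN iN.
by case: (eqVneq (val i) 0) => /= i0; case: (eqVneq (val j) 0) => /= j0; case: ifP; case: ifP; lia.
Qed.

Lemma on_left_rota a h : nontrivial a ->
  on_left (rota a) (gpos (rotg h)) = on_left a (gpos h).
Proof.
move=> na; rewrite !on_leftE ?nontrivial_neq ?nontrivial_rota // !ord_predE /=.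
have := nontrivial_neq na; rewrite -val_eqE /=.
have := ltn_ord a.1; have := ltn_ord a.2; have := ltn_ord h.1.
case: a {na} => [i j]; case: h => J t /=; rewrite /npred /lft => iN jN JN ij.
case: (eqVneq (val i) 0) => /= i0; case: (eqVneq (val j) 0) => /= j0; case: (eqVneq (val J) 0) => /= J0;
  case: (leqP i j) => h; case: ifP => h'; lia.
Qed.

End Rotation.

Section RotatedRegions.
Variable N : nat.
Implicit Types (a b : arrow N) (h g : gap N) (d : {set arrow N}) (r : {set gap N}).

Lemma agree_rota a h g : nontrivial a -> agree (rota a) (rotg h) (rotg g) = agree a h g.
Proof. by move=> na; rewrite /agree !on_left_rota. Qed.

Lemma aoff_rota a : nontrivial a -> aoff N (rota a).1 (rota a).2 = aoff N a.1 a.2.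
Proof.
move=> na; rewrite !ord_predE; have := nontrivial_neq na; rewrite -val_eqE /=.
have := ltn_ord a.1; have := ltn_ord a.2; case: a {na} => i j /=; rewrite /npred /aoff => iN jN ij.
by case: (eqVneq (val i) 0) => /= i0; case: (eqVneq (val j) 0) => /= j0;
  case: (leqP i j) => h; case: ifP; lia.
Qed.

Lemma endg_rota a : nontrivial a -> endg (rota a) = rotg (endg a).
Proof.
move=> na; congr (_, _); apply: val_inj; rewrite /= !val_insubd aoff_rota //.
by rewrite aoff_lt.
Qed.

Lemma preg_rota a : nontrivial a -> preg (rota a) = rotg (preg a).
Proof.
move=> na; congr (_, _); apply: val_inj; rewrite /= !val_insubd aoff_rota //.
by have oa := aoff_lt a; rewrite ifT ?ifT //; lia.
Qed.

Lemma astart_rota a : astart (rota a) = gpos (rotg (a.1, insubd a.1 0)).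
Proof.
rewrite astartE; congr gpos; congr (_, _); apply: val_inj; rewrite !val_insubd /=.
by have aN := ltn_ord a.1; rewrite ifT ?ifT //=; lia.
Qed.

Lemma crosses_rota a b : nontrivial a -> nontrivial b ->
  crosses (rota a) (rota b) = crosses a b.
Proof.
move=> na nb; rewrite /crosses astart_rota aendE endg_rota // !on_left_rota //.
by rewrite astartE aendE (inj_eq (can_inj (@ord_predK _))).
Qed.

Lemma rotd_diss d : (rotd d \in dissections N) = (d \in dissections N).
Proof.
apply/dissP/dissP => -[h1 h2]; split.
- by move=> a ad; rewrite -nontrivial_rota h1 ?mem_rotd.
- move=> a b ad bd; have := h2 (rota a) (rota b); rewrite !mem_rotd => /(_ ad bd).
  have na : nontrivial a by rewrite -nontrivial_rota h1 ?mem_rotd.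
  have nb : nontrivial b by rewrite -nontrivial_rota h1 ?mem_rotd.
  by rewrite -!crossesE ?nontrivial_rota // crosses_rota.
- by move=> _ /imsetP[a ad ->]; rewrite nontrivial_rota h1.
- move=> _ _ /imsetP[a ad ->] /imsetP[b bd ->].
  by rewrite -crossesE ?nontrivial_rota ?crosses_rota ?crossesE ?h1 ?h2.
Qed.

Lemma region_rot d g : {in d, forall a, nontrivial a} ->
  region_at (rotd d) (gpos (rotg g)) = rotreg (region_at d (gpos g)).
Proof.
move=> dn; apply/setP => h; have [k ->] := rotg_surj h; rewrite (mem_rotreg (region_at d _)).
apply/regionP/regionP => H a.
  by move=> ad; rewrite -agree_rota ?dn // H // mem_rotd.
by case/imsetP => b bd ->; rewrite agree_rota ?dn // H.
Qed.

Lemma rotreg_inj : injective (@rotreg N).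
Proof. exact: imset_inj (@rotg_inj N). Qed.

Lemma rotd_inj : injective (@rotd N).
Proof. exact: imset_inj (@rota_inj N). Qed.

Lemma regions_rot d : {in d, forall a, nontrivial a} ->
  regions (rotd d) = @rotreg N @: regions d.
Proof.
move=> dn; apply/setP => r; apply/regionsP/imsetP => [[N1 [g ->]]|[_ /regionsP[N1 [g ->]] ->]].
  have [k ->] := rotg_surj g; exists (region_at d (gpos k)); last exact: region_rot.
  by apply/regionsP; split=> //; exists k.
by split=> //; exists (rotg g); rewrite region_rot.
Qed.

Lemma left_region_rot d a : {in d, forall a, nontrivial a} -> a \in d ->
  left_region (rotd d) (rota a) = rotreg (left_region d a).
Proof.
by move=> dn ad; rewrite /left_region !aendE endg_rota ?dn // region_rot.
Qed.

Lemma right_region_rot d a : {in d, forall a, nontrivial a} -> a \in d ->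
  right_region (rotd d) (rota a) = rotreg (right_region d a).
Proof.
move=> dn ad; rewrite /right_region !aend_predE ?preg_rota ?dn ?region_rot //.
  exact/nontrivial_neq/dn.
by apply: nontrivial_neq; rewrite nontrivial_rota dn.
Qed.

Lemma npred_last (i : 'I_N) : (npred N i == N.-1) = (i == 0 :> nat).
Proof. by rewrite /npred; have := ltn_ord i; case: ifP; lia. Qed.

Lemma is_root_rot d r c : {in d, forall a, nontrivial a} ->
  is_root (rotd d) (rotreg r) N.-1 (ord_pred c) -> is_root d r 0 c.
Proof.
move=> dn [[h hr hc] rc]; split.
  case/imsetP: hr hc => g gr -> /= /(can_inj (@ord_predK _)) gc; by exists g.
have E (i : 'I_N) : (ord_pred i == N.-1 :> nat) = (i == 0 :> nat).
  by rewrite ord_predE npred_last.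
case: rc => [/eqP|[h1 [_ /imsetP[a ad ->] [ac ha]]]]; first by rewrite E => /eqP; left.
right; split; first by move=> g gr; rewrite -E; apply: (h1 (rotg g)); rewrite mem_rotreg.
exists a => //; split; first exact: (can_inj (@ord_predK _)).
move=> g k gr /eqP; rewrite -E => /eqP k0.
by rewrite -agree_rota ?dn // ha ?mem_rotreg.
Qed.

End RotatedRegions.

(** * The trees of a polygon and of its rotation on common nodes *)

Section PolygonTrees.
Variables (R : choiceType) (n : nat).
Implicit Types (x : nat -> R).

Definition nsucc N j := if j.+1 == N then 0 else j.+1.

(** The label, in the polygon with sides x 1, ..., x (N - 1), x 0, of a region
    of the polygon with sides x 0, ..., x (N - 1). *)
Definition labS x N (d : {set arrow N}) (r : {set gap N}) : words R :=
  pword [seq x (nsucc N (val j)) | j <- subpolygon (rotd d) (rotreg r)].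

Lemma labS_root x N (d : {set arrow N}) r : d \in dissections N -> r \in regions d ->
  exists2 c : 'I_N, is_root d r 0 c & labS x d r = can_label x N (side_set r) c.
Proof.
move=> dD rd; have dn : {in d, forall a, nontrivial a} by have /dissP[] := dD.
have dD' : rotd d \in dissections N by rewrite rotd_diss.
have rd' : rotreg r \in regions (rotd d) by rewrite regions_rot // imset_f.
have [c rc E] := labE_root (fun j => x (nsucc N j)) dD' rd'.
have rc0 : is_root d r 0 (ordS c) by apply: is_root_rot; rewrite ?ordSK.
exists (ordS c) => //.
rewrite /labS; move: E; rewrite /labE => ->; rewrite /can_label (map_comp x) /=; congr (pword (map _ _)).
have cE : val c = (if val (ordS c) == 0 then N.-1 else (val (ordS c)).-1).
  by have := ord_predE (ordS c); rewrite ordSK.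
rewrite [X in cyc_sides _ _ X]cE; apply: cyc_sides_pred; first exact: ltn_ord.
  move=> j jN; have := ltn_ord c => cN.
  have SE (i : 'I_N) : side_set (rotreg r) (ord_pred i) = side_set r i.
    apply/exists_inP/exists_inP => [[_ /imsetP[g gr ->] /eqP/val_inj/(can_inj (@ord_predK _)) gi]|[g gr /eqP/val_inj gi]].
      by exists g; rewrite ?gi.
    by exists (rotg g); rewrite ?mem_rotreg //= gi.
  have := SE (ordS (Ordinal jN)); rewrite ordSK /= => ->; congr (side_set r _).
  have [E|ne] := eqVneq j.+1 N; first by rewrite E modnn.
  by rewrite modn_small //; lia.
by case: rc0 => -[h hr hc] _; apply/exists_inP; exists h; rewrite ?hc.
Qed.

(** One form for all the trees involved: [rs] takes the labels of the rotated polygon, [flip]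
    reverses the arrows from vertex 0, and [last] selects which of the two corner gaps at vertex 0
    determines the chosen region. *)
Definition pft N x (rs flip last : bool) (d : {set arrow N}) : ftree R := {|
  ft := {set gap N};
  fV := regions d;
  fe := fun r r' => [exists a in d,
     if flip && (a.1 == 0 :> nat) then (r == right_region d a) && (r' == left_region d a)
     else (r == left_region d a) && (r' == right_region d a)];
  fl := fun r => if rs then labS x d r else labE x d r;
  fc := fun r => r == region_at d (if last then (N * N).-1 else 0) |}.

Definition psgn N (flip : bool) (d : {set arrow N}) : rat :=
  (-1) ^+ #|[set a in d | flip && (a.1 == 0 :> nat)]|.

Definition ftree_of (T : stree R) (v : node T) : ftree R := {|
  ft := node T; fV := nodes T; fe := @edge R T; fl := @label R T; fc := fun w => w == v |}.

Definition fvoid : ftree R := {|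
  ft := void; fV := set0; fe := fun _ _ => false; fl := fun _ => 0%R; fc := fun _ => false |}.

(** Both trees of an insertion are joined to the new vertex in the same direction, so that the
    forest in the other direction is empty. *)
Lemma Lambda_graft out u (T T' : stree R) (v : node T) (v' : node T') :
  eqm n (Lambda (graft out u v v'))
    ((sgn T * sgn T') *: gstar out u (fsum (ftree_of v) (ftree_of v')) fvoid)%R.
Proof.
rewrite LambdaE; apply: eqmZ.
apply: (@LamE_iso _ _ _ _ (fun w : option (node T + node T') =>
  if w is Some z then Some (inl z) else None : option ((node T + node T') + void))).
- by case=> [z|] [z'|] //= _ _ [->].
- apply/setP => w; rewrite !inE; apply/imsetP/idP => [[z]|].
    by rewrite inE => zV ->; case: z zV => [[a|b]|] //=; rewrite inE.
  case: w => [[[a|b]|[]]|] //=; rewrite ?inE => wV.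
  + by exists (Some (inl a)); rewrite ?inE.
  + by exists (Some (inr b)); rewrite ?inE.
  + by exists None; rewrite ?inE.
- by case=> [[a|b]|] [[a'|b']|].
- by case=> [[a|b]|] _ /=; apply: eqm_refl.
Qed.

Section FromSeq.
Variables (Y : seq R) (x : nat -> R) (x0 : R).
Let N := size Y.

Lemma fiso_RE (phi : genset) flip last (d : {set arrow N}) :
  (forall j, j < N -> nth x0 Y j = x j) ->
  (phi = phi4 /\ flip = false) \/ (phi = phifv /\ flip = true) ->
  fiso n (@ftree_of (diss_tree phi (in_tuple Y) d) (region_at d (if last then (N * N).-1 else 0)))
    (pft x false flip last d)
  /\ sgn (diss_tree phi (in_tuple Y) d) = psgn flip d.
Proof.
move=> xE phE.
have rev a : reversed phi a = flip && (a.1 == 0 :> nat) by case: phE => -[-> ->].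
split.
  exists id; split=> //=; rewrite ?imset_id //.
  - by move=> r r' _ _; apply: eq_existsb => a; rewrite rev.
  - move=> r rd; apply: eqm_eq; congr pword; apply: eq_map => j.
    by rewrite (tnth_nth x0) xE.
rewrite /= /psgn; congr (_ ^+ _)%R; apply: eq_card => a; rewrite !inE.
by rewrite rev.
Qed.

(** The tree of [Y] is transported to the polygon of which [Y] is the rotation; the last vertex of
    [Y] becomes vertex 0, so that [phifv] and [phisfv] reverse arrows at the same vertex. *)
Lemma fiso_RS (phi : genset) flip last (d : {set arrow N}) :
  d \in dissections N ->
  (forall j, j < N -> nth x0 Y j = x (nsucc N j)) ->
  (phi = phi4 /\ flip = false) \/ (phi = phisfv /\ flip = true) ->
  fiso n (pft x true flip last d)
    (@ftree_of (diss_tree phi (in_tuple Y) (rotd d))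
       (region_at (rotd d) (if last then (N * N.-1).-1 else N * N.-1)))
  /\ sgn (diss_tree phi (in_tuple Y) (rotd d)) = psgn flip d.
Proof.
move=> dD xE phE; have dn : {in d, forall a, nontrivial a} by have /dissP[] := dD.
have rev a : reversed phi (rota a) = flip && (a.1 == 0 :> nat).
  case: phE => -[-> ->] //; rewrite [reversed _ _]/= -(npred_last a.1) -ord_predE //.
split.
  exists (@rotreg N); split=> /=.
  - by move=> r r' _ _; apply: rotreg_inj.
  - by rewrite regions_rot.
  - move=> r r' _ _; apply/exists_inP/exists_inP => -[a ad].
      move=> H; exists (rota a); rewrite ?mem_rotd // rev left_region_rot // right_region_rot //.
      by rewrite !(inj_eq (@rotreg_inj N)).
    case/imsetP: ad => b bd ->; rewrite rev left_region_rot // right_region_rot //.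
    by rewrite !(inj_eq (@rotreg_inj N)) => H; exists b.
  - move=> r rd; apply: eqm_eq; congr pword; apply: eq_map => j.
    by rewrite (tnth_nth x0) xE.
  - move=> r /regionsP[N1 _].
    (* Rotation sends the first and the last gap of the boundary to those just after and just before
       the last vertex. *)
    have [g [gE gE']] : exists g : gap N, gpos g = (if last then (N * N).-1 else 0) /\
        gpos (rotg g) = (if last then (N * N.-1).-1 else N * N.-1).
      have N0 : 0 < N by lia.
      have NN : N.-1 < N by lia.
      case: (last).
        exists (Ordinal NN, Ordinal NN); rewrite /gpos ord_predE /npred /= ifF; last lia.
        by case: (N) N1 => [|[|k]] // _; split=> /=; rewrite !mulSn !mulnS; lia.
      exists (Ordinal N0, Ordinal N0); rewrite /gpos ord_predE /npred /=.
      by split; rewrite ?mul0n // addn0 mulnC.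
    by rewrite -gE -gE' region_rot // (inj_eq (@rotreg_inj N)).
rewrite /= /psgn; congr (_ ^+ _)%R.
rewrite -[RHS](card_imset _ (@rota_inj N)); apply: eq_card => a; have [b ->] := rota_surj a.
rewrite inE mem_rotd rev; apply/idP/imsetP => [H|[c]]; last by rewrite inE => H /rota_inj ->.
by exists b; rewrite ?inE.
Qed.

Definition gen_term (rs : bool) (d : {set arrow N}) : words R :=
  (psgn true d *: LamE (regions d) (fe (f := pft x rs true true d)) (fl (f := pft x rs true true d)))%R.

Lemma fiso_LamE F F' : fiso n F F' ->
  eqm n (LamE (fV F) (@fe R F) (@fl R F)) (LamE (fV F') (@fe R F') (@fl R F')).
Proof. by case=> f [fi fV_ fe_ fl_ _]; apply: LamE_iso fi fV_ fe_ fl_. Qed.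

Lemma Lambda_gen_RE : (forall j, j < N -> nth x0 Y j = x j) ->
  eqm n (Lambda_gen phifv Y) (\sum_(d in dissections N) gen_term false d)%R.
Proof.
move=> xE; apply: eqm_sum => d dD; rewrite LambdaE.
have [iso ->] := @fiso_RE phifv true true d xE (or_intror (conj erefl erefl)).
by apply: eqmZ; apply: fiso_LamE iso.
Qed.

Lemma sum_rotd (F : {set arrow N} -> words R) :
  (\sum_(d in dissections N) F d = \sum_(d in dissections N) F (rotd d))%R.
Proof.
rewrite (reindex_inj (@rotd_inj N)); apply: eq_bigl => d.
exact: rotd_diss.
Qed.

Lemma Lambda_gen_RS : (forall j, j < N -> nth x0 Y j = x (nsucc N j)) ->
  eqm n (Lambda_gen phisfv Y) (\sum_(d in dissections N) gen_term true d)%R.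
Proof.
move=> xE; apply: eqm_trans (eqm_eq _ (sum_rotd _)) _.
apply: eqm_sum => d dD; rewrite LambdaE.
have [iso ->] := @fiso_RS phisfv true true d dD xE (or_intror (conj erefl erefl)).
by apply: eqmZ; apply: eqm_sym; apply: fiso_LamE iso.
Qed.

End FromSeq.

Lemma insert_prec_eqm u (Y3 Y4 : seq R) x3 x4 (x0 : R) :
  (forall j, j < size Y3 -> nth x0 Y3 j = x3 j) ->
  (forall j, j < size Y4 -> nth x0 Y4 j = x4 j) ->
  eqm n (insert_prec u Y3 Y4)
   (\sum_(d3 in dissections (size Y3)) \sum_(d4 in dissections (size Y4))
     psgn true d4 *: gstar true u
       (fsum (pft x3 false false true d3) (pft x4 false true false d4)) fvoid)%R.
Proof.
move=> x3E x4E; apply: eqm_sum => d3 d3D; apply: eqm_sum => d4 d4D.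
have [iso3 s3] := @fiso_RE Y3 x3 x0 phi4 false true d3 x3E (or_introl (conj erefl erefl)).
have [iso4 s4] := @fiso_RE Y4 x4 x0 phifv true false d4 x4E (or_intror (conj erefl erefl)).
apply: eqm_trans (Lambda_graft _ _ _ _) _; rewrite s3 s4.
have -> : psgn false d3 = 1%R by rewrite /psgn eq_card0 // => a; rewrite !inE andbF.
rewrite mul1r; apply: eqmZ; apply: gstar_iso; first exact: eqm_refl.
  exact: fiso_sum iso3 iso4.
exact: fiso_refl.
Qed.

Lemma insert_succ_eqm u (Y2 Y1 : seq R) x2 x1 (x0 : R) :
  (forall j, j < size Y2 -> nth x0 Y2 j = x2 (nsucc (size Y2) j)) ->
  (forall j, j < size Y1 -> nth x0 Y1 j = x1 (nsucc (size Y1) j)) ->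
  eqm n (insert_succ u Y2 Y1)
   (\sum_(d2 in dissections (size Y2)) \sum_(d1 in dissections (size Y1))
     psgn true d1 *: gstar false u
       (fsum (pft x2 true false false d2) (pft x1 true true true d1)) fvoid)%R.
Proof.
move=> x2E x1E; apply: eqm_trans (eqm_eq _ (sum_rotd _)) _.
apply: eqm_sum => d2 d2D; apply: eqm_trans (eqm_eq _ (sum_rotd _)) _.
apply: eqm_sum => d1 d1D.
have [iso2 s2] := @fiso_RS Y2 x2 x0 phi4 false false d2 d2D x2E (or_introl (conj erefl erefl)).
have [iso1 s1] := @fiso_RS Y1 x1 x0 phisfv true true d1 d1D x1E (or_intror (conj erefl erefl)).
apply: eqm_trans (Lambda_graft _ _ _ _) _; rewrite s2 s1.
have -> : psgn false d2 = 1%R by rewrite /psgn eq_card0 // => a; rewrite !inE andbF.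
rewrite mul1r; apply: eqmZ; apply: eqm_sym; apply: gstar_iso; first exact: eqm_refl.
  exact: fiso_sum iso2 iso1.
exact: fiso_refl.
Qed.

End PolygonTrees.

(** * Pieces of a polygon *)

Section PieceArithmetic.
Variables (N M s : nat) (zb : bool).

(** The piece of the [N]-gon with sides [s, ..., s + M - 1]: its first vertex is
    the vertex [s] if [zb] holds, and the vertex [s + M] otherwise. *)
Definition pvtx i := if i == 0 then (if zb then s else if s + M == N then 0 else s + M) else s + i.
Definition pcut_i := pvtx 0.
Definition pcut_j := if zb then s + M - 1 else s.
Definition in_part J t :=
  [&& 1 < M, s <= J, J < s + M & if zb then (J.+1 < s + M) || (t < M - 1) else (s < J) || (N - M <= t)].
(** Everything outside the piece is shrunk to one gap: the one next to the first vertex, on the side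
    where the cut ends. *)
Definition gam_j J t := if in_part J t then J - s else if zb then M - 1 else 0.
(** On a given side, an arrow of the piece has the same offset in both polygons, or [N - M] more in
    the large one if it passes over the end of the numbering. No arrow of the piece ends at the
    offsets in between, which [maxn] identifies. *)
Definition gam_t J t :=
  if in_part J t then
    (if zb then (if t <= J - s then t else maxn (J - s) (t - (N - M)))
     else (if t < J - s then t else maxn (J - s - 1) (t - (N - M))))
  else if zb then M - 1 else 0.

Hypotheses (M0 : 0 < M) (MN : M < N) (sMN : s + M <= N).

Lemma pvtx_lt i : i < M -> pvtx i < N.
Proof. by rewrite /pvtx => iM; case: (i == 0); case: zb; case: (eqVneq (s + M) N); lia. Qed.

Lemma gam_j_lt J t : gam_j J t < M.
Proof. by rewrite /gam_j /in_part; case: zb; case: ifP; lia. Qed.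

Lemma gam_t_lt J t : t < N -> gam_t J t < M.
Proof.
rewrite /gam_t /in_part => tN; case: zb; case: ifP => h; try lia; case: ifP; lia.
Qed.

Lemma nontriv_pvtx i j : i < M -> j < M -> nontriv M i j -> nontriv N (pvtx i) (s + j).
Proof.
rewrite /nontriv /pvtx => iM jM; case: zb; case: (eqVneq i 0) => i0; case: (eqVneq (s + M) N) => sM;
  case: (eqVneq j.+1 M) => jM'; case: (eqVneq (s + j).+1 N) => sj; lia.
Qed.

Lemma lft_gam i j J t : i < M -> j < M -> nontriv M i j -> J < N -> t < N ->
  lft N (pvtx i) (s + j) J t = lft M i j (gam_j J t) (gam_t J t).
Proof.
rewrite /nontriv /pvtx /gam_j /gam_t => iM jM ij JN tN.
case P: (in_part J t); move: P; rewrite /in_part; case: zb => P.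
- case: (leqP t (J - s)) => tJ; case: (eqVneq i 0) ij => [->|i0] ij; rewrite /lft.
  + by case: (leqP s (s + j)) => h; case: (leqP 0 j) => h'; case: (eqVneq j.+1 M) ij => ? ij; lia.
  + by case: (leqP (s + i) (s + j)) => h; case: (leqP i j) => h'; case: (eqVneq j.+1 M) ij => ? ij; lia.
  + by case: (leqP s (s + j)) => h; case: (leqP 0 j) => h'; case: (eqVneq j.+1 M) ij => ? ij; lia.
  + by case: (leqP (s + i) (s + j)) => h; case: (leqP i j) => h'; case: (eqVneq j.+1 M) ij => ? ij; lia.
- case: (ltnP t (J - s)) => tJ; case: (eqVneq i 0) ij => [->|i0] ij; rewrite /lft.
  + by case: (eqVneq (s + M) N) => E; [case: (leqP 0 (s + j)) => h|case: (leqP (s + M) (s + j)) => h];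
      case: (leqP 0 j) => h'; case: (eqVneq j.+1 M) ij => ? ij; lia.
  + by case: (leqP (s + i) (s + j)) => h; case: (leqP i j) => h'; case: (eqVneq j.+1 M) ij => ? ij; lia.
  + by case: (eqVneq (s + M) N) => E; [case: (leqP 0 (s + j)) => h|case: (leqP (s + M) (s + j)) => h];
      case: (leqP 0 j) => h'; case: (eqVneq j.+1 M) ij => ? ij; lia.
  + by case: (leqP (s + i) (s + j)) => h; case: (leqP i j) => h'; case: (eqVneq j.+1 M) ij => ? ij; lia.
- case: (eqVneq i 0) ij => [->|i0] ij; rewrite /lft.
  + by case: (leqP s (s + j)) => h; case: (leqP 0 j) => h'; case: (eqVneq j.+1 M) ij => ? ij; lia.
  + by case: (leqP (s + i) (s + j)) => h; case: (leqP i j) => h'; case: (eqVneq j.+1 M) ij => ? ij; lia.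
- case: (eqVneq i 0) ij => [->|i0] ij; rewrite /lft.
  + by case: (eqVneq (s + M) N) => E; [case: (leqP 0 (s + j)) => h|case: (leqP (s + M) (s + j)) => h];
      case: (leqP 0 j) => h'; case: (eqVneq j.+1 M) ij => ? ij; lia.
  + by case: (leqP (s + i) (s + j)) => h; case: (leqP i j) => h'; case: (eqVneq j.+1 M) ij => ? ij; lia.
Qed.

Lemma interleave_pvtx i j i' j' : i < M -> j < M -> i' < M -> j' < M ->
  nontriv M i j -> nontriv M i' j' ->
  interleave (pvtx i) (s + j) (pvtx i') (s + j') = interleave i j i' j'.
Proof.
have E i1 j1 i2 j2 : interleave i1 j1 i2 j2 = [&& i1 != i2, j1 != j2 &
    ((i1 <= j1) && ((i1 < i2 <= j1) != (i1 <= j2 < j1))) ||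
    ((j1 < i1) && ((j1 < i2 < i1) != (j1 < j2 < i1)))].
  by rewrite /interleave; case: (leqP i1 j1) => h; lia.
rewrite !E /nontriv /pvtx => iM jM i'M j'M.
case: (eqVneq j.+1 M) => jM'; case: (eqVneq j'.+1 M) => j'M';
case: (eqVneq i 0) => i0; case: (eqVneq i' 0) => i0'; case: zb; try lia;
case: (eqVneq (s + M) N) => E'; lia.
Qed.

Lemma pcut_nontriv : 1 < M -> nontriv N pcut_i pcut_j.
Proof.
rewrite /nontriv /pcut_i /pcut_j /pvtx eqxx => M1; case: zb.
  by case: (eqVneq (s + M - 1).+1 N); lia.
by case: (eqVneq (s + M) N) => E; case: (eqVneq s.+1 N); lia.
Qed.

Lemma in_part_cut J t : 1 < M -> J < N -> t < N ->
  in_part J t = (lft N pcut_i pcut_j J t == ~~ zb).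
Proof.
rewrite /in_part /lft /pcut_i /pcut_j /pvtx eqxx => M1 JN tN; case: zb.
  by case: (leqP s (s + M - 1)) => h; lia.
by case: (eqVneq (s + M) N) => E; [case: (leqP 0 s) => h|case: (leqP (s + M) s) => h]; lia.
Qed.

Definition in_piece i j :=
  [&& (i == pcut_i) || (s < i < s + M), s <= j < s + M & ~~ ((i == pcut_i) && (j == pcut_j))].

Lemma in_pieceP i j : i < N -> j < N -> nontriv N i j -> in_piece i j ->
  exists i' j', [/\ i' < M, j' < M, nontriv M i' j', pvtx i' = i & s + j' = j].
Proof.
move=> iN jN ij /and3P[h1 h2 h3].
exists (if i == pcut_i then 0 else i - s), (j - s); split.
- by move: h1; case: (eqVneq i pcut_i); lia.
- lia.
- move: h1 h3 ij; rewrite /pcut_j /nontriv; case: (eqVneq i pcut_i) => ic /=.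
    move: ic; rewrite /pcut_i /pvtx eqxx; case: zb => ic _ jc; case: (eqVneq j.+1 N) => jN';
    case: (eqVneq (j - s).+1 M) => jM'; try lia; move: ic; case: (eqVneq (s + M) N); lia.
  by case: (eqVneq j.+1 N) => jN'; case: (eqVneq (j - s).+1 M) => jM'; lia.
- case: (eqVneq i pcut_i) h1 => [->|ne] //= h1; rewrite /pvtx ifF; lia.
- lia.
Qed.

Lemma in_piece_pvtx i j : i < M -> j < M -> nontriv M i j -> in_piece (pvtx i) (s + j).
Proof.
rewrite /in_piece /pcut_i /pcut_j /nontriv /pvtx eqxx => iM jM.
by case: zb; case: (eqVneq i 0) => i0; case: (eqVneq (s + M) N) => E; case: (eqVneq j.+1 M) => E'; lia.
Qed.

(** An arrow that does not cross the cut and is not in the piece does not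
    separate the gaps of the piece. *)
Lemma lft_const i j J t : i < N -> j < N -> nontriv N i j -> J < N -> t < N ->
  1 < M -> ~~ interleave i j pcut_i pcut_j -> ~~ in_piece i j ->
  in_part J t -> lft N i j J t = if zb then lft N i j s 0 else lft N i j (s + M - 1) (N - 1).
Proof.
move=> iN jN; rewrite /nontriv /in_piece /interleave /in_part /lft /pcut_i /pcut_j /pvtx eqxx.
move=> ij JN tN M1; case: zb.
  by case: (leqP i j) => h; case: (eqVneq j.+1 N) ij => E ij; lia.
by case: (leqP i j) => h; case: (eqVneq j.+1 N) ij => E ij; case: (eqVneq (s + M) N) => E'; lia.
Qed.

Lemma gam_end i j : i < M -> j < M -> nontriv M i j ->
  let t := aoff N (pvtx i) (s + j) in
  [/\ in_part (s + j) t, gam_t (s + j) t = aoff M i j,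
      in_part (s + j) t.-1 & gam_t (s + j) t.-1 = (aoff M i j).-1].
Proof.
rewrite /nontriv /= => iM jM ij.
have ip t : in_part (s + j) t = [&& 1 < M & if zb then (j.+1 < M) || (t < M - 1) else (0 < j) || (N - M <= t)].
  by rewrite /in_part; case: zb; lia.
rewrite /gam_t !ip /pvtx /aoff (_ : s + j - s = j); last lia.
case: (eqVneq j.+1 M) ij => E ij; case: zb; case: (eqVneq i 0) ij => [->|i0] ij.
- case: (leqP s (s + j)) => h; case: (leqP 0 j) => h'; (split; try lia);
  case: ifP => h1; try lia; case: (leqP _ j) => h2; lia.
- case: (leqP (s + i) (s + j)) => h; case: (leqP i j) => h'; (split; try lia);
  case: ifP => h1; try lia; case: (leqP _ j) => h2; lia.
- case: (eqVneq (s + M) N) => E'; [case: (leqP 0 (s + j)) => h|case: (leqP (s + M) (s + j)) => h];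
  case: (leqP 0 j) => h'; (split; try lia);
  case: ifP => h1; try lia; case: (ltnP _ j) => h2; lia.
- case: (leqP (s + i) (s + j)) => h; case: (leqP i j) => h'; (split; try lia);
  case: ifP => h1; try lia; case: (ltnP _ j) => h2; lia.
- case: (leqP s (s + j)) => h; case: (leqP 0 j) => h'; (split; try lia);
  case: ifP => h1; try lia; case: (leqP _ j) => h2; lia.
- case: (leqP (s + i) (s + j)) => h; case: (leqP i j) => h'; (split; try lia);
  case: ifP => h1; try lia; case: (leqP _ j) => h2; lia.
- case: (eqVneq (s + M) N) => E'; [case: (leqP 0 (s + j)) => h|case: (leqP (s + M) (s + j)) => h];
  case: (leqP 0 j) => h'; (split; try lia);
  case: ifP => h1; try lia; case: (ltnP _ j) => h2; lia.
- case: (leqP (s + i) (s + j)) => h; case: (leqP i j) => h'; (split; try lia);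
  case: ifP => h1; try lia; case: (ltnP _ j) => h2; lia.
Qed.

(** The gaps of the piece meet all the gaps of the [M]-gon, up to the last two
    which no arrow separates. *)
Lemma gam_surj j t : 1 < M -> j < M -> t < M -> exists2 t', t' < N &
  in_part (s + j) t' /\ gam_t (s + j) t' = if zb && (j == M - 1) && (t == M - 1) then t - 1 else t.
Proof.
move=> M1 jM tM.
have ip t' : in_part (s + j) t' = [&& 1 < M & if zb then (j.+1 < M) || (t' < M - 1) else (0 < j) || (N - M <= t')].
  by rewrite /in_part; case: zb; lia.
have E t' : gam_t (s + j) t' = if [&& 1 < M & if zb then (j.+1 < M) || (t' < M - 1) else (0 < j) || (N - M <= t')]
    then (if zb then (if t' <= j then t' else maxn j (t' - (N - M)))
     else (if t' < j then t' else maxn (j - 1) (t' - (N - M)))) else if zb then M - 1 else 0.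
  by rewrite /gam_t ip (_ : s + j - s = j); last lia.
have sol t' v : t' < N -> [&& 1 < M & if zb then (j.+1 < M) || (t' < M - 1) else (0 < j) || (N - M <= t')] ->
    (if zb then (if t' <= j then t' else maxn j (t' - (N - M)))
     else (if t' < j then t' else maxn (j - 1) (t' - (N - M)))) = v ->
    exists2 t', t' < N & in_part (s + j) t' /\ gam_t (s + j) t' = v.
  by move=> tN P Ev; exists t' => //; rewrite E ip P.
clear ip E; case: zb sol => /= sol.
  case: ifP => jt.
    by apply: (sol (M - 2)); [lia|lia|rewrite ifT; lia].
  case: (leqP t j) => tj; first by apply: (sol t); [lia|lia|rewrite tj].
  by apply: (sol (t + (N - M))); [lia|lia|rewrite ifF; lia].
case: (ltnP t j) => tj; first by apply: (sol t); [lia|lia|rewrite tj].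
by apply: (sol (t + (N - M))); [lia|lia|rewrite ifF; lia].
Qed.
End PieceArithmetic.

Record piece (N : nat) := Piece {
  psize : nat; pstart : nat; pfst : bool;
  psize_gt0 : 0 < psize; psize_lt : psize < N; pend_le : pstart + psize <= N }.

(** * Restriction of dissections and regions to a piece *)

Section Pieces.
Variables (N : nat) (p : piece N).
Notation M := (psize p).
Notation s := (pstart p).
Notation zb := (pfst p).
Let M0 : 0 < M := psize_gt0 p.
Let MN : M < N := psize_lt p.
Let sMN : s + M <= N := pend_le p.
Implicit Types (a : arrow N) (b : arrow M) (h g k : gap N) (d : {set arrow N}).

Lemma pside_lt (j : 'I_M) : s + j < N.
Proof. by have := ltn_ord j; have := sMN; lia. Qed.

Definition farr b : arrow N :=
  (Ordinal (pvtx_lt zb M0 MN sMN (ltn_ord b.1)), Ordinal (pside_lt b.2)).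

Definition gam h : gap M :=
  (Ordinal (gam_j_lt zb M0 MN sMN h.1 h.2), Ordinal (gam_t_lt zb M0 MN sMN h.1 (ltn_ord h.2))).

Definition part h : bool := in_part N M s zb h.1 h.2.

Definition restr d : {set arrow M} := [set b | nontrivial b && (farr b \in d)].

(** The preimage under [gam] has to be cut down to the piece, because [gam] also sends everything
    outside to one gap. *)
Definition fre (r : {set gap M}) : {set gap N} := [set h | part h && (gam h \in r)].

(** The gap of the piece at the cut. *)
Definition kap : nat := if zb then (M * M).-1 else 0.

Lemma nontrivial_farr b : nontrivial b -> nontrivial (farr b).
Proof. by rewrite !nontrivialE; apply: (nontriv_pvtx zb M0 MN sMN); rewrite ?ltn_ord. Qed.

Lemma on_left_farr b h : nontrivial b ->
  on_left (farr b) (gpos h) = on_left b (gpos (gam h)).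
Proof.
move=> nb; rewrite !on_leftE ?nontrivial_neq ?nontrivial_farr //=.
by apply: (lft_gam zb M0 MN sMN); rewrite ?ltn_ord -?nontrivialE.
Qed.

Lemma agree_farr b h g : nontrivial b -> agree (farr b) h g = agree b (gam h) (gam g).
Proof. by move=> nb; rewrite /agree !on_left_farr. Qed.

Lemma interleave_farr b b' : nontrivial b -> nontrivial b' ->
  interleave (farr b).1 (farr b).2 (farr b').1 (farr b').2 = interleave b.1 b.2 b'.1 b'.2.
Proof. by rewrite !nontrivialE => nb nb'; apply: (interleave_pvtx zb M0 MN sMN); rewrite ?ltn_ord. Qed.

Lemma mem_restr d b : nontrivial b -> (b \in restr d) = (farr b \in d).
Proof. by rewrite inE => ->. Qed.

Lemma restr_diss d : d \in dissections N -> restr d \in dissections M.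
Proof.
case/dissP=> dn dx; apply/dissP; split; first by move=> b; rewrite inE => /andP[].
move=> b b'; rewrite !inE => /andP[nb bd] /andP[nb' bd'].
by rewrite -interleave_farr // dx.
Qed.

Definition is_cut a : Prop := a.1 = pcut_i N M s zb :> nat /\ a.2 = pcut_j M s zb :> nat.

Lemma cut_exists : 1 < M -> exists2 a, nontrivial a & is_cut a.
Proof.
move=> M1; have h1 : pcut_i N M s zb < N by apply: (pvtx_lt zb M0 MN sMN).
have h2 : pcut_j M s zb < N by rewrite /pcut_j; case: zb; have := sMN; lia.
by exists (Ordinal h1, Ordinal h2); rewrite // nontrivialE; apply: (pcut_nontriv zb M0 MN sMN).
Qed.

Lemma part_gt1 h : part h -> 1 < M.
Proof. by case/and4P. Qed.

Lemma part_cut a h : is_cut a -> nontrivial a -> 1 < M -> part h = (on_left a (gpos h) == ~~ zb).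
Proof.
move=> [a1 a2] na M1; rewrite on_leftE ?nontrivial_neq // a1 a2.
by apply: (in_part_cut zb M0 MN sMN); rewrite ?ltn_ord.
Qed.

Definition cut_in d : Prop := 1 < M -> exists2 a, a \in d & is_cut a.

Lemma not_piece_agree d a h g : d \in dissections N -> cut_in d -> a \in d ->
  ~ (exists2 b, nontrivial b & a = farr b) -> part h -> part g -> agree a h g.
Proof.
move=> /dissP[dn dx] cd ad na ph pg; have M1 := part_gt1 ph.
have [c cD [c1 c2]] := cd M1; have nta := dn a ad.
have ni : ~~ in_piece N M s zb a.1 a.2.
  apply/negP => /(in_pieceP M0 MN sMN); rewrite -nontrivialE.
  case=> // i [j [iM jM nij ai aj]]; apply: na.
  exists (Ordinal iM, Ordinal jM); first by rewrite nontrivialE.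
  by case: (a) ai aj => a1 a2 /= ai aj; congr (_, _); apply: val_inj.
have ac : ~~ interleave a.1 a.2 (pcut_i N M s zb) (pcut_j M s zb) by rewrite -c1 -c2 dx.
rewrite /agree !on_leftE ?nontrivial_neq //.
have nta' : nontriv N a.1 a.2 by rewrite -nontrivialE.
have K k : part k -> lft N a.1 a.2 k.1 k.2 = _ :=
  lft_const M0 MN sMN (ltn_ord a.1) (ltn_ord a.2) nta' (ltn_ord k.1) (ltn_ord k.2) M1 ac ni.
by rewrite (K h ph) (K g pg).
Qed.

(** The cut confines the region to the piece. Inside, the arrows of the piece separate gaps as their
    counterparts in [restr d] do, and the other arrows do not separate them. *)
Lemma fre_region d h : d \in dissections N -> cut_in d -> part h ->
  region_at d (gpos h) = fre (region_at (restr d) (gpos (gam h))).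
Proof.
move=> dD cd ph; have /dissP[dn dx] := dD; have M1 := part_gt1 ph.
apply/setP => k; rewrite [in RHS]inE; apply/regionP/andP => [H|[pk /regionP H] a ad].
  have [c cD c12] := cd M1; split.
    have := H c cD; rewrite /agree => /eqP; move: ph.
    by rewrite !(part_cut _ c12 (dn _ cD)) // => /eqP -> ->.
  by apply/regionP => b; rewrite inE => /andP[nb bd]; rewrite -agree_farr // H.
have [[b nb ab]|nab] := pselect (exists2 b, nontrivial b & a = farr b).
  by rewrite ab agree_farr // H // mem_restr // -ab.
exact: (not_piece_agree dD cd ad nab pk ph).
Qed.

Lemma gam_surj_agree (g : gap M) : 1 < M -> exists h, [/\ part h, (gam h).1 = g.1 &
  forall b, nontrivial b -> agree b (gam h) g].
Proof.
case: g => j t M1; have [t' tN [ip gt]] := gam_surj zb M0 MN sMN M1 (ltn_ord j) (ltn_ord t).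
have jE : gam_j N M s zb (s + j) t' = j by rewrite /gam_j ip; lia.
pose h : gap N := (Ordinal (pside_lt j), Ordinal tN).
have hj : (gam h).1 = j by apply: val_inj.
exists h; split => // b nb; rewrite /agree !on_leftE ?nontrivial_neq // hj /=.
rewrite gt; case: ifP => // /andP[/andP[_ /eqP jM] /eqP tM].
move: nb; rewrite nontrivialE /nontriv /lft; have := ltn_ord b.1; have := ltn_ord b.2.
case: b => i j' /= j'M iM; rewrite jM tM.
by case: (leqP i j') => ij; case: (eqVneq j'.+1 M) => E; lia.
Qed.

Lemma restr_regionP d r : d \in dissections N -> r \in regions (restr d) ->
  exists h, part h /\ r = region_at (restr d) (gpos (gam h)).
Proof.
move=> dD /regionsP[M1 [g ->]]; have [h [ph _ H]] := gam_surj_agree g M1.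
exists h; split=> //; apply/region_eqP/regionP => b; rewrite inE => /andP[nb _].
by rewrite agree_sym H.
Qed.

Lemma fre_regions d r : d \in dissections N -> cut_in d -> r \in regions (restr d) ->
  fre r \in regions d.
Proof.
move=> dD cd rd; have [h [ph ->]] := restr_regionP dD rd.
rewrite -fre_region //; apply/regionsP; split; last by exists h.
by have := part_gt1 ph; have := MN; lia.
Qed.

Lemma fre_inj d : d \in dissections N -> {in regions (restr d) &, injective fre}.
Proof.
move=> dD r r' rd rd' E; have [h [ph rE]] := restr_regionP dD rd.
have : h \in fre r by rewrite inE ph rE region_refl.
rewrite E inE => /andP[_]; have [h' [ph' ->]] := restr_regionP dD rd'.
by rewrite rE => /region_eqP.
Qed.

Lemma fre_part r h : h \in fre r -> part h.
Proof. by rewrite inE => /andP[]. Qed.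

Lemma fre_neq0 d r : d \in dissections N -> r \in regions (restr d) -> exists h, h \in fre r.
Proof.
move=> dD rd; have [h [ph ->]] := restr_regionP dD rd.
by exists h; rewrite inE ph region_refl.
Qed.

Lemma part_endg b : nontrivial b -> part (endg (farr b)) /\ gam (endg (farr b)) = endg b.
Proof.
move=> nb; have := nb; rewrite nontrivialE => nb'.
have [h1 h2 h3 h4] := gam_end zb M0 MN sMN (ltn_ord b.1) (ltn_ord b.2) nb'.
have pE : part (endg (farr b)) by rewrite /part endg2.
split=> //; congr (_, _); apply: val_inj.
  rewrite -[LHS]/(gam_j N M s zb (endg (farr b)).1 (endg (farr b)).2) /gam_j.
  by rewrite -[in_part _ _ _ _ _ _]/(part (endg (farr b))) pE /=; lia.
rewrite -[LHS]/(gam_t N M s zb (endg (farr b)).1 (endg (farr b)).2).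
by rewrite -[RHS]/(nat_of_ord (endg b).2) !endg2.
Qed.

Lemma part_preg b : nontrivial b -> part (preg (farr b)) /\ gam (preg (farr b)) = preg b.
Proof.
move=> nb; have := nb; rewrite nontrivialE => nb'.
have [h1 h2 h3 h4] := gam_end zb M0 MN sMN (ltn_ord b.1) (ltn_ord b.2) nb'.
have pE : part (preg (farr b)) by rewrite /part preg2.
split=> //; congr (_, _); apply: val_inj.
  rewrite -[LHS]/(gam_j N M s zb (preg (farr b)).1 (preg (farr b)).2) /gam_j.
  by rewrite -[in_part _ _ _ _ _ _]/(part (preg (farr b))) pE /=; lia.
rewrite -[LHS]/(gam_t N M s zb (preg (farr b)).1 (preg (farr b)).2).
by rewrite -[RHS]/(nat_of_ord (preg b).2) !preg2.
Qed.

Lemma left_region_farr d b : d \in dissections N -> cut_in d -> b \in restr d ->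
  left_region d (farr b) = fre (left_region (restr d) b).
Proof.
move=> dD cd; rewrite inE => /andP[nb bd]; have [pe ge] := part_endg nb.
by rewrite /left_region !aendE fre_region // ge.
Qed.

Lemma right_region_farr d b : d \in dissections N -> cut_in d -> b \in restr d ->
  right_region d (farr b) = fre (right_region (restr d) b).
Proof.
move=> dD cd; rewrite inE => /andP[nb bd]; have [pe ge] := part_preg nb.
by rewrite /right_region !aend_predE ?nontrivial_neq ?nontrivial_farr // fre_region // ge.
Qed.

Lemma kap_gap : exists g : gap M, [/\ gpos g = kap, g.1 = (if zb then M - 1 else 0) :> nat &
  g.2 = (if zb then M - 1 else 0) :> nat].
Proof.
have h : (if zb then M - 1 else 0) < M by case: zb; have := M0; lia.
exists (Ordinal h, Ordinal h); split=> //; rewrite /gpos /kap /=; case: zb => //.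
by case: (M) M0 => // m _; rewrite subn1 /=; lia.
Qed.

Lemma gam_out h : ~~ part h -> gpos (gam h) = kap.
Proof.
move=> ph; have [g [<- g1 g2]] := kap_gap; congr gpos.
rewrite /part in ph; case: g g1 g2 => j t /= g1 g2; congr (_, _); apply: val_inj => /=.
  by rewrite /gam_j (negbTE ph) g1.
by rewrite /gam_t (negbTE ph) g2.
Qed.

(** Identifies the node by which the tree of the piece is attached to the rest of the tree. *)
Lemma cut_region d a : d \in dissections N -> a \in d -> is_cut a -> 1 < M ->
  (if zb then right_region d a else left_region d a) = fre (region_at (restr d) kap).
Proof.
move=> dD ad ca M1; have [dn _] := dissP _ dD; have na := dn a ad.
have cd : cut_in d by exists a.
have ne := nontrivial_neq na; have [a1 a2] := ca.
have [g [<- g1 g2]] := kap_gap.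
pose h := if zb then preg a else endg a.
have -> : (if zb then right_region d a else left_region d a) = region_at d (gpos h).
  by rewrite /h /right_region /left_region; case: zb; rewrite ?aend_predE ?aendE //.
have ph : part h.
  rewrite (part_cut _ ca na M1) /h; case: zb; first by rewrite (negbTE (preg_right na)).
  by rewrite endg_left.
rewrite fre_region //; congr fre; apply/region_eqP/regionP => b; rewrite inE => /andP[nb _].
rewrite /agree !on_leftE ?nontrivial_neq // g1 g2 /=.
have h1 : h.1 = a.2 by rewrite /h; case: zb.
have h2 : h.2 = (if zb then (aoff N a.1 a.2).-1 else aoff N a.1 a.2) :> nat.
  by rewrite /h; case: zb; rewrite ?endg2 ?preg2.
rewrite h1 h2 a1 a2.
have := nb; rewrite nontrivialE /nontriv /lft.
move: ph; rewrite /part /gam_j /gam_t h1 h2 a1 a2 => ->.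
have := ltn_ord b.1; have := ltn_ord b.2; case: b {nb} => i j /= jM iM.
rewrite /pcut_i /pcut_j /pvtx eqxx /aoff; have := sMN; have := MN; clear -M1 iM jM.
case: (pfst p) => MN sMN.
  case: (leqP s (s + M - 1)) => h; last lia.
  have -> : s + M - 1 - s = M - 1 by lia.
  by rewrite leq_pred; case: (leqP i j) => ij; case: (eqVneq j.+1 M) => E; lia.
rewrite subnn ltn0; case: (eqVneq (s + M) N) => E.
  by case: (leqP 0 s) => // h; case: (leqP i j) => ij; case: (eqVneq j.+1 M) => E'; lia.
case: (leqP (s + M) s) => h; first lia.
by case: (leqP i j) => ij; case: (eqVneq j.+1 M) => E'; lia.
Qed.

Lemma side_set_fre d r j : d \in dissections N -> r \in regions (restr d) -> j < M ->
  side_set (fre r) (s + j) = side_set r j.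
Proof.
move=> dD rd jM; apply/exists_inP/exists_inP => [[h]|[g gr /eqP gj]].
  rewrite inE => /andP[ph gr] /eqP hj; exists (gam h) => //=.
  by rewrite /gam_j (_ : in_part _ _ _ _ _ _) // hj; lia.
have /regionsP[M1 [k rE]] := rd.
have [h [ph hg H]] := gam_surj_agree g M1.
exists h; last first.
  have := congr1 val hg; rewrite /= /gam_j (_ : in_part _ _ _ _ _ _) // gj.
  by move: ph => /and4P[_ h1 h2 _]; lia.
rewrite inE ph /= rE; apply/regionP => b; rewrite inE => /andP[nb bd].
apply: agree_trans (H b nb) _; move: gr; rewrite rE => /regionP; apply.
by rewrite inE nb.
Qed.

Lemma side_set_fre_range r j : side_set (fre r) j -> s <= j < s + M.
Proof. by case/exists_inP => h /fre_part /and4P[_ h1 h2 _] /eqP <-; rewrite h1 h2. Qed.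

Lemma root_fre d r rho' rho (c' : 'I_M) (c : 'I_N) :
  d \in dissections N -> cut_in d -> r \in regions (restr d) -> c = s + c' :> nat ->
  (forall h, h.1 = rho :> nat -> (gam h).1 = rho' :> nat) ->
  s + rho' = rho \/ ((forall h, h.1 = rho :> nat -> ~~ part h) /\ pcut_j M s zb = s + rho') ->
  is_root (restr d) r rho' c' -> is_root d (fre r) rho c.
Proof.
move=> dD cd rd cc' H1 H2 [cr rc].
have [dn _] := dissP _ dD.
have sc : side_set r c' by case: cr => g gr gc; apply/exists_inP; exists g; rewrite ?gc.
have : side_set (fre r) c by rewrite cc' (side_set_fre dD rd).
case/exists_inP => h hr /eqP/val_inj hc.
have M1 : 1 < M by apply: part_gt1 (fre_part hr).
split; first by exists h.
case: rc => [c'r|[h1 [b bd [bc hb]]]].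
  case: H2 => [H2|[H2 H3]]; first by left; rewrite cc' c'r.
  right; split; first by move=> k /fre_part pk; apply: contraL pk => /eqP/H2.
  have [a ad [a1 a2]] := cd M1; exists a => //; split.
    by apply: val_inj; rewrite /= a2 H3 cc' c'r.
  move=> k g /fre_part pk gr; have pg := H2 g gr; rewrite /agree.
  move: pk pg; rewrite !(@part_cut a) ?dn // => /eqP -> /negP pg.
  by apply/eqP => E; apply: pg; rewrite E.
right; split.
  move=> k; rewrite inE => /andP[pk gk]; apply/eqP => kr.
  by have := h1 _ gk; rewrite (H1 k kr) eqxx.
move: bd; rewrite inE => /andP[nb bd]; exists (farr b) => //; split.
  by apply: val_inj; rewrite /= bc cc'.
move=> k g; rewrite inE => /andP[pk gk] gr.
by rewrite agree_farr // hb // H1.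
Qed.

End Pieces.

Arguments farr {N} p b.
Arguments fre {N} p r.

Section PieceLabels.
Variables (R : choiceType) (N : nat) (p : piece N) (x : nat -> R).
Notation M := (psize p).
Notation s := (pstart p).
Notation zb := (pfst p).

Definition rho (rs : bool) N := if rs then 0 else N.-1.

Definition lab (rs : bool) x N (d : {set arrow N}) (r : {set gap N}) : words R :=
  if rs then labS x d r else labE x d r.

Lemma lab_root (rs : bool) (y : nat -> R) N' (d : {set arrow N'}) r :
  d \in dissections N' -> r \in regions d ->
  exists2 c : 'I_N', is_root d r (rho rs N') c & lab rs y d r = can_label y N' (side_set r) c.
Proof. by move=> dD rd; rewrite /lab /rho; case: rs; [apply: labS_root|apply: labE_root]. Qed.

(** The positions of a piece for which root sides, in the sense of [rs'] in the
    piece and of [rs] in the whole polygon, agree on the regions of the piece. *)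
Definition root_compat (rs' rs : bool) :=
  [|| [&& zb, ~~ rs' & ~~ rs], [&& ~~ zb, rs', ~~ rs & s + M < N], [&& ~~ zb, rs', rs & 0 < s],
      [&& zb, s == 0, rs' & rs] | [&& ~~ zb, s + M == N, ~~ rs' & ~~ rs]].

Lemma lab_piece rs' rs d r : root_compat rs' rs ->
  d \in dissections N -> cut_in p d -> r \in regions (restr p d) ->
  lab rs' (fun j => x (s + j)) (restr p d) r = lab rs x d (fre p r).
Proof.
move=> comp dD cd rd; have M1 : 1 < M by case/regionsP: rd.
have [MN sMN] := (psize_lt p, pend_le p).
have rd' := fre_regions dD cd rd.
have [c' rc' ->] := lab_root rs' (fun j => x (s + j)) (restr_diss p dD) rd.
have [c rc ->] := lab_root rs x dD rd'.
have cN : s + c' < N by have := ltn_ord c'; lia.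
have rho_lt : rho rs N < N by rewrite /rho; case: (rs); lia.
(* Both labels are read cyclically up to the root side, so that only the root has to be matched, and
   it is unique. *)
suff : is_root d (fre p r) (rho rs N) (Ordinal cN).
  case/regionsP: rd' rc => _ [g E]; rewrite E => rc rc2.
  rewrite (is_root_uniq dD rho_lt rc rc2) -E /= /can_label; congr pword.
  rewrite (@cyc_sides_shift N M s _ (side_set r) c') //.
  - by rewrite -map_comp.
  - by move=> j jM; apply: side_set_fre dD rd jM.
  - by move=> j; apply: side_set_fre_range.
have gj (h : gap N) : (gam p h).1 = (if part p h then h.1 - s else if zb then M - 1 else 0) :> nat.
  by [].
have ph (h : gap N) : part p h = [&& s <= h.1, h.1 < s + M &
    if zb then (h.1.+1 < s + M) || (h.2 < M - 1) else (s < h.1) || (N - M <= h.2)].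
  by rewrite /part /in_part M1.
apply: (@root_fre N p d r (rho rs' M) (rho rs N) c') => //.
  move=> h hr; rewrite gj ph; move: hr comp; rewrite /root_compat /rho.
  have := ltn_ord h.1; have := ltn_ord h.2.
  by case: (rs') => /=; case: (rs) => /=; case: zb => /=; rewrite ?andbF ?orbF //=; case: ifP; lia.
move: comp; rewrite /root_compat /rho /pcut_j.
case: (rs') => /=; case: (rs) => /=; case: zb ph => /= ph; rewrite ?andbF ?orbF //= => comp; try by [left; lia].
- by right; split; [move=> h h0; rewrite ph; lia|lia].
- by right; split; [move=> h h0; rewrite ph; lia|lia].
- case: (eqVneq (s + M) N) => E; first by left; lia.
  by right; split; [move=> h h0; rewrite ph; lia|lia].
Qed.
End PieceLabels.

(** * Gluing dissections of a family of pieces *)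

Section Family.
Variables (N : nat) (K : finType) (pc : K -> piece N) (C : {set arrow N}).
Notation M k := (psize (pc k)).

(** Conditions under which the dissections containing [C] are exactly the families of dissections of
    the pieces. A trivial piece has no cut, whence the conditions [1 < M k]. *)
Record piece_family : Prop := Family {
  famC_nt : {in C, forall c, nontrivial c};
  famC_x : {in C &, forall a b : arrow N, ~~ interleave a.1 a.2 b.1 b.2};
  fam_Cx : forall k (b : arrow (M k)) c, nontrivial b -> c \in C ->
    ~~ interleave (farr (pc k) b).1 (farr (pc k) b).2 c.1 c.2;
  fam_x : forall k l (b : arrow (M k)) (b' : arrow (M l)), k != l -> nontrivial b -> nontrivial b' ->
    ~~ interleave (farr (pc k) b).1 (farr (pc k) b).2 (farr (pc l) b').1 (farr (pc l) b').2
    /\ farr (pc k) b != farr (pc l) b';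
  fam_notC : forall k (b : arrow (M k)), nontrivial b -> farr (pc k) b \notin C;
  fam_cover : forall a : arrow N, nontrivial a -> {in C, forall c : arrow N, ~~ interleave a.1 a.2 c.1 c.2} ->
    a \in C \/ exists k, exists2 b, nontrivial b & a = farr (pc k) b;
  fam_cut : forall k, 1 < M k -> exists2 c, c \in C & is_cut (pc k) c;
  fam_cut_of : forall c, c \in C -> exists2 k, 1 < M k & is_cut (pc k) c;
  fam_part : forall k l (h : gap N), part (pc k) h -> part (pc l) h -> k = l }.

Hypothesis fam : piece_family.

Definition glue (delta : forall k, {set arrow (M k)}) : {set arrow N} :=
  C :|: \bigcup_k farr (pc k) @: delta k.

Lemma mem_glue (delta : forall k, {set arrow (M k)}) a : reflect (a \in C \/ exists k, exists2 b, b \in delta k & a = farr (pc k) b)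
  (a \in glue delta).
Proof.
rewrite inE; apply: (iffP orP) => -[|]; [by left| |by left|].
  by case/bigcupP => k _ /imsetP[b bd ->]; right; exists k, b.
by case=> k [b bd ->]; right; apply/bigcupP; exists k => //; apply: imset_f.
Qed.

Lemma farr_inj k (b b' : arrow (M k)) : farr (pc k) b = farr (pc k) b' ->
  nontrivial b -> nontrivial b' -> b = b'.
Proof.
case: b b' => i j [i' j'] E _ _.
have E1 : pvtx N (M k) (pstart (pc k)) (pfst (pc k)) i = pvtx N (M k) (pstart (pc k)) (pfst (pc k)) i'.
  by have := congr1 (fun a : arrow N => val a.1) E.
have E2 : pstart (pc k) + j = pstart (pc k) + j' by have := congr1 (fun a : arrow N => val a.2) E.
have := ltn_ord i; have := ltn_ord i'; have := psize_lt (pc k); have := pend_le (pc k).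
move: E1; rewrite /pvtx => E1 h1 h2 h3 h4; congr (_, _); apply: val_inj => /=; last lia.
move: E1; case: (eqVneq (val i) 0) => /= i0; case: (eqVneq (val i') 0) => /= i0'; case: (pfst (pc k)); try lia;
  case: (eqVneq (pstart (pc k) + M k) N); lia.
Qed.

Lemma glue_restr d : d \in dissections N -> C \subset d ->
  glue (fun k => restr (pc k) d) = d.
Proof.
move=> /dissP[dn dx] /subsetP Cd; apply/setP => a; apply/mem_glue/idP.
  case=> [/Cd //|[k [b bd ->]]]; by move: bd; rewrite inE => /andP[].
move=> ad; have [||[k [b nb ab]]] := fam_cover fam (dn a ad).
- by move=> c cC; apply: dx => //; apply: Cd.
- by left.
- by right; exists k, b; rewrite // inE nb -ab.
Qed.

Section Glue.
Variable delta : forall k, {set arrow (M k)}.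
Hypothesis deltaD : forall k, delta k \in dissections (M k).

Lemma restr_glue k : restr (pc k) (glue delta) = delta k.
Proof.
have nt l b : b \in delta l -> nontrivial b by have /dissP[h _] := deltaD l; apply: h.
apply/setP => b; rewrite inE; apply/andP/idP => [[nb /mem_glue]|bd].
  case=> [bC|[l [b' bd' E]]]; first by have := fam_notC fam nb; rewrite bC.
  have [kl|kl] := eqVneq k l; last first.
    by have [_] := fam_x fam kl nb (nt _ _ bd'); rewrite E eqxx.
  by subst l; rewrite (farr_inj E nb (nt _ _ bd')).
split; first exact: nt bd.
by apply/mem_glue; right; exists k, b.
Qed.

Lemma glue_diss : glue delta \in dissections N.
Proof.
have nt l b : b \in delta l -> nontrivial b by have /dissP[h _] := deltaD l; apply: h.
apply/dissP; split.
  by move=> a /mem_glue[/(famC_nt fam) //|[k [b bd ->]]]; apply: nontrivial_farr (nt _ _ bd).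
move=> a a' /mem_glue[aC|[k [b bd ->]]] /mem_glue[aC'|[l [b' bd' ->]]].
- exact: (famC_x fam aC aC').
- by rewrite interleaveC; apply: (fam_Cx fam (nt _ _ bd') aC).
- by apply: (fam_Cx fam (nt _ _ bd) aC').
have [kl|kl] := eqVneq k l; last by have [] := fam_x fam kl (nt _ _ bd) (nt _ _ bd').
subst l; rewrite interleave_farr ?(nt _ _ bd) ?(nt _ _ bd') //.
by have /dissP[_ h] := deltaD k; apply: h.
Qed.

Lemma sub_glue : C \subset glue delta.
Proof. exact: subsetUl. Qed.
End Glue.

Section Nodes.
Variable d : {set arrow N}.
Hypotheses (dD : d \in dissections N) (Cd : C \subset d).

Lemma fam_cut_in k : cut_in (pc k) d.
Proof.
by move=> M1; have [c cC h] := fam_cut fam M1; exists c => //; apply: (subsetP Cd).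
Qed.

Definition pnode := {k : K & {set gap (M k)}}.
Definition pnodes : {set pnode} := [set w | tagged w \in regions (restr (pc (tag w)) d)].
Definition pregion (w : pnode) : {set gap N} := fre (pc (tag w)) (tagged w).

Lemma pregion_regions w : w \in pnodes -> pregion w \in regions d.
Proof. by rewrite inE => wV; apply: (fre_regions dD (fam_cut_in (k := tag w)) wV). Qed.

Lemma pregion_inj : {in pnodes &, injective pregion}.
Proof.
case=> k r [l r']; rewrite !inE /pregion /= => rV rV' E.
have [h hr] := fre_neq0 dD rV.
have kl : k = l by apply: (fam_part fam (fre_part hr)); apply: (@fre_part _ _ r'); rewrite -E.
by subst l; rewrite (fre_inj dD rV rV' E).
Qed.

Lemma pregion_cover k h : part (pc k) h ->
  exists2 w, w \in pnodes & region_at d (gpos h) = pregion w.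
Proof.
move=> ph; exists (existT _ k (region_at (restr (pc k) d) (gpos (gam (pc k) h)))).
  by rewrite inE /=; apply/regionsP; split; [apply: part_gt1 ph|exists (gam (pc k) h)].
by rewrite (fre_region dD (@fam_cut_in k) ph).
Qed.

Lemma nontrivial_gt1 n (b : arrow n) : nontrivial b -> 1 < n.
Proof.
rewrite nontrivialE /nontriv; have := ltn_ord b.1; have := ltn_ord b.2.
by case: ifP; lia.
Qed.

Lemma pregion_left k b w : w \in pnodes -> b \in restr (pc k) d ->
  (pregion w == left_region d (farr (pc k) b)) =
  (w == existT _ k (left_region (restr (pc k) d) b)).
Proof.
move=> wV bd; rewrite (left_region_farr dD (@fam_cut_in k) bd) -/(pregion (existT _ k _)).
rewrite (inj_in_eq pregion_inj) // inE /=; apply/regionsP; split.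
  by move: bd; rewrite inE => /andP[/nontrivial_gt1].
by exists (endg b); rewrite /left_region aendE.
Qed.

Lemma pregion_right k b w : w \in pnodes -> b \in restr (pc k) d ->
  (pregion w == right_region d (farr (pc k) b)) =
  (w == existT _ k (right_region (restr (pc k) d) b)).
Proof.
move=> wV bd; rewrite (right_region_farr dD (@fam_cut_in k) bd) -/(pregion (existT _ k _)).
have nb : nontrivial b by move: bd; rewrite inE => /andP[].
rewrite (inj_in_eq pregion_inj) // inE /=; apply/regionsP; split.
  exact: nontrivial_gt1 nb.
by exists (preg b); rewrite /right_region aend_predE ?nontrivial_neq.
Qed.

Lemma pregion_cut k a w : w \in pnodes -> a \in d -> is_cut (pc k) a -> 1 < M k ->
  (pregion w == if pfst (pc k) then right_region d a else left_region d a) =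
  (w == existT _ k (region_at (restr (pc k) d) (kap (pc k)))).
Proof.
move=> wV ad ca M1; rewrite (cut_region dD ad ca M1) -/(pregion (existT _ k _)).
rewrite (inj_in_eq pregion_inj) // inE /=; apply/regionsP; split=> //.
by have [g [<- _ _]] := kap_gap (pc k); exists g.
Qed.

Section Mid.
Variable hm : gap N.
Hypothesis hm_out : forall k, ~~ part (pc k) hm.
Let mid := region_at d (gpos hm).

(** A gap outside all pieces is on the same side as [hm] of each cut, and also of each arrow of a
    piece, because [gam] sends all gaps outside this piece to a single one. *)
Lemma mem_mid h : (h \in mid) = [forall k, ~~ part (pc k) h].
Proof.
apply/regionP/forallP => [H k|H a ad].
  apply/negP => pk; have M1 := part_gt1 pk.
  have [c cC ck] := fam_cut fam M1; have nc := famC_nt fam cC.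
  have := H c (subsetP Cd _ cC); rewrite /agree => E.
  by have := hm_out k; rewrite !(part_cut _ ck nc M1) in pk *; rewrite -(eqP E) pk.
have nta : nontrivial a by have /dissP[dn _] := dD; apply: dn.
have : a \in glue (fun k => restr (pc k) d) by rewrite glue_restr.
case/mem_glue => [aC|[k [b bd ->]]].
  have [k M1 ck] := fam_cut_of fam aC.
  have := H k; have := hm_out k; rewrite !(part_cut _ ck nta M1) /agree.
  by case: on_left; case: on_left; case: (pfst (pc k)).
move: bd; rewrite inE => /andP[nb _].
by rewrite agree_farr // /agree !gam_out.
Qed.

Lemma pregion_mid w : w \in pnodes -> pregion w != mid.
Proof.
case: w => k r; rewrite inE /= => rV; have [h hr] := fre_neq0 dD rV.
apply/eqP => E; have := fre_part hr; have : h \in mid by rewrite -E.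
by rewrite mem_mid => /forallP /(_ k) /negP.
Qed.

Lemma regions_mid r : 1 < N ->
  (r \in regions d) = (r == mid) || (r \in pregion @: pnodes).
Proof.
move=> N1; apply/idP/orP => [/regionsP[_ [g ->]]|[/eqP ->|/imsetP[w wV ->]]].
- have [/existsP[k pk]|] := boolP [exists k, part (pc k) g].
    by right; have [w wV ->] := pregion_cover pk; apply: imset_f.
  rewrite negb_exists => H; left; apply/eqP/region_eqP; by rewrite mem_mid.
- by apply/regionsP; split=> //; exists hm.
- exact: pregion_regions.
Qed.

Lemma mid_not_left k b : b \in restr (pc k) d -> mid != left_region d (farr (pc k) b).
Proof.
move=> bd; have nb : nontrivial b by move: bd; rewrite inE => /andP[].
rewrite (left_region_farr dD (@fam_cut_in k) bd) -/(pregion (existT _ k _)) eq_sym.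
apply: pregion_mid; rewrite inE /=; apply/regionsP; split; first exact: nontrivial_gt1 nb.
by exists (endg b); rewrite /left_region aendE.
Qed.

Lemma mid_not_right k b : b \in restr (pc k) d -> mid != right_region d (farr (pc k) b).
Proof.
move=> bd; have nb : nontrivial b by move: bd; rewrite inE => /andP[].
rewrite (right_region_farr dD (@fam_cut_in k) bd) -/(pregion (existT _ k _)) eq_sym.
apply: pregion_mid; rewrite inE /=; apply/regionsP; split; first exact: nontrivial_gt1 nb.
by exists (preg b); rewrite /right_region aend_predE ?nontrivial_neq.
Qed.

End Mid.
End Nodes.
End Family.

(** * The tree as a star around the middle region *)

Section FamilyStar.
Variables (R : choiceType) (n : nat).
Variables (N : nat) (K : finType) (pc : K -> piece N) (C : {set arrow N}).
Hypothesis fam : piece_family pc C.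
Variable d : {set arrow N}.
Hypotheses (dD : d \in dissections N) (Cd : C \subset d).
Notation M k := (psize (pc k)).

Variables (x : nat -> R) (rs flp : K -> bool).
Definition pforest k : ftree R :=
  pft (fun j => x (pstart (pc k) + j)) (rs k) (flp k) (pfst (pc k)) (restr (pc k) d).

(** [None] stands for the middle region. A piece with [pfst] lies to the right of its cut, so that
    its edge leaves the middle region, unless the cut starts at the first vertex and is reversed;
    [outE] below records this. *)
Definition mstar_e (out : pred K) : rel (option (pnode pc)) := fun w w' =>
  match w, w' with
  | Some w, Some w' => (tag w == tag w') && fe (f := pforest (tag w)) (tagged w) (tagged_as w w')
  | None, Some w => out (tag w) && fc (f := pforest (tag w)) (tagged w)
  | Some w, None => ~~ out (tag w) && fc (f := pforest (tag w)) (tagged w)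
  | None, None => false
  end.

Definition mstar_l (u : words R) (w : option (pnode pc)) : words R :=
  if w is Some w then fl (f := pforest (tag w)) (tagged w) else u.

Variable hm : gap N.
Hypothesis hm_out : forall k, ~~ part (pc k) hm.
Let mid := region_at d (gpos hm).
Hypothesis mid_cut : forall k c, c \in C -> is_cut (pc k) c -> 1 < M k ->
  (if pfst (pc k) then left_region d c else right_region d c) = mid.
Hypothesis flE : forall k (b : arrow (M k)), nontrivial b ->
  flp k && (b.1 == 0 :> nat) = ((farr (pc k) b).1 == 0 :> nat).
Variable out : pred K.
Hypothesis outE : forall k, 1 < M k ->
  out k = (pfst (pc k) != (pcut_i N (M k) (pstart (pc k)) (pfst (pc k)) == 0)).

Definition mregion (w : option (pnode pc)) : {set gap N} := if w is Some w then pregion w else mid.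
Definition mnodes : {set option (pnode pc)} := [set w | if w is Some w then w \in pnodes pc d else true].

Lemma fam_arrow a : a \in d ->
  (exists2 k, 1 < M k & is_cut (pc k) a /\ a \in C) \/
  (exists k, exists2 b, b \in restr (pc k) d & a = farr (pc k) b).
Proof.
move=> ad; have : a \in glue C (fun k => restr (pc k) d) by rewrite glue_restr.
case/mem_glue => [aC|]; [left|by right].
by have [k M1 ck] := fam_cut_of fam aC; exists k.
Qed.

Lemma pregion_midF w : w \in pnodes pc d -> (pregion w == mid) = false.
Proof. by move=> wV; apply/negbTE; apply: (pregion_mid fam). Qed.

Lemma mstar_edges w w' : w \in mnodes -> w' \in mnodes ->
  mstar_e out w w' = [exists a in d,
     if a.1 == 0 :> nat then (mregion w == right_region d a) && (mregion w' == left_region d a)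
     else (mregion w == left_region d a) && (mregion w' == right_region d a)].
Proof.
rewrite !inE; have cutd c : c \in C -> c \in d by apply: (subsetP Cd).
case: w => [w|]; case: w' => [w'|] wV wV' /=.
- apply/andP/exists_inP => [[tw]|[a ad]].
    case: w w' tw wV wV' => k r [k' r'] /= /eqP kk'; subst k'; rewrite tagged_asE => wV wV'.
    case/exists_inP => b bd; have nb : nontrivial b by move: bd; rewrite inE => /andP[].
    rewrite flE // => H; exists (farr (pc k) b); first by move: bd; rewrite inE => /andP[].
    by rewrite !(pregion_left fam dD Cd _ bd) ?(pregion_right fam dD Cd _ bd) // !eq_Tagged.
  have [[k M1 [ck cC]]|[k [b bd ->]]] := fam_arrow ad.
    have := mid_cut cC ck M1; case: (pfst _) => ->; rewrite !pregion_midF ?andbF //; by case: ifP.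
  have nb : nontrivial b by move: bd; rewrite inE => /andP[].
  rewrite !(pregion_left fam dD Cd _ bd) ?(pregion_right fam dD Cd _ bd) // -flE //.
  move=> H; have [tw tw'] : tag w = k /\ tag w' = k.
    by move: H; case: ifP => _ /andP[/eqP -> /eqP ->].
  case: w w' tw tw' wV wV' H => l r [l' r'] /= lk lk' _ _; subst l l'; rewrite !eq_Tagged eqxx tagged_asE.
  by move=> H; split=> //; apply/exists_inP; exists b.
- apply/andP/exists_inP => [[ok /eqP rE]|[a ad]].
    have M1 : 1 < M (tag w) by move: wV; rewrite inE => /regionsP[].
    have [c cC ck] := fam_cut fam M1; exists c; first exact: cutd.
    have := pregion_cut fam dD wV (cutd _ cC) ck M1; have := mid_cut cC ck M1.
    have -> : w == existT _ (tag w) (region_at (restr (pc (tag w)) d) (kap (pc (tag w)))).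
      by rewrite -[X in X == _]taggedK eq_Tagged rE.
    move: ok; rewrite outE //; have [-> _] := ck.
    by case: (pfst _) => /=; case: (_ == 0) => //= _ -> ->; rewrite eqxx.
  have [[k M1 [ck cC]]|[k [b bd ->]]] := fam_arrow ad; last first.
    have := mid_not_left fam dD Cd hm_out bd; have := mid_not_right fam dD Cd hm_out bd.
    by rewrite -/mid => /negbTE -> /negbTE ->; rewrite !andbF; case: ifP.
  have := pregion_cut fam dD wV ad ck M1; have mc := mid_cut cC ck M1; have [a1 _] := ck.
  have sd := cut_region dD ad ck M1; rewrite a1.
  have ne : (mid == if pfst (pc k) then right_region d a else left_region d a) = false.
    rewrite sd -/(pregion (existT (fun k => {set gap (M k)}) k _)) eq_sym; apply: pregion_midF.
    by rewrite inE /=; apply/regionsP; split=> //; have [g [<- _ _]] := kap_gap (pc k); exists g.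
  move=> E; have oE := outE M1; move: mc ne oE E.
  case: (pfst (pc k)) => /= mc ne oE E; rewrite mc; case: ifP => c0;
    rewrite ?eqxx ?ne ?andbF ?andbT //= E => /eqP ->; by rewrite /= oE c0; split.
- apply/andP/exists_inP => [[ok /eqP rE]|[a ad]].
    have M1 : 1 < M (tag w') by move: wV'; rewrite inE => /regionsP[].
    have [c cC ck] := fam_cut fam M1; exists c; first exact: cutd.
    have := pregion_cut fam dD wV' (cutd _ cC) ck M1; have := mid_cut cC ck M1.
    have -> : w' == existT _ (tag w') (region_at (restr (pc (tag w')) d) (kap (pc (tag w')))).
      by rewrite -[X in X == _]taggedK eq_Tagged rE.
    move: ok; rewrite outE //; have [-> _] := ck.
    by case: (pfst _) => /=; case: (_ == 0) => //= _ -> ->; rewrite eqxx.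
  have [[k M1 [ck cC]]|[k [b bd ->]]] := fam_arrow ad; last first.
    have := mid_not_left fam dD Cd hm_out bd; have := mid_not_right fam dD Cd hm_out bd.
    by rewrite -/mid => /negbTE -> /negbTE ->; case: ifP.
  have := pregion_cut fam dD wV' ad ck M1; have mc := mid_cut cC ck M1; have [a1 _] := ck.
  have sd := cut_region dD ad ck M1; rewrite a1.
  have ne : (mid == if pfst (pc k) then right_region d a else left_region d a) = false.
    rewrite sd -/(pregion (existT (fun k => {set gap (M k)}) k _)) eq_sym; apply: pregion_midF.
    by rewrite inE /=; apply/regionsP; split=> //; have [g [<- _ _]] := kap_gap (pc k); exists g.
  move=> E; have oE := outE M1; move: mc ne oE E.
  case: (pfst (pc k)) => /= mc ne oE E; rewrite mc; case: ifP => c0;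
    rewrite ?eqxx ?ne ?andbF ?andbT //= E => /eqP ->; by rewrite /= oE c0; split.
- apply/esym/negbTE; rewrite negb_exists_in; apply/forall_inP => a ad.
  have [[k M1 [ck cC]]|[k [b bd ->]]] := fam_arrow ad; last first.
    have := mid_not_left fam dD Cd hm_out bd; have := mid_not_right fam dD Cd hm_out bd.
    by rewrite -/mid => /negbTE -> /negbTE ->; case: ifP.
  have sd := cut_region dD ad ck M1.
  have ne : (mid == if pfst (pc k) then right_region d a else left_region d a) = false.
    rewrite sd -/(pregion (existT (fun k => {set gap (M k)}) k _)) eq_sym; apply: pregion_midF.
    by rewrite inE /=; apply/regionsP; split=> //; have [g [<- _ _]] := kap_gap (pc k); exists g.
  by move: ne; case: (pfst _) => ->; rewrite ?andbF /=; case: ifP.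
Qed.

Lemma mstar_iso (u : words R) (e : rel {set gap N}) (l : {set gap N} -> words R) : 1 < N ->
  (forall r r', e r r' = [exists a in d,
     if a.1 == 0 :> nat then (r == right_region d a) && (r' == left_region d a)
     else (r == left_region d a) && (r' == right_region d a)]) ->
  eqm n u (l mid) ->
  (forall k r, r \in regions (restr (pc k) d) ->
    eqm n (lab (rs k) (fun j => x (pstart (pc k) + j)) (restr (pc k) d) r) (l (fre (pc k) r))) ->
  eqm n (LamE mnodes (mstar_e out) (mstar_l u)) (LamE (regions d) e l).
Proof.
move=> N1 eE ul ll; have mE w : (Some w \in mnodes) = (w \in pnodes pc d) by rewrite inE.
apply: (@LamE_iso _ _ _ _ mregion).
- case=> [w|] [w'|]; rewrite ?mE => wV wV' //= E.
  + by rewrite (pregion_inj fam dD wV wV' E).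
  + by have := pregion_midF wV; rewrite E eqxx.
  + by have := pregion_midF wV'; rewrite -E eqxx.
- apply/setP => r; rewrite (regions_mid fam dD Cd hm_out) //.
  apply/imsetP/orP => [[[w|]]|[/eqP ->|/imsetP[w wV ->]]].
  + by rewrite mE => wV ->; right; apply: imset_f.
  + by move=> _ ->; left.
  + by exists None; rewrite ?inE.
  + by exists (Some w); rewrite ?mE.
- by move=> w w' wV wV'; rewrite mstar_edges // eE.
- by case=> [[k r]|]; rewrite ?mE => wV //=; apply: ll; move: wV; rewrite inE.
Qed.

End FamilyStar.

(** * Dissections around a 2-gon *)

Section Bigon.
Variables (N a v b : nat).
Hypotheses (av : a < v) (vb : v <= b) (bN : b < N).

Fact bpiece_ff_lt : a.+1 < N. Proof. by lia. Qed.
Fact bpiece_ft_gt0 : 0 < v - a. Proof. by lia. Qed.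
Fact bpiece_ft_lt : v - a < N. Proof. by lia. Qed.
Fact bpiece_ft_le : a + (v - a) <= N. Proof. by lia. Qed.
Fact bpiece_tf_gt0 : 0 < b.+1 - v. Proof. by lia. Qed.
Fact bpiece_tf_lt : b.+1 - v < N. Proof. by lia. Qed.
Fact bpiece_tf_le : v + (b.+1 - v) <= N. Proof. by lia. Qed.
Fact bpiece_tt_gt0 : 0 < N - b. Proof. by lia. Qed.
Fact bpiece_tt_lt : N - b < N. Proof. by lia. Qed.
Fact bpiece_tt_le : b + (N - b) <= N. Proof. by lia. Qed.

(** The polygons cut out by a 2-gon with sides [a] and [b], whose vertex other
    than the first one is [v]. *)
Definition bpiece (k : bool * bool) : piece N := match k with
  | (false, false) => @Piece N a.+1 0 true (ltn0Sn a) bpiece_ff_lt (ltnW bpiece_ff_lt)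
  | (false, true) => @Piece N (v - a) a false bpiece_ft_gt0 bpiece_ft_lt bpiece_ft_le
  | (true, false) => @Piece N (b.+1 - v) v true bpiece_tf_gt0 bpiece_tf_lt bpiece_tf_le
  | (true, true) => @Piece N (N - b) b false bpiece_tt_gt0 bpiece_tt_lt bpiece_tt_le
  end.

Definition bcut (k : bool * bool) : nat * nat := match k with
  | (false, false) => (0, a) | (false, true) => (v, a)
  | (true, false) => (v, b) | (true, true) => (0, b)
  end.

Definition bcuts : {set arrow N} :=
  [set c | nontrivial c && [exists k, ((c.1 : nat) == (bcut k).1) && ((c.2 : nat) == (bcut k).2)]].

Definition in_bpiece k i j : bool := match k with
  | (false, false) => [&& i <= a, j <= a & ~~ ((i == 0) && (j == a))]
  | (false, true) => [&& a < i, i <= v, a <= j, j < v & ~~ ((i == v) && (j == a))]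
  | (true, false) => [&& v <= i, i <= b, v <= j, j <= b & ~~ ((i == v) && (j == b))]
  | (true, true) => [&& (i == 0) || (b < i < N), b <= j, j < N & ~~ ((i == 0) && (j == b))]
  end.

Lemma bpiece_cut k : pcut_i N (psize (bpiece k)) (pstart (bpiece k)) (pfst (bpiece k)) = (bcut k).1 /\
  pcut_j (psize (bpiece k)) (pstart (bpiece k)) (pfst (bpiece k)) = (bcut k).2.
Proof.
rewrite /pcut_i /pcut_j /pvtx; case: k => [[] []] /=; split=> //; try lia.
  by rewrite ifT; lia.
by rewrite ifF; lia.
Qed.

Lemma in_bpieceE k i j : in_piece N (psize (bpiece k)) (pstart (bpiece k)) (pfst (bpiece k)) i j
  = in_bpiece k i j.
Proof.
have [E1 E2] := bpiece_cut k; rewrite /in_piece E1 E2 {E1 E2}.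
by case: k => [[] []] /=; lia.
Qed.

Lemma farr_bpiece k (c : arrow (psize (bpiece k))) : nontrivial c ->
  let a' := farr (bpiece k) c in nontriv N a'.1 a'.2 /\ in_bpiece k a'.1 a'.2.
Proof.
move=> nc; split; first by rewrite -nontrivialE nontrivial_farr.
rewrite -in_bpieceE; apply: (in_piece_pvtx _ (psize_gt0 _) (psize_lt _) (pend_le _)) => //.
by rewrite -nontrivialE.
Qed.

Lemma mem_bcuts (c : arrow N) : reflect (nontrivial c /\ exists k, val c.1 = (bcut k).1 /\ val c.2 = (bcut k).2)
  (c \in bcuts).
Proof.
rewrite inE; apply: (iffP andP) => -[nc].
  by move=> /existsP[k /andP[/eqP h1 /eqP h2]]; split=> //; exists k.
by move=> [k [h1 h2]]; split=> //; apply/existsP; exists k; rewrite -h1 -h2 !eqxx.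
Qed.

Lemma bcut_nt k : nontriv N (bcut k).1 (bcut k).2 = (1 < psize (bpiece k)).
Proof.
by rewrite /nontriv; case: k => [[] []] /=; case: (eqVneq b.+1 N); case: (eqVneq a.+1 N); lia.
Qed.

(** By the position of [i] with respect to 0, [a], [v] and [b]: an arrow that leaves the polygons at
    its starting vertex crosses one of the cuts. *)
Lemma bpiece_cover i j : i < N -> j < N -> nontriv N i j ->
  (forall k, nontriv N (bcut k).1 (bcut k).2 -> ~~ interleave i j (bcut k).1 (bcut k).2) ->
  (exists k, i = (bcut k).1 /\ j = (bcut k).2) \/ exists k, in_bpiece k i j.
Proof.
move=> iN jN _ H.
have X k : 1 < psize (bpiece k) -> interleave i j (bcut k).1 (bcut k).2 ->
    (exists k, i = (bcut k).1 /\ j = (bcut k).2) \/ exists k, in_bpiece k i j.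
  by rewrite -bcut_nt => /H /negbTE ->.
have Cut k : i = (bcut k).1 -> j = (bcut k).2 ->
    (exists k, i = (bcut k).1 /\ j = (bcut k).2) \/ exists k, in_bpiece k i j.
  by left; exists k.
have In k : in_bpiece k i j ->
    (exists k, i = (bcut k).1 /\ j = (bcut k).2) \/ exists k, in_bpiece k i j.
  by right; exists k.
move: X Cut In; rewrite /interleave => X Cut In; clear H.
case: (posnP i) => [i0|ipos].
  case: (ltngtP j a) => ja; [by apply: (In (false, false)) => /=; lia| |by apply: (Cut (false, false))].
  case: (ltnP j v) => jv; first by apply: (X (false, true)) => /=; rewrite ?ifT; lia.
  case: (ltngtP j b) => jb; [|by apply: (In (true, true)) => /=; lia|by apply: (Cut (true, true))].
  by apply: (X (true, false)) => /=; rewrite ?ifT; lia.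
case: (leqP i a) => ia.
  case: (leqP j a) => ja; first by apply: (In (false, false)) => /=; lia.
  by apply: (X (false, false)) => /=; rewrite ?ifT; lia.
case: (ltngtP i v) => iv.
- case: (boolP (a <= j < v)) => ja; first by apply: (In (false, true)) => /=; lia.
  by apply: (X (false, true)) => /=; case: (leqP i j); lia.
- case: (leqP i b) => ib.
    case: (boolP (v <= j <= b)) => ja; first by apply: (In (true, false)) => /=; lia.
    by apply: (X (true, false)) => /=; case: (leqP i j); lia.
  case: (leqP b j) => bj; last by apply: (X (true, true)) => /=; case: (leqP i j); lia.
  by apply: (In (true, true)) => /=; lia.
case: (ltngtP j a) => ja; [|  |by apply: (Cut (false, true))].
  by apply: (X (false, false)) => /=; case: (leqP i j); lia.
case: (ltnP j v) => jv; first by apply: (In (false, true)) => /=; lia.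
case: (ltngtP j b) => jb; [by apply: (In (true, false)) => /=; lia| |by apply: (Cut (true, false))].
by apply: (X (true, true)) => /=; case: (leqP i j); lia.
Qed.

Lemma bpiece_family : piece_family bpiece bcuts.
Proof.
split.
- by move=> c /mem_bcuts[].
- move=> c c' /mem_bcuts[_ [k [-> ->]]] /mem_bcuts[_ [k' [-> ->]]].
  by rewrite interleave_if; case: k => [[] []]; case: k' => [[] []] /=; lia.
- move=> k c c' nc /mem_bcuts[_ [k' [-> ->]]]; have /= [] := farr_bpiece nc.
  set i := pvtx _ _ _ _ _; set j := _ + _; rewrite interleave_if /nontriv; move: i j => i j.
  by case: k c nc => [[] []] c nc; case: k' => [[] []] /=; case: (eqVneq j.+1 N); lia.
- move=> k l c c' kl nc nc'; have [] := farr_bpiece nc; have [] := farr_bpiece nc'.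
  set f := farr _ c; set f' := farr _ c'; rewrite interleave_if /nontriv => n' p' n p.
  suff H : forall i j i' j', in_bpiece k i j -> in_bpiece l i' j' -> j < N -> j' < N ->
     (j != i) && ((if j.+1 == N then 0 else j.+1) != i) ->
     (j' != i') && ((if j'.+1 == N then 0 else j'.+1) != i') ->
     ~~ [&& i != i', j != j' & ((i <= j) && ((i < i' <= j) != (i <= j' < j))) ||
        ((j < i) && ((j < i' < i) != (j < j' < i)))] /\ ((i != i') || (j != j')).
    have [h1 h2] := H _ _ _ _ p p' (ltn_ord _) (ltn_ord _) n n'.
    by split=> //; apply: contraTneq h2 => ->; rewrite !eqxx.
  move: kl {f f' n p n' p'} => kl i j i' j' h h' jN jN'.
  case: (eqVneq j.+1 N); case: (eqVneq j'.+1 N); move: kl h h';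
    by case: k c nc => [[] []] c nc; case: l c' nc' => [[] []] c' nc' //=; lia.
- move=> k c nc; apply/negP => /mem_bcuts[_ [k' [h1 h2]]]; have [] := farr_bpiece nc.
  rewrite h1 h2 /nontriv; case: k c nc {h1 h2} => [[] []] c nc; case: k' => [[] []] /=;
    by case: (eqVneq b.+1 N); case: (eqVneq a.+1 N); lia.
- move=> c nc H; have nc' : nontriv N c.1 c.2 by rewrite -nontrivialE.
  have H' k : nontriv N (bcut k).1 (bcut k).2 -> ~~ interleave c.1 c.2 (bcut k).1 (bcut k).2.
    rewrite bcut_nt => M1; have [c' nc0 [h1 h2]] := cut_exists M1.
    have [E1 E2] := bpiece_cut k; rewrite -E1 -E2 -h1 -h2; apply: H.
    by apply/mem_bcuts; split=> //; exists k; rewrite -E1 -E2.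
  have [[k [h1 h2]]|[k pk]] := bpiece_cover (ltn_ord _) (ltn_ord _) nc' H'.
    by left; apply/mem_bcuts; split=> //; exists k.
  right; exists k; move: pk; rewrite -in_bpieceE.
  case/(in_pieceP (psize_gt0 _) (psize_lt _) (pend_le _)) => // [i [j [iM jM nij ai aj]]].
  exists (Ordinal iM, Ordinal jM); first by rewrite nontrivialE.
  by case: (c) ai aj => a1 a2 /= ai aj; congr (_, _); apply: val_inj.
- move=> k M1; have [c nc [h1 h2]] := cut_exists M1; exists c => //.
  by have [E1 E2] := bpiece_cut k; apply/mem_bcuts; split=> //; exists k; rewrite -E1 -E2.
- move=> c /mem_bcuts[nc [k [h1 h2]]]; have [E1 E2] := bpiece_cut k.
  by exists k; rewrite ?[is_cut _ _]/is_cut ?E1 ?E2 // -bcut_nt -h1 -h2 -nontrivialE.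
- move=> k l h; rewrite /part /in_part.
  by case: k => [[] []]; case: l => [[] []] //=; have := ltn_ord h.2; lia.
Qed.

Fact bigon_lt : a < N. Proof. by lia. Qed.
(** An arrow from the first vertex to side [a] ends at offset [a], one from [v] at the larger offset
    [a + N - v]; the gap just after the former end thus lies in the 2-gon. *)
Definition bmid : gap N := (Ordinal bigon_lt, Ordinal bigon_lt).

Lemma bmid_out k : ~~ part (bpiece k) bmid.
Proof. by rewrite /part /in_part; case: k => [[] []] /=; lia. Qed.

Lemma bmid_cut d k c : d \in dissections N -> bcuts \subset d ->
  c \in bcuts -> is_cut (bpiece k) c -> 1 < psize (bpiece k) ->
  (if pfst (bpiece k) then left_region d c else right_region d c) = region_at d (gpos bmid).
Proof.
move=> dD Cd cC ck M1; have fam := bpiece_family; have nc := famC_nt fam cC.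
have ne := nontrivial_neq nc.
have [E1 E2] := bpiece_cut k; have [c1 c2] := ck.
pose h := if pfst (bpiece k) then endg c else preg c.
have -> : (if pfst (bpiece k) then left_region d c else right_region d c) = region_at d (gpos h).
  by rewrite /h /right_region /left_region; case: (pfst _); rewrite ?aend_predE ?aendE.
apply/region_eqP; rewrite (mem_mid fam dD Cd bmid_out); apply/forallP => l.
have h1 : h.1 = (bcut k).2 :> nat by rewrite /h -E2 -c2; case: (pfst _).
have h2 : h.2 = (if pfst (bpiece k) then aoff N (bcut k).1 (bcut k).2 else (aoff N (bcut k).1 (bcut k).2).-1) :> nat.
  by rewrite /h -E1 -E2 -c1 -c2; case: (pfst _); rewrite ?endg2 ?preg2.
rewrite /part /in_part h1 h2 /aoff; move: M1; rewrite -bcut_nt /nontriv {h1 h2 h c1 c2 E1 E2 ck}.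
case: k => [[] []]; case: l => [[] []] /=;
 repeat (match goal with |- context [if ?x <= ?y then _ else _] => case: (leqP x y) => ? end); try lia;
 by case: ifP; lia.
Qed.

End Bigon.

(** * Sums over the dissections that contain given cuts *)

Section GlueSum.
Variables (R : choiceType) (N : nat) (K : finType) (pc : K -> piece N) (C : {set arrow N}).
Hypothesis fam : piece_family pc C.
Notation M k := (psize (pc k)).

(** Families of dissections have a type depending on [k]; they are encoded by a finite type [T] so
    that one can sum over them. *)
Lemma glue_sum (T : finType) (delta : T -> forall k, {set arrow (M k)})
    (Phi : {set arrow N} -> T) (F : {set arrow N} -> words R) :
  (forall d k, delta (Phi d) k = restr (pc k) d) ->
  (forall t d, (forall k, restr (pc k) d = delta t k) -> Phi d = t) ->
  (\sum_(d in dissections N | C \subset d) F d =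
   \sum_(t | [forall k, delta t k \in dissections (M k)]) F (glue C (delta t)))%R.
Proof.
move=> dP Pd; have ext d : glue C (delta (Phi d)) = glue C (fun k => restr (pc k) d).
  by congr (_ :|: _); apply: eq_bigr => k _; rewrite dP.
rewrite (reindex_onto (fun t => glue C (delta t)) Phi) /=; last first.
  by move=> d /andP[dD Cd]; rewrite ext glue_restr.
apply: eq_bigl => t; apply/andP/forallP => [[/andP[gD _] /eqP E] k|H].
  by rewrite -E dP restr_diss.
rewrite glue_diss // sub_glue; split=> //; apply/eqP; apply: Pd => k.
by rewrite (restr_glue fam H).
Qed.

Definition vsgn (i : nat) : rat := if i == 0 then (-1)%R else 1%R.

Lemma psgn_prod (flip : bool) M' (d : {set arrow M'}) :
  psgn flip d = (\prod_(a in d) (if flip && (a.1 == 0 :> nat) then -1 else 1))%R.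
Proof.
transitivity (\prod_(a in [set a in d | flip && (a.1 == 0 :> nat)]) (-1 : rat))%R.
  by rewrite prodr_const.
apply: etrans (big_mkcond _ _) _; apply: etrans _ (esym (big_mkcond _ _)).
by apply: eq_bigr => a _; rewrite inE; case: (a \in d).
Qed.

Lemma psgn_glue (fl : K -> bool) (delta : forall k, {set arrow (M k)}) :
  (forall k, delta k \in dissections (M k)) ->
  (forall k (b : arrow (M k)), nontrivial b ->
    fl k && (b.1 == 0 :> nat) = ((farr (pc k) b).1 == 0 :> nat)) ->
  psgn true (glue C delta) = ((\prod_(c in C) vsgn c.1) * \prod_k psgn (fl k) (delta k))%R.
Proof.
move=> dD flE; rewrite psgn_prod /=.
have nt k b : b \in delta k -> nontrivial b by have /dissP[h _] := dD k; apply: h.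
have dis : [disjoint C & \bigcup_k farr (pc k) @: delta k].
  rewrite -setI_eq0; apply/eqP/setP => a; rewrite !inE; apply/negP => /andP[aC /bigcupP[k _]].
  by case/imsetP => b bd ab; have := fam_notC fam (nt _ _ bd); rewrite -ab aC.
have eU : (fun a => a \in glue C delta) =1 [predU C & \bigcup_k farr (pc k) @: delta k].
  by move=> a; rewrite !inE.
rewrite (eq_bigl _ _ eU) bigU //; congr (_ * _)%R.
rewrite partition_disjoint_bigcup; last first.
  move=> k l kl; rewrite -setI_eq0; apply/eqP/setP => a; rewrite !inE.
  apply/negP => /andP[/imsetP[b bd ->] /imsetP[b' bd' E]].
  by have [_] := fam_x fam kl (nt _ _ bd) (nt _ _ bd'); rewrite E eqxx.
apply: eq_bigr => k _; rewrite psgn_prod big_imset.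
  by apply: eq_bigr => b bd; rewrite -flE ?(nt _ _ bd).
by move=> b b' bd bd' E; apply: farr_inj E (nt _ _ bd) (nt _ _ bd').
Qed.
End GlueSum.

Section BigonSum.
Variables (R : choiceType) (n : nat) (N : nat) (x : nat -> R).

(** The polygons before [v] have edges into the 2-gon and root sides as in the rotated polygon;
    those after [v] have edges out of it and root sides as in the polygon itself. The form [0 + j]
    matches the start of the first piece. *)
Definition bigon_star a v b u (d1 : {set arrow a.+1}) (d2 : {set arrow (v - a)})
    (d3 : {set arrow (b.+1 - v)}) (d4 : {set arrow (N - b)}) : words R :=
  gstar true u
    (fsum (pft (fun j => x (v + j)) false false true d3) (pft (fun j => x (b + j)) false true false d4))
    (fsum (pft (fun j => x (0 + j)) true true true d1) (pft (fun j => x (a + j)) true false false d2)).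

Definition bigon_sum a v b u : words R :=
  (\sum_(d1 in dissections a.+1) \sum_(d2 in dissections (v - a))
   \sum_(d3 in dissections (b.+1 - v)) \sum_(d4 in dissections (N - b))
     (psgn true d1 * psgn true d4) *: bigon_star u d1 d2 d3 d4)%R.

Variables (a v b : nat).
Hypotheses (av : a < v) (vb : v <= b) (bN : b < N).
Notation pc := (bpiece av vb bN).
Notation C := (bcuts N a v b).
Notation hm := (bmid av vb bN).
Let brs (k : bool * bool) := ~~ k.1.
Let bfl (k : bool * bool) := k.1 == k.2.
Let bout : pred (bool * bool) := fun k => k.1.

Lemma bflE k (c : arrow (psize (pc k))) : nontrivial c ->
  bfl k && (c.1 == 0 :> nat) = ((farr (pc k) c).1 == 0 :> nat).
Proof.
move=> nc; rewrite /= /pvtx /bfl; case: k c nc => [[] []] c nc /=; case: (eqVneq (val c.1) 0) => /= c0; try lia.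
  by rewrite ifT; lia.
by rewrite ifF; lia.
Qed.

Lemma boutE k : 1 < psize (pc k) ->
  bout k = (pfst (pc k) != (pcut_i N (psize (pc k)) (pstart (pc k)) (pfst (pc k)) == 0)).
Proof. by move=> _; rewrite (bpiece_cut av vb bN k).1; case: k => [[] []] /=; rewrite /bout /=; lia. Qed.

Definition bsum := option (({set gap (b.+1 - v)} + {set gap (N - b)}) + ({set gap a.+1} + {set gap (v - a)})).

Definition bnode (w : bsum) :
    option (pnode pc) :=
  match w with
  | None => None
  | Some (inl (inl r)) => Some (existT (fun k => {set gap (psize (pc k))}) (true, false) r)
  | Some (inl (inr r)) => Some (existT (fun k => {set gap (psize (pc k))}) (true, true) r)
  | Some (inr (inl r)) => Some (existT (fun k => {set gap (psize (pc k))}) (false, false) r)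
  | Some (inr (inr r)) => Some (existT (fun k => {set gap (psize (pc k))}) (false, true) r)
  end.

Definition bnode_inv (w : option (pnode pc)) : bsum :=
  match w with
  | None => None
  | Some (existT k r) =>
    (match k as k0 return {set gap (psize (pc k0))} -> bsum with
     | (true, false) => fun r => Some (inl (inl r))
     | (true, true) => fun r => Some (inl (inr r))
     | (false, false) => fun r => Some (inr (inl r))
     | (false, true) => fun r => Some (inr (inr r))
     end) r
  end.

Lemma bnodeK : cancel bnode bnode_inv.
Proof. by case=> [[[r|r]|[r|r]]|]. Qed.

Lemma bnode_invK : cancel bnode_inv bnode.
Proof. by case=> [[[[] []] r]|]. Qed.

Lemma bigon_star_iso (d : {set arrow N}) u (l : {set gap N} -> words R) :
  d \in dissections N -> C \subset d ->
  eqm n u (l (region_at d (gpos hm))) ->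
  (forall k r, r \in regions (restr (pc k) d) ->
    eqm n (lab (brs k) (fun j => x (pstart (pc k) + j)) (restr (pc k) d) r) (l (fre (pc k) r))) ->
  eqm n (bigon_star u (restr (pc (false, false)) d) (restr (pc (false, true)) d)
           (restr (pc (true, false)) d) (restr (pc (true, true)) d))
        (LamE (regions d) (fe (f := pft x true true true d)) l).
Proof.
move=> dD Cd ul ll; have N1 : 1 < N by lia.
have fam := bpiece_family av vb bN.
apply: eqm_trans (@mstar_iso R n N _ pc C fam d dD Cd x brs bfl hm (bmid_out av vb bN)
  (fun k c => @bmid_cut N a v b av vb bN d k c dD Cd) bflE bout boutE u _ l N1 _ ul ll); last first.
  by move=> r r' /=; apply: eq_existsb => c.
apply: (@LamE_iso _ _ _ _ bnode).
- by move=> w w' _ _; apply: (can_inj bnodeK).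
- apply/setP => w; rewrite -(bnode_invK w) (mem_imset _ _ (can_inj bnodeK)).
  by case: (bnode_inv w) => [[[r|r]|[r|r]]|]; rewrite !inE /= ?inE.
- by case=> [[[r|r]|[r|r]]|] [[[r'|r']|[r'|r']]|] _ _ //=; rewrite ?tagged_asE.
- by case=> [[[r|r]|[r|r]]|] _ /=; apply: eqm_refl.
Qed.

(** The cuts to [a] and to [b] from the first vertex are reversed and contribute a sign each, except
    a trivial one, which occurs for [a = 0] or [b = N.-1]. *)
Definition bsign : rat := ((if a == 0 then 1 else -1) * (if b == N.-1 then 1 else -1))%R.

Lemma bcuts_sign : (\prod_(c in C) vsgn c.1)%R = bsign.
Proof.
have N0 : 0 < N by lia.
pose o := Ordinal N0; pose h k : arrow N := (insubd o (bcut a v b k).1, insubd o (bcut a v b k).2).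
have hE k : val (h k).1 = (bcut a v b k).1 /\ val (h k).2 = (bcut a v b k).2.
  by rewrite /h !val_insubd; case: k => [[] []] /=; rewrite !ifT; lia.
have -> : C = h @: [set k | 1 < psize (pc k)].
  apply/setP => c; apply/mem_bcuts/imsetP => [[nc [k [h1 h2]]]|[k]].
    exists k; first by rewrite inE -bcut_nt -h1 -h2 -nontrivialE.
    have [E1 E2] := hE k; case: c h1 h2 {nc} => i j /= h1 h2.
    by rewrite [h k]surjective_pairing; congr (_, _); apply: val_inj; rewrite ?E1 ?E2.
  rewrite inE -bcut_nt => nk ->; have [E1 E2] := hE k; split; last by exists k.
  by rewrite nontrivialE E1 E2.
rewrite big_imset /=; last first.
  move=> k k'; rewrite !inE -!bcut_nt => nk nk' E.
  have [E1 E2] := hE k; have [E1' E2'] := hE k'.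
  move: E1 E2 nk nk'; rewrite E E1' E2' /nontriv {E E1' E2'}.
  by case: k => [[] []]; case: k' => [[] []] //=; case: (eqVneq a.+1 N); case: (eqVneq b.+1 N); lia.
rewrite (eq_bigl (fun k => 1 < psize (pc k))); last by move=> k; rewrite inE.
rewrite big_mkcond /=.
transitivity (\prod_(k1 : bool) \prod_(k2 : bool)
    (if (1 < psize (pc (k1, k2)))%N then vsgn (h (k1, k2)).1 else 1 : rat))%R.
  by rewrite pair_bigA; apply: eq_bigr => -[].
have Ev k : vsgn (h k).1 = (if (bcut a v b k).1 == 0 then -1 else 1)%R.
  by rewrite /vsgn -[nat_of_ord _]/(val _) (hE k).1.
rewrite !big_bool !Ev /= (_ : v == 0 = false); last by lia.
rewrite /bsign (_ : (b == N.-1) = ~~ (1 < N - b)); last by lia.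
rewrite (_ : (a == 0) = ~~ (1 < a.+1)); last by lia.
by case: (1 < N - b); case: (1 < a.+1); case: ifP; case: ifP; rewrite ?mulr1 ?mul1r // => _ _; rewrite mulrC.
Qed.

Lemma bigon_glue_sum u (l : {set arrow N} -> {set gap N} -> words R) :
  (forall d, d \in dissections N -> C \subset d -> eqm n u (l d (region_at d (gpos hm)))) ->
  (forall d, d \in dissections N -> C \subset d -> forall k r, r \in regions (restr (pc k) d) ->
    eqm n (lab (brs k) (fun j => x (pstart (pc k) + j)) (restr (pc k) d) r) (l d (fre (pc k) r))) ->
  eqm n (\sum_(d in dissections N | C \subset d)
          psgn true d *: LamE (regions d) (fe (f := pft x true true true d)) (l d))%R
        (bsign *: bigon_sum a v b u)%R.
Proof.
move=> ul ll; have fam := bpiece_family av vb bN.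
pose T := ((({set arrow a.+1} * {set arrow (v - a)}) * ({set arrow (b.+1 - v)} * {set arrow (N - b)})))%type.
pose delta (t : T) (k : bool * bool) : {set arrow (psize (pc k))} :=
  match k as k0 return {set arrow (psize (pc k0))} with
  | (false, false) => t.1.1 | (false, true) => t.1.2 | (true, false) => t.2.1 | (true, true) => t.2.2
  end.
pose Phi (d : {set arrow N}) : T := ((restr (pc (false, false)) d, restr (pc (false, true)) d),
  (restr (pc (true, false)) d, restr (pc (true, true)) d)).
apply: eqm_trans (eqm_eq _ (@glue_sum R N _ pc C fam T delta Phi _ _ _)) _.
- by move=> d [[] []].
- move=> [[d1 d2] [d3 d4]] d H; have := H (false, false); have := H (false, true).
  by have := H (true, false); have := H (true, true); rewrite /Phi /= => -> -> -> ->.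
have -> : bigon_sum a v b u = (\sum_(t : T | [forall k, delta t k \in dissections (psize (pc k))])
    (psgn true t.1.1 * psgn true t.2.2) *: bigon_star u t.1.1 t.1.2 t.2.1 t.2.2)%R.
  rewrite /bigon_sum pair_big /=.
  under eq_bigr do rewrite pair_big /=.
  rewrite pair_big /=; apply: eq_bigl => -[[d1 d2] [d3 d4]] /=.
  apply/idP/forallP => [/andP[/andP[h1 h2] /andP[h3 h4]] [[] []] //|H].
  by have := H (false, false); have := H (false, true);
     have := H (true, false); have := H (true, true); rewrite /= => -> -> -> ->.
rewrite scaler_sumr; apply: eqm_sum => -[[d1 d2] [d3 d4]] /forallP tD /=.
set d := glue _ _.
have dD : d \in dissections N by apply: glue_diss.
have Cd : C \subset d by apply: sub_glue.
have dE k : restr (pc k) d = delta ((d1, d2), (d3, d4)) k by apply: (restr_glue fam tD).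
have -> : psgn true d = (bsign * (psgn true d1 * psgn true d4))%R.
  rewrite (psgn_glue fam tD bflE) bcuts_sign; congr (_ * _)%R.
  transitivity (\prod_(k1 : bool) \prod_(k2 : bool)
      psgn (bfl (k1, k2)) (delta ((d1, d2), (d3, d4)) (k1, k2)))%R.
    by rewrite pair_bigA; apply: eq_bigr => -[].
  rewrite !big_bool /= /bfl /=.
  have psgn0 M (e : {set arrow M}) : psgn false e = 1%R.
    by rewrite /psgn eq_card0 // => c; rewrite !inE andbF.
  by rewrite !psgn0 mulr1 mul1r mulrC.
rewrite -scalerA; apply: eqmZ; apply: eqmZ; apply: eqm_sym.
have := @bigon_star_iso d u (l d) dD Cd (ul d dD Cd) (ll d dD Cd).
by rewrite !dE.
Qed.

End BigonSum.

Section BigonMid.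
Variables (R : choiceType) (N : nat) (x : nat -> R) (a v b : nat) (d : {set arrow N}).
Hypotheses (av : a < v) (vb : v <= b) (bN : b < N).
Hypotheses (dD : d \in dissections N) (Cd : bcuts N a v b \subset d).
Notation pc := (bpiece av vb bN).
Notation hm := (bmid av vb bN).
Notation mid := (region_at d (gpos hm)).

Lemma mem_bmid h : (h \in mid) = [forall k, ~~ part (pc k) h].
Proof. exact: (mem_mid (bpiece_family av vb bN) dD Cd (bmid_out av vb bN)). Qed.

Lemma bmid_sides j : side_set mid j = (j == a) || (j == b).
Proof.
apply/exists_inP/orP => [[[J t]]|H].
  rewrite mem_bmid => /forallP H /eqP <-; move: (H (false, false)) (H (false, true)) (H (true, false)) (H (true, true)).
  rewrite /part /in_part /=; have := ltn_ord J; lia.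
have bvN : b - v < N by lia.
(* The gaps just after the ends of the arrows from the first vertex to [a] and from [v] to [b]. *)
have hE : exists t : 'I_N, t = (if j == a then a else b - v) :> nat.
  by case: ifP => _; [exists (Ordinal (bigon_lt av vb bN))|exists (Ordinal bvN)].
have jN : j < N by lia.
have [t tE] := hE; exists (Ordinal jN, t) => //; rewrite mem_bmid; apply/forallP => k.
rewrite /part /in_part /= tE; case: (eqVneq j a) H => [->|ja] H; case: k => [[] []] /=; lia.
Qed.

Lemma cyc_sides_2 (S : pred nat) p q : p < N -> q < N -> p != q ->
  (forall j, j < N -> S j = (j == p) || (j == q)) -> cyc_sides N S q = [:: p; q].
Proof.
move=> pN qN pq SE; rewrite /cyc_sides.
have F (T : pred nat) : (forall j, j < N -> T j = (j == p)) -> [seq j <- iota 0 N | T j] = [:: p].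
  move=> TE; rewrite (eq_in_filter (a2 := pred1 p)).
    by rewrite filter_pred1_uniq ?iota_uniq ?mem_iota.
  by move=> j; rewrite mem_iota => jN; rewrite TE.
have F0 (T : pred nat) : (forall j, j < N -> T j = false) -> [seq j <- iota 0 N | T j] = [::].
  move=> TE; rewrite (eq_in_filter (a2 := pred0)) ?filter_pred0 // => j.
  by rewrite mem_iota => jN; rewrite TE.
move: pq; rewrite neq_ltn => /orP[lt|lt].
  by rewrite F0 ?F // => j jN; rewrite SE //; lia.
by rewrite F ?F0 // => j jN; rewrite SE //; lia.
Qed.

Lemma bmid_regions : mid \in regions d.
Proof. by apply/regionsP; split; [lia|exists hm]. Qed.

Lemma bmid_root_E (c : 'I_N) : is_root d mid N.-1 c -> c = b :> nat.
Proof.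
move=> rc; have rN : N.-1 < N by lia.
suff rb : is_root d mid N.-1 (Ordinal bN) by rewrite (is_root_uniq dD rN rc rb).
have : side_set mid b by rewrite bmid_sides eqxx orbT.
case/exists_inP => h hr /eqP hb; split; first by exists h => //; apply: val_inj.
have [bE|bN1] := eqVneq b N.-1; [by left|right; split].
  move=> g gr; apply/negP => /eqP gE.
  have : side_set mid N.-1 by apply/exists_inP; exists g; rewrite ?gE.
  rewrite bmid_sides; lia.
have M1 : 1 < psize (pc (true, true)) by rewrite /=; lia.
have fam := bpiece_family av vb bN; have [c' cC ck] := fam_cut fam M1.
exists c'; first exact: (subsetP Cd).
split; first by apply: val_inj; rewrite [LHS](proj2 ck).
move=> g g' gr gN; have nc := famC_nt fam cC.
have pg : ~~ part (pc (true, true)) g by move: gr; rewrite mem_bmid => /forallP.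
have pg' : part (pc (true, true)) g' by rewrite /part /in_part gN /=; lia.
rewrite /agree; move: pg pg'; rewrite !(part_cut _ ck nc M1).
by case: on_left; case: on_left.
Qed.

Lemma bmid_root_S (c : 'I_N) : is_root d mid 0 c -> c = a :> nat.
Proof.
move=> rc; have rN : 0 < N by lia.
suff rb : is_root d mid 0 (Ordinal (bigon_lt av vb bN)) by rewrite (is_root_uniq dD rN rc rb).
have : side_set mid a by rewrite bmid_sides eqxx.
case/exists_inP => h hr /eqP hb; split; first by exists h => //; apply: val_inj.
have [bE|bN1] := eqVneq a 0; [by left|right; split].
  move=> g gr; apply/negP => /eqP gE.
  have : side_set mid 0 by apply/exists_inP; exists g; rewrite ?gE.
  rewrite bmid_sides; lia.
have M1 : 1 < psize (pc (false, false)) by rewrite /=; lia.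
have fam := bpiece_family av vb bN; have [c' cC ck] := fam_cut fam M1.
exists c'; first exact: (subsetP Cd).
split; first by apply: val_inj; rewrite [LHS](proj2 ck) /pcut_j /=; lia.
move=> g g' gr gN; have nc := famC_nt fam cC.
have pg : ~~ part (pc (false, false)) g by move: gr; rewrite mem_bmid => /forallP.
have pg' : part (pc (false, false)) g' by rewrite /part /in_part gN /=; lia.
rewrite /agree; move: pg pg'; rewrite !(part_cut _ ck nc M1).
by case: on_left; case: on_left.
Qed.

Lemma bmid_labE : labE x d mid = pword [:: x a; x b].
Proof.
have [c rc ->] := labE_root x dD bmid_regions; rewrite /can_label (bmid_root_E rc).
by rewrite (@cyc_sides_2 _ a b) //; [lia|lia|move=> j _; apply: bmid_sides].
Qed.

Lemma bmid_labS : labS x d mid = pword [:: x b; x a].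
Proof.
have [c rc ->] := labS_root x dD bmid_regions; rewrite /can_label (bmid_root_S rc).
by rewrite (@cyc_sides_2 _ b a) //; [lia|lia|move=> j _; rewrite bmid_sides orbC].
Qed.

End BigonMid.

(** The gap [bmid] depends only on [a], so that both 2-gons are the same region; its sides determine
    [b], and the extent of its part of side [a] determines [v]. *)
Lemma bigon_uniq N a v b v' b' (d : {set arrow N}) :
  a < v -> v <= b -> b < N -> v' <= b' -> b' < N -> v <= v' ->
  d \in dissections N -> bcuts N a v b \subset d -> bcuts N a v' b' \subset d ->
  v = v' /\ b = b'.
Proof.
move=> av vb bN vb' bN' vv' dD Cd Cd'; have av' : a < v' by apply: leq_trans vv'.
have hmE : gpos (bmid av vb bN) = gpos (bmid av' vb' bN') by [].
have bb' : b = b'.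
  have := bmid_sides av vb bN dD Cd b; rewrite hmE (bmid_sides av' vb' bN' dD Cd'); lia.
split=> //; apply/eqP; move: vv'; rewrite leq_eqVlt => /orP[//|lt].
have tN : a + N - v' < N by lia.
(* If [v < v'], the arrow from [v'] ends on side [a] before the one from [v]; the gap after its end
   is inside the first 2-gon and outside the second. *)
pose h : gap N := (Ordinal (bigon_lt av vb bN), Ordinal tN).
have h1 : h \in region_at d (gpos (bmid av vb bN)).
  rewrite mem_bmid //; apply/forallP => k; rewrite /part /in_part.
  by case: k => [[] []] /=; lia.
move: h1; rewrite hmE mem_bmid // => /forallP /(_ (false, true)).
by rewrite /part /in_part /=; lia.
Qed.

(** [(k, k - v)] is the gap just after the end of an arrow from [v] to [k], and [(a, a)] the one
    just after the end of an arrow from the first vertex to [a]. The last two hypotheses express the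
    maximal choices of [v], and then of [k], in [bigon_exists]. *)
Lemma bigon_corner N a v b k i j : a < v -> v <= k -> k <= b -> v <= b -> b < N -> i < N -> j < N ->
  nontriv N i j ->
  (a != 0 -> ~~ interleave i j 0 a) -> (b != N.-1 -> ~~ interleave i j 0 b) ->
  (v != a.+1 -> ~~ interleave i j v a) -> (k != v -> ~~ interleave i j v k) ->
  (j = a -> ~~ (v < i <= b)) -> (i = v -> j <= k) ->
  lft N i j k (k - v) = lft N i j a a.
Proof.
move=> av vk kb vb bN iN jN ij X1 X2 X3 X4 X5 X6.
have D : (i = 0 -> j != 0) -> i = j -> False by move: ij; rewrite /nontriv; lia.
have C (P : Prop) m l : (interleave i j m l -> False) -> interleave i j m l -> P by move=> h /h.
have {}X1 P a0 := C P _ _ (elimN idP (X1 a0)); have {}X2 P b0 := C P _ _ (elimN idP (X2 b0)).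
have {}X3 P v0 := C P _ _ (elimN idP (X3 v0)); have {}X4 P k0 := C P _ _ (elimN idP (X4 k0)).
have ji : j != i by move: ij; rewrite /nontriv => /andP[].
move: X1 X2 X3 X4; rewrite !interleave_if => X1 X2 X3 X4 {D C ij}; rewrite /lft.
case: (posnP i) => [i0|i0].
  case: (leqP j a) => ja; first by clear X1 X2 X3 X4 X5 X6; rewrite i0 /=; lia.
  case: (leqP k j) => jk; first by clear X1 X2 X3 X4 X5 X6; rewrite i0 /=; lia.
  case: (ltnP j v) => jv; first by apply: X3; clear X1 X2 X4 X5 X6; lia.
  by apply: X4; clear X1 X2 X3 X5 X6; lia.
case: (leqP i a) => ia.
  case: (leqP j a) => ja; last by apply: X1; clear X2 X3 X4 X5 X6; lia.
  by clear X1 X2 X3 X4 X5 X6; case: (leqP i j) => h; lia.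
case: (ltngtP i v) => iv.
- case: (boolP (a <= j < v)) => jr; last by apply: X3; clear X1 X2 X4 X5 X6; lia.
  by clear X1 X2 X3 X4 X5 X6; case: (leqP i j) => h; lia.
- case: (leqP i b) => ib; last first.
    case: (leqP b j) => bj; last by apply: X2; clear X1 X3 X4 X5 X6; lia.
    by clear X1 X2 X3 X4 X5 X6; case: (leqP i j) => h; lia.
  have ja : j != a by apply/eqP => /X5; lia.
  case: (ltnP j a) => ja'; first by apply: X1; clear X2 X3 X4 X5 X6; lia.
  case: (ltnP j v) => jv; first by apply: X3; clear X1 X2 X4 X5 X6; lia.
  case: (ltnP j k) => jk.
    case: (leqP i k) => ik; last by apply: X4; clear X1 X2 X3 X5 X6; lia.
    by clear X1 X2 X3 X4 X5 X6; case: (leqP i j) => h; lia.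
  case: (leqP i k) => ik.
    case: (ltnP k j) => kj; first by apply: X4; clear X1 X2 X3 X5 X6; lia.
    by clear X1 X2 X3 X4 X5 X6; case: (leqP i j) => h; lia.
  case: (ltnP b j) => bj; first by apply: X2; clear X1 X3 X4 X5 X6; lia.
  by clear X1 X2 X3 X4 X5 X6; case: (leqP i j) => h; lia.
have jk := X6 iv.
case: (ltnP j a) => ja'; first by apply: X1; clear X2 X3 X4 X5 X6; lia.
by clear X1 X2 X3 X4 X5 X6; case: (leqP i j) => h; lia.
Qed.

Lemma corner_lft N i j t t' : 0 < i -> i < N -> j < N -> j != 0 -> j != N.-1 ->
  lft N i j 0 t = lft N i j N.-1 t'.
Proof. by rewrite /lft => i0 iN jN j0 jN'; case: (leqP i j) => h; lia. Qed.

Lemma corner_lft0 N j t (first : bool) : j < N -> j != (if first then 0 else N.-1) ->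
  lft N 0 j (if first then 0 else N.-1) t = ~~ first.
Proof. by rewrite /lft; case: first => /=; lia. Qed.

(** An arrow to [a] from beyond [b] crosses the arrow from the first vertex to [b]. Any other one
    that separates the two gaps of [a] also separates [(a, ta)] from [(b, tb)]. *)
Lemma bigon_first N a b i ta tb : a < b -> i < N -> a <= ta ->
  lft N i a b tb = lft N i a a ta -> (b != N.-1 -> ~~ interleave i a 0 b) ->
  lft N i a a a = lft N i a a ta.
Proof.
move=> ab iN ata E X; move: E; rewrite /lft; case: (leqP i a) => ia; first by lia.
case: (ltnP b i) => bi; last by lia.
have /X : b != N.-1 by lia.
by rewrite interleave_if; lia.
Qed.

(** * The regions whose two labels are not congruent *)

Section BigonExists.
Variables (R : choiceType) (n N : nat) (x : nat -> R) (d : {set arrow N}).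
Hypotheses (dD : d \in dissections N) (Nn : N <= n.+1).

(* An arrow that does not start at the first vertex has the two corner gaps at
   this vertex on the same side. *)
Lemma root_start r (c c' : 'I_N) (first : bool) : r \in regions d ->
  is_root d r (if first then 0 else N.-1) c -> is_root d r (if first then N.-1 else 0) c' ->
  c != c' -> c = (if first then 0 else N.-1) :> nat \/
  exists2 e, e \in d & [/\ e.1 = 0 :> nat, e.2 = c & {in r, forall h, on_left e (gpos h) = first}].
Proof.
move=> rd rc rc' cc'; have [N1 [g rE]] := regionsP _ _ rd.
case: (rc) => -[h hr hc] [|[h1 [e ed [ec he]]]]; first by left.
right; exists e => //.
have ne : nontrivial e by have /dissP[dn _] := dD; apply: dn.
have N0 : 0 < N by lia.
have Nl : N.-1 < N by lia.
pose o : gap N := ((if first then Ordinal N0 else Ordinal Nl), Ordinal N0).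
have oE : o.1 = (if first then 0 else N.-1) :> nat by rewrite /o; case: (first).
have cr : val e.2 != (if first then 0 else N.-1) by rewrite ec -hc; apply: h1.
(* Otherwise [c] would also be the root with respect to the other side at the first vertex: it is
   that side, or else [e] separates [r] from it too. *)
have e10 : e.1 = 0 :> nat.
  apply/eqP/negPn/negP => e10; case/negP: cc'; apply/eqP.
  apply: (@is_root_uniq N d g (if first then N.-1 else 0)) => //; first by case: (first).
    rewrite -rE; split; first by exists h.
    have [cr'|cr'] := eqVneq (val e.2) (if first then N.-1 else 0); first by left; rewrite -ec.
    right.
    have sep (k k' : gap N) : k \in r -> k'.1 = (if first then N.-1 else 0) :> nat -> ~~ agree e k k'.
      move=> kr kE; apply: contra (he k o kr oE) => A; apply: agree_trans A _.
      rewrite /agree !on_leftE ?nontrivial_neq // oE kE; apply/eqP; move: cr cr' e10; rewrite /=.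
      by case: (first) => cr cr' e10; [apply: esym|]; apply: corner_lft; rewrite ?ltn_ord ?lt0n.
    split; last by exists e.
    move=> k kr; apply/negP => /eqP kE.
    by have := sep k k kr kE; rewrite /agree eqxx.
  by rewrite -rE.
have eo : on_left e (gpos o) = ~~ first.
  by rewrite on_leftE ?nontrivial_neq // e10 oE; apply: corner_lft0; rewrite ?ltn_ord.
by split=> // k kr; have := he k o kr oE; rewrite /agree eo; case: on_left; case: (first).
Qed.

(** Both labels list the same sides cyclically, so that they can differ modulo the ideal only for a
    region with two sides and two distinct roots. *)
Lemma bigon_exists r : r \in regions d ->
  eqm n (labE x d r) (labS x d r) \/
  exists a v b (av : a < v) (vb : v <= b) (bN : b < N),
    bcuts N a v b \subset d /\ r = region_at d (gpos (bmid av vb bN)).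
Proof.
move=> rd; have [N1 [g rE]] := regionsP _ _ rd.
have [c rc ->] := labE_root x dD rd; have [c' rc' ->] := labS_root x dD rd.
have [->|cc'] := eqVneq c c'; first by left; apply: eqm_refl.
have Sc : side_set r c by case: (rc) => -[h hr <-] _; apply/exists_inP; exists h.
have Sc' : side_set r c' by case: (rc') => -[h hr <-] _; apply/exists_inP; exists h.
have [S2|S2] := eqVneq (size [seq j <- iota 0 N | side_set r j]) 2; last first.
  by left; apply: can_label_eqm.
right.
have SE j : side_set r j -> j = c \/ j = c'.
  move=> Sj; have jN : j < N by case/exists_inP: Sj => h _ /eqP <-.
  have [] := @uniq_min_size _ [:: val c; val c'] [seq j <- iota 0 N | side_set r j].
  - by rewrite /= inE andbT.
  - by move=> i; rewrite !inE mem_filter mem_iota => /orP[] /eqP ->; rewrite ?Sc ?Sc' /=.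
  - by rewrite S2.
  move=> _ /(_ j); rewrite !inE mem_filter mem_iota Sj jN => /orP[] /eqP ->; [by left|by right].
have [dn dx] := dissP _ dD.
have A := @root_start r c c' false rd rc rc' cc'.
have B := @root_start r c' c true rd rc' rc; rewrite eq_sym in B; have {}B := B cc'.
case/exists_inP: (Sc) => hb hbr /eqP hbc; case/exists_inP: (Sc') => ha har /eqP hac.
have lt : c' < c.
  have ne : val c != val c' by [].
  case: A => [cN|[e ed [e1 ec el]]]; first by move: ne; rewrite /= cN; have := ltn_ord c'; lia.
  have := el _ har; rewrite on_leftE ?nontrivial_neq ?dn // e1 ec hac /lft /=.
  by move: ne => /=; lia.
have [a aE] : exists a, a = val c' by exists (val c').
have [b bE] : exists b, b = val c by exists (val c).
have ab : a < b by rewrite aE bE.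
have bN : b < N by rewrite bE; apply: ltn_ord.
have aN : a < N by rewrite aE; apply: ltn_ord.
have Xa i j : (exists2 e, e \in d & val e.1 = i /\ val e.2 = j) -> forall e', e' \in d ->
    ~~ interleave e'.1 e'.2 i j.
  by move=> [e ed [<- <-]] e' e'd; apply: dx.
have A' : b != N.-1 -> exists2 e, e \in d & val e.1 = 0 /\ val e.2 = b.
  rewrite bE => bN1; case: A => [cN|[e ed [e1 ec _]]]; first by rewrite /= cN eqxx in bN1.
  by exists e => //; rewrite ec.
have B' : a != 0 -> exists2 e, e \in d & val e.1 = 0 /\ val e.2 = a.
  rewrite aE => a0; case: B => [cN|[e ed [e1 ec _]]]; first by rewrite /= cN eqxx in a0.
  by exists e => //; rewrite ec.
have har2 : a <= ha.2.
  have [->|a0] := eqVneq a 0; first by [].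
  case: B => [cN|[e ed [e1 ec el]]]; first by move: a0; rewrite aE /= cN eqxx.
  have := el _ har; rewrite on_leftE ?nontrivial_neq ?dn // e1 ec hac /lft /= aE /=.
  lia.
have rg h : h \in r -> {in d, forall e, agree e h g} by rewrite rE => /regionP.
have hm_in (h : gap N) : h.1 = a :> nat -> h.2 = a :> nat -> h \in r.
  move=> h1 h2; rewrite rE; apply/regionP => e ed; apply: agree_trans (rg ha har e ed).
  have [ea|ea] := eqVneq (val e.2) a; last first.
    apply: same_side_agree; rewrite ?dn //; first by apply: val_inj; rewrite /= h1 aE hac.
    by rewrite -val_eqE /= h1 eq_sym.
  have := rg hb hbr e ed; have := rg ha har e ed; rewrite /agree => /eqP <-.
  rewrite !on_leftE ?nontrivial_neq ?dn // h1 h2 hac hbc -[nat_of_ord c']/(val c') -[nat_of_ord c]/(val c) -aE -bE.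
  rewrite -[nat_of_ord e.2]/(val e.2) ea => /eqP lb; apply/eqP; apply: bigon_first har2 lb _ => //.
  by move=> bN1; have := Xa _ _ (A' bN1) e ed; rewrite -[nat_of_ord e.2]/(val e.2) ea.
(* Among the arrows to [a] from vertices up to [b], the one starting last borders [r]; [a.+1] stands
   for the trivial arrow, when nothing is cut off there. *)
pose Pv w := (a < w <= b) && ((w == a.+1) || [exists e in d, (val e.1 == w) && (val e.2 == a)]).
have exv : exists w, Pv w by exists a.+1; rewrite /Pv eqxx ltnSn ab.
have Pvb w : Pv w -> w <= b by case/andP => /andP[].
case: (ex_maxnP exv Pvb) => v /andP[/andP[av vb] vP] vmax.
(* Here [w = v] stands for the trivial arrow. The gap just after the end of the arrow from [v] to
   the largest such side belongs to [r]; as [r] has only the sides [a] and [b], this side is [b]. *)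
pose Pk w := (v <= w < N) && ((w == v) || [exists e in d, (val e.1 == v) && (val e.2 == w)]).
have exk : exists w, Pk w by exists v; rewrite /Pk eqxx leqnn (leq_ltn_trans vb bN).
have Pkb w : Pk w -> w <= N by case/andP => /andP[_ /ltnW].
case: (ex_maxnP exk Pkb) => k /andP[/andP[vk kN] kP] kmax.
have vP' : v != a.+1 -> exists2 e, e \in d & val e.1 = v /\ val e.2 = a.
  by move/negbTE => v0; move: vP; rewrite v0 => /exists_inP[e ed /andP[/eqP ? /eqP ?]]; exists e.
have kP' : k != v -> exists2 e, e \in d & val e.1 = v /\ val e.2 = k.
  by move/negbTE => v0; move: kP; rewrite v0 => /exists_inP[e ed /andP[/eqP ? /eqP ?]]; exists e.
have kb : k <= b.
  have [->|kv] := eqVneq k v; first by [].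
  have [bN1|bN1] := eqVneq b N.-1; first by move: kN; rewrite bN1; clear; lia.
  have [e ed [e1 e2]] := kP' kv; have := Xa _ _ (A' bN1) e ed.
  rewrite -[nat_of_ord e.1]/(val e.1) -[nat_of_ord e.2]/(val e.2) e1 e2 interleave_if.
  by move: av vb vk; clear; lia.
have kvN : k - v < N by apply: leq_ltn_trans (leq_subr _ _) kN.
have gr : (Ordinal kN, Ordinal kvN) \in r.
  pose hm : gap N := (Ordinal aN, Ordinal aN).
  have hmr : hm \in r by apply: hm_in.
  rewrite rE; apply/regionP => e ed; apply: agree_trans (rg hm hmr e ed).
  rewrite /agree !on_leftE ?nontrivial_neq ?dn //=; apply/eqP.
  apply: (@bigon_corner N a v b k) => //; rewrite -?nontrivialE ?dn //.
  - by move=> a0; apply: Xa (B' a0) _ ed.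
  - by move=> b0; apply: Xa (A' b0) _ ed.
  - by move=> v0; apply: Xa (vP' v0) _ ed.
  - by move=> k0; apply: Xa (kP' k0) _ ed.
  - move=> ea; apply/negP => /andP[ve eb].
    have /vmax ev : Pv e.1; last by rewrite ltnNge ev in ve.
    by rewrite /Pv eb (ltn_trans av ve) /=; apply/orP; right; apply/exists_inP; exists e; rewrite ?eqxx //= ea eqxx.
  - move=> ev; case: (leqP v e.2) => ve; last by apply: leq_trans (ltnW ve) vk.
    apply: kmax; rewrite /Pk ve ltn_ord /=; apply/orP; right; apply/exists_inP; exists e => //.
    by rewrite /= ev !eqxx.
have kE : k = b.
  have /SE : side_set r k by apply/exists_inP; exists (Ordinal kN, Ordinal kvN).
  by rewrite -[nat_of_ord c']/(val c') -[nat_of_ord c]/(val c) -aE -bE => -[//|ka]; by move: (leq_trans av vk); rewrite ka ltnn.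
subst k; exists a, v, b, av, vb, bN; split; last first.
  by rewrite rE; apply/esym/region_eqP; rewrite -rE; apply: hm_in.
apply/subsetP => f /mem_bcuts[nf [l [f1 f2]]].
suff [e ed [e1 e2]] : exists2 e, e \in d & val e.1 = (bcut a v b l).1 /\ val e.2 = (bcut a v b l).2.
  suff -> : f = e by [].
  by case: f e f1 f2 e1 e2 {nf ed} => [f1 f2] [e1 e2] /= h1 h2 h3 h4; congr (_, _); apply: val_inj;
    rewrite /= ?h1 ?h2 ?h3 ?h4.
have M1 : 1 < psize (bpiece av vb bN l) by rewrite -bcut_nt -f1 -f2 -nontrivialE.
case: l f1 f2 M1 => [[] []] /= _ _ M1; [apply: A'|apply: kP'|apply: vP'|apply: B']; move: M1; clear; lia.
Qed.
End BigonExists.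

(** * The difference of the two generating sums *)

Section Rank.
Variable N : nat.
Implicit Types (r : {set gap N}) (h : gap N).

(** The position of the first gap of [r]. *)
Definition rank r := find (fun k => [exists h in r, gpos h == k]) (iota 0 (N * N)).

Lemma rank_le r h : h \in r -> rank r <= gpos h.
Proof.
move=> hr; rewrite leqNgt; apply/negP => lt; have := before_find 0 lt.
rewrite nth_iota ?gpos_lt // add0n => /negbT; rewrite negb_exists_in => /forall_inP /(_ h hr).
by rewrite eqxx.
Qed.

Lemma rank_mem r h : h \in r -> exists2 g, g \in r & gpos g = rank r.
Proof.
move=> hr; have lt : rank r < N * N by apply: leq_ltn_trans (rank_le hr) (gpos_lt h).
have : has (fun k => [exists h in r, gpos h == k]) (iota 0 (N * N)) by rewrite has_find size_iota.
move/(nth_find 0); rewrite nth_iota // => /exists_inP[g gr /eqP gE].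
by exists g.
Qed.

Lemma rank_inj d : {in regions d &, injective rank}.
Proof.
move=> _ _ /regionsP[_ [g ->]] /regionsP[_ [g' ->]] E.
have [h hr hE] := rank_mem (region_refl d g); have [h' hr' hE'] := rank_mem (region_refl d g').
have hh : h = h' by apply: gpos_inj; rewrite hE hE' E.
move/region_eqP: hr => <-; subst h'; by move/region_eqP: hr' => <-.
Qed.

Lemma rank_lt d r : r \in regions d -> rank r < N * N.
Proof.
by case/regionsP=> _ [g ->]; apply: leq_ltn_trans (rank_le (region_refl d g)) (gpos_lt g).
Qed.
End Rank.

Section Difference.
Variables (R : choiceType) (n N : nat) (x : nat -> R).
Hypotheses (Nn : N <= n.+1).

Definition tree_rel (d : {set arrow N}) : rel {set gap N} := fe (f := pft x true true true d).

Definition gon2 a b : words R := pword [:: x a; x b].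

Definition triple := ('I_N * 'I_N * 'I_N)%type.
Definition ordered (p : triple) := (p.1.1 < p.1.2) && (p.1.2 <= p.2).
Definition tri (d : {set arrow N}) (p : triple) :=
  ordered p && (bcuts N p.1.1 p.1.2 p.2 \subset d).
(** The position of [bmid], which is the first gap of the 2-gon and hence its rank. *)
Definition kpos (p : triple) := p.1.1 * N + p.1.1.

Section OneDissection.
Variable d : {set arrow N}.
Hypothesis dD : d \in dissections N.

(** The labels of the regions are changed one by one, in the order of [rank]. *)
Definition hyb k : words R := LamE (regions d) (tree_rel d) (hybrid (labE x d) (labS x d) (@rank N) k).
Definition hdiff k : words R := (hyb k - hyb k.+1)%R.

Lemma rank_bmid a v b (av : a < v) (vb : v <= b) (bN : b < N) : bcuts N a v b \subset d ->
  rank (region_at d (gpos (bmid av vb bN))) = a * N + a.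
Proof.
move=> Cd; apply/eqP; rewrite eqn_leq -[X in _ <= X]/(gpos (bmid av vb bN)) rank_le ?region_refl //=.
have [g gr <-] := rank_mem (region_refl d (bmid av vb bN)).
rewrite leqNgt; apply/negP; rewrite /gpos lex_ltn ?ltn_ord ?(bigon_lt av vb bN) // => lt.
move: gr; rewrite mem_bmid // => /forallP /(_ (false, false)); rewrite /part /in_part /=.
have := ltn_ord g.1; lia.
Qed.

Lemma tri_uniq p p' : tri d p -> tri d p' -> kpos p = kpos p' -> p = p'.
Proof.
case: p p' => [[a v] b] [[a' v'] b'] /andP[/andP[/= av vb] Cd] /andP[/andP[/= av' vb'] Cd'].
rewrite /kpos /= => E; have aa : a = a'.
  apply: val_inj => /=; have := @lex_ltn N a a a' a' (ltn_ord _) (ltn_ord _).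
  have := @lex_ltn N a' a' a a (ltn_ord _) (ltn_ord _); rewrite E ltnn; lia.
subst a'; have [vv|vv] := leqP v v'.
  have [h1 h2] := bigon_uniq av vb (ltn_ord b) vb' (ltn_ord b') vv dD Cd Cd'.
  by congr (_, _, _); apply: val_inj.
have [h1 h2] := bigon_uniq av' vb' (ltn_ord b') vb (ltn_ord b) (ltnW vv) dD Cd' Cd.
by congr (_, _, _); apply: val_inj.
Qed.

(** The sum has at most one term, by [tri_uniq]. It is empty if no region has rank [k] or if the
    label of that region does not change modulo the ideal. *)
Lemma hdiff_sum k : eqm n (hdiff k) (\sum_(p | tri d p && (kpos p == k)) hdiff k)%R.
Proof.
have zero : eqm n (hdiff k) 0%R -> eqm n (hdiff k) (\sum_(p | tri d p && (kpos p == k)) hdiff k)%R.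
  move=> z; apply: (eqm_trans z); apply: eqm_sym.
  have := @eqm_sum R n triple (index_enum _) (fun p => tri d p && (kpos p == k)) (fun=> hdiff k) (fun=> 0%R) (fun _ _ => z).
  by rewrite big1_eq.
have [rk|] := pselect (exists2 r, r \in regions d & rank r = k); last first.
  move=> nok; apply: zero; apply: eqm_eq; rewrite /hdiff /hyb /LamE; apply/eqP; rewrite subr_eq0; apply/eqP.
  rewrite big_seq_cond [RHS]big_seq_cond; apply: eq_bigr => s.
  rewrite mem_permutations => /andP[sV _]; apply: eq_big_seq => t.
  rewrite (perm_mem sV) mem_enum /hybrid ltnS (leq_eqVlt (rank t) k) => tV; case: eqP => //= tk.
  by case: nok; exists t.
have [r rd rk'] := rk; have [eES|[a [v [b [av [vb [bN [Cd rE]]]]]]]] := bigon_exists x dD Nn rd.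
  apply: zero; rewrite /hdiff -[X in eqm _ _ X](subrr (hyb k)); apply: eqmB; first exact: eqm_refl.
  apply: LamE_eq => // t tV; rewrite /hybrid ltnS (leq_eqVlt (rank t) k); case: eqP => /= [tk|_]; last first.
    by case: ifP => _; apply: eqm_refl.
  have -> : t = r by apply: (rank_inj tV rd); rewrite tk.
  by rewrite rk' ltnn; apply: eqm_sym.
have aN := bigon_lt av vb bN; have vN : v < N by lia.
pose p : triple := (Ordinal aN, Ordinal vN, Ordinal bN).
have tp : tri d p by rewrite /tri /ordered /= av vb.
have kp : kpos p = k by rewrite -rk' rE rank_bmid.
rewrite (big_pred1 p); first exact: eqm_refl.
move=> q; apply/andP/eqP => [[tq /eqP kq]|->]; last by rewrite tp kp.
by apply: tri_uniq; rewrite // kq kp.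
Qed.

Definition mid_label k (t : {set gap N}) : words R :=
  if rank t < k then labS x d t else if rank t == k then (labE x d t - labS x d t)%R else labE x d t.

Lemma hdiff_mid a v b (av : a < v) (vb : v <= b) (bN : b < N) : bcuts N a v b \subset d ->
  hdiff (a * N + a) = LamE (regions d) (tree_rel d) (mid_label (a * N + a)).
Proof.
move=> Cd; have rm := rank_bmid av vb bN Cd; have mV := bmid_regions av vb bN dD Cd.
rewrite /hdiff /hyb; apply/esym; apply: (LamE_replace _ mV); rewrite /hybrid /mid_label; first by rewrite rm ltnn eqxx ltnSn.
move=> t tV tm; rewrite ltnS (leq_eqVlt (rank t) (a * N + a)); case: (eqVneq (rank t) (a * N + a)) => [tk|_] /=.
  by case/eqP: tm; apply: (rank_inj tV mV); rewrite rm.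
by case: ifP.
Qed.

End OneDissection.

Lemma difference_triple (p : triple) : ordered p ->
  eqm n (\sum_(d in dissections N | bcuts N p.1.1 p.1.2 p.2 \subset d) psgn true d *: hdiff d (kpos p))%R
    (bsign N p.1.1 p.2 *: bigon_sum N x p.1.1 p.1.2 p.2 (gon2 p.1.1 p.2 - gon2 p.2 p.1.1))%R.
Proof.
case: p => [[a v] b] /= /andP[/= av vb]; have bN := ltn_ord b.
have := @bigon_glue_sum R n N x a v b av vb bN (gon2 a b - gon2 b a)%R (fun d => mid_label d (a * N + a)).
move=> H; apply: eqm_trans (H _ _).
- apply: eqm_sum => d /andP[dD Cd]; apply: eqmZ; apply: eqm_eq.
  by rewrite /kpos /= (hdiff_mid dD av vb bN).
- move=> d dD Cd; apply: eqm_eq; rewrite /mid_label rank_bmid // ltnn eqxx.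
  by rewrite bmid_labE // bmid_labS.
- move=> d dD Cd k r rd; apply: eqm_eq.
  have cd := fam_cut_in (bpiece_family av vb bN) Cd (k := k).
  have [h hr] := fre_neq0 dD rd; have [g gr gE] := rank_mem hr.
  have pg := fre_part gr.
  (* Among the gaps of the four pieces, those before [bmid] are exactly the ones of the piece
     [(false, false)], so that only its labels have been changed. *)
  rewrite (lab_piece (rs' := ~~ k.1) (rs := ~~ k.1 && ~~ k.2) x _ dD cd rd); last first.
    by rewrite /root_compat; case: k {cd r rd h hr g gr gE pg} => [[] []] /=; rewrite ?andbT ?orbT //; lia.
  rewrite /mid_label -gE /gpos lex_ltn ?ltn_ord //.
  have -> : (g.1 * N + g.2 == a * N + a) = false.
    apply/negbTE/negP => /eqP E; have := @lex_ltn N g.1 g.2 a a (ltn_ord _) (ltn_ord _).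
    have := @lex_ltn N a a g.1 g.2 (ltn_ord _) (ltn_ord _); rewrite E ltnn.
    move: pg; rewrite /part /in_part; have := ltn_ord v; case: k {cd r rd h hr gr gE} => [[] []] /=; lia.
  have -> : (g.1 < a) || (g.1 == a :> nat) && (g.2 < a) = ~~ k.1 && ~~ k.2.
    move: pg; rewrite /part /in_part; have := ltn_ord v; case: k {cd r rd h hr gr gE} => [[] []] /=; lia.
  by rewrite /lab; case: (~~ k.1 && ~~ k.2).
Qed.

Lemma difference_sum :
  eqm n (\sum_(d in dissections N) psgn true d *:
          (LamE (regions d) (tree_rel d) (labE x d) - LamE (regions d) (tree_rel d) (labS x d)))%R
   (\sum_(p : triple | ordered p) bsign N p.1.1 p.2 *:
      bigon_sum N x p.1.1 p.1.2 p.2 (gon2 p.1.1 p.2 - gon2 p.2 p.1.1))%R.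
Proof.
apply: (@eqm_trans R n (\sum_(p : triple | ordered p)
  \sum_(d in dissections N | bcuts N p.1.1 p.1.2 p.2 \subset d) psgn true d *: hdiff d (kpos p))%R); last first.
  by apply: eqm_sum => p /difference_triple.
have -> : (\sum_(p : triple | ordered p)
  \sum_(d in dissections N | bcuts N p.1.1 p.1.2 p.2 \subset d) psgn true d *: hdiff d (kpos p) =
  \sum_(d in dissections N) psgn true d *: \sum_(p | tri d p) hdiff d (kpos p))%R.
  rewrite (exchange_big_dep (fun d => d \in dissections N)) /=; last by move=> p d _ /andP[].
  apply: eq_bigr => d dD; rewrite scaler_sumr; apply: eq_bigl => p.
  by rewrite /tri dD.
apply: eqm_sum => d dD; apply: eqmZ.
have -> := @hybrid_telescope R _ (regions d) (tree_rel d) (labE x d) (labS x d) (@rank N) (N * N); last by move=> t; apply: rank_lt.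
apply: (@eqm_trans R n (\sum_(k < N * N) \sum_(p | tri d p && (kpos p == k)) hdiff d k)%R).
  by apply: eqm_sum => k _; apply: hdiff_sum dD k.
apply: eqm_eq; rewrite (exchange_big_dep (tri d)) /=; last by move=> k p _ /andP[].
apply: eq_bigr => p tp.
have kN : kpos p < N * N.
  by case: p tp => [[a v] b] _; rewrite /kpos /= -[X in X < _]/(gpos (a, a)) gpos_lt.
rewrite (big_pred1 (Ordinal kN)) // => k; rewrite tp /= -val_eqE /= eq_sym.
by [].
Qed.

End Difference.

(** * Splitting the first vertex *)

Section Split.
Variables (N b : nat).
Hypotheses (b0 : 0 < b) (bN : b.+1 < N).

Fact spiece_t_le : 0 + b.+1 <= N. Proof. by lia. Qed.
Fact spiece_f_gt0 : 0 < N - b. Proof. by lia. Qed.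
Fact spiece_f_lt : N - b < N. Proof. by lia. Qed.
Fact spiece_f_le : b + (N - b) <= N. Proof. by lia. Qed.
Fact split_N_gt0 : 0 < N. Proof. by lia. Qed.
Fact split_lt : b < N. Proof. by lia. Qed.

(** The two polygons into which the arrow from the first vertex to the side [b]
    divides the polygon. *)
Definition spiece (k : bool) : piece N := if k
  then @Piece N b.+1 0 true (ltn0Sn b) bN spiece_t_le
  else @Piece N (N - b) b false spiece_f_gt0 spiece_f_lt spiece_f_le.

Definition scut : arrow N := (Ordinal split_N_gt0, Ordinal split_lt).

Lemma spiece_cut k : pcut_i N (psize (spiece k)) (pstart (spiece k)) (pfst (spiece k)) = 0 /\
  pcut_j (psize (spiece k)) (pstart (spiece k)) (pfst (spiece k)) = b.
Proof.
rewrite /pcut_i /pcut_j /pvtx; case: k => /=; split=> //; try lia.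
by rewrite ifT; lia.
Qed.

Lemma is_scut k c : is_cut (spiece k) c <-> c = scut.
Proof.
rewrite /is_cut; have [-> ->] := spiece_cut k; split=> [[c1 c2]|->] //.
by case: c c1 c2 => i j /= c1 c2; congr (_, _); apply: val_inj.
Qed.

Definition in_spiece (k : bool) i j : bool := if k
  then [&& i <= b, j <= b & ~~ ((i == 0) && (j == b))]
  else [&& (i == 0) || (b < i < N), b <= j, j < N & ~~ ((i == 0) && (j == b))].

Lemma in_spieceE k i j :
  in_piece N (psize (spiece k)) (pstart (spiece k)) (pfst (spiece k)) i j = in_spiece k i j.
Proof.
have [E1 E2] := spiece_cut k; rewrite /in_piece E1 E2 {E1 E2}.
by case: k => /=; lia.
Qed.

Lemma farr_spiece k (c : arrow (psize (spiece k))) : nontrivial c ->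
  let a' := farr (spiece k) c in nontriv N a'.1 a'.2 /\ in_spiece k a'.1 a'.2.
Proof.
move=> nc; split; first by rewrite -nontrivialE nontrivial_farr.
rewrite -in_spieceE; apply: (in_piece_pvtx _ (psize_gt0 _) (psize_lt _) (pend_le _)) => //.
by rewrite -nontrivialE.
Qed.

Lemma scut_nt : nontrivial scut.
Proof. by rewrite nontrivialE /nontriv /=; case: (eqVneq b.+1 N); lia. Qed.

Lemma spiece_gt1 k : 1 < psize (spiece k).
Proof. by case: k => /=; lia. Qed.

Lemma spiece_cover i j : i < N -> j < N -> nontriv N i j -> ~~ interleave i j 0 b ->
  (i = 0 /\ j = b) \/ exists k, in_spiece k i j.
Proof.
move=> iN jN; rewrite interleave_if /nontriv => nij nx.
case: (boolP (in_spiece true i j)) => h1; first by right; exists true.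
case: (boolP (in_spiece false i j)) => h2; first by right; exists false.
left; move: h1 h2 nx nij; rewrite /in_spiece; case: (eqVneq j.+1 N); lia.
Qed.

Lemma spiece_family : piece_family spiece [set scut].
Proof.
split.
- by move=> c; rewrite inE => /eqP ->; apply: scut_nt.
- by move=> c c'; rewrite !inE => /eqP -> /eqP ->; rewrite /interleave eqxx.
- move=> k c c' nc; rewrite inE => /eqP ->; have /= [] := farr_spiece nc.
  set i := pvtx _ _ _ _ _; set j := _ + _; rewrite interleave_if /nontriv; move: i j => i j.
  by case: k c nc => c nc /=; case: (eqVneq j.+1 N); lia.
- move=> k l c c' kl nc nc'; have [] := farr_spiece nc; have [] := farr_spiece nc'.
  set f := farr _ c; set f' := farr _ c'; rewrite interleave_if /nontriv => n' p' n p.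
  suff H : forall i j i' j', in_spiece k i j -> in_spiece l i' j' -> j < N -> j' < N ->
     (j != i) && ((if j.+1 == N then 0 else j.+1) != i) ->
     (j' != i') && ((if j'.+1 == N then 0 else j'.+1) != i') ->
     ~~ [&& i != i', j != j' & ((i <= j) && ((i < i' <= j) != (i <= j' < j))) ||
        ((j < i) && ((j < i' < i) != (j < j' < i)))] /\ ((i != i') || (j != j')).
    have [h1 h2] := H _ _ _ _ p p' (ltn_ord _) (ltn_ord _) n n'.
    by split=> //; apply: contraTneq h2 => ->; rewrite !eqxx.
  move: kl {f f' n p n' p'} => kl i j i' j' h h' jN jN'.
  case: (eqVneq j.+1 N); case: (eqVneq j'.+1 N); move: kl h h';
    by case: k c nc => c nc; case: l c' nc' => c' nc' //=; lia.
- move=> k c nc; apply/negP; rewrite inE => /eqP E; have [_] := farr_spiece nc.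
  by rewrite E; case: k c nc E => c nc _ /=; lia.
- move=> c nc H; have nc' : nontriv N c.1 c.2 by rewrite -nontrivialE.
  have nx : ~~ interleave c.1 c.2 0 b by apply: (H scut); rewrite inE.
  have [[c1 c2]|[k pk]] := spiece_cover (ltn_ord _) (ltn_ord _) nc' nx.
    by left; rewrite inE; apply/eqP/(is_scut true); have [E1 E2] := spiece_cut true; rewrite /is_cut E1 E2.
  right; exists k; move: pk; rewrite -in_spieceE.
  case/(in_pieceP (psize_gt0 _) (psize_lt _) (pend_le _)) => // [i [j [iM jM nij ai aj]]].
  exists (Ordinal iM, Ordinal jM); first by rewrite nontrivialE.
  by case: (c) ai aj => a1 a2 /= ai aj; congr (_, _); apply: val_inj.
- by move=> k _; exists scut; rewrite ?inE ?is_scut.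
- by move=> c; rewrite inE => /eqP ->; exists true; rewrite ?is_scut ?spiece_gt1.
- move=> k l h; rewrite /part /in_part.
  by case: k; case: l => //=; have := ltn_ord h.2; lia.
Qed.

Lemma spiece_part h : exists k, part (spiece k) h.
Proof.
have := ltn_ord h.1; have := ltn_ord h.2 => h2 h1.
case: (boolP (part (spiece true) h)) => p1; first by exists true.
by exists false; move: p1; rewrite /part /in_part /=; lia.
Qed.

End Split.

Section SplitForest.
Variables (R : choiceType) (n N : nat) (x : nat -> R) (out : bool).

(** The first vertex of the polygon is split at the side [b]: the arrows from
    this vertex which end before [b] (or after [b], depending on [out]) are
    reversed, and the arrow ending at [b], if any, is removed. *)
Definition split_forest (d : {set arrow N}) (b : nat) : ftree R := {|
  ft := {set gap N};
  fV := regions d;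
  fe := fun r r' => [exists a in d, ~~ ((a.1 == 0 :> nat) && (a.2 == b :> nat)) &&
     if (a.1 == 0 :> nat) && (if out then b < a.2 else a.2 < b)
     then (r == right_region d a) && (r' == left_region d a)
     else (r == left_region d a) && (r' == right_region d a)];
  fl := fun r => lab (~~ out) x d r;
  fc := fun r => ((0 < b) && (r == region_at d (b * N + b).-1)) ||
                 ((b < N.-1) && (r == region_at d (b * N + b))) |}.

Definition splitf M3 M4 b (d3 : {set arrow M3}) (d4 : {set arrow M4}) : ftree R :=
  fsum (pft x (~~ out) (~~ out) true d3) (pft (fun j => x (b + j)) (~~ out) out false d4).

Section Inner.
Variables (b : nat) (d : {set arrow N}).
Hypotheses (b0 : 0 < b) (bN : b.+1 < N).
Notation pc := (spiece b0 bN).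
Hypotheses (dD : d \in dissections N) (cd : scut b0 bN \in d).
Let fam := spiece_family b0 bN.
Let Cd : [set scut b0 bN] \subset d. Proof. by rewrite sub1set. Qed.

Let sflip (k : bool) := k != out.

Lemma sflipE k (c : arrow (psize (pc k))) : nontrivial c ->
  let a := farr (pc k) c in
  ~~ ((a.1 == 0 :> nat) && (a.2 == b :> nat)) /\
  (a.1 == 0 :> nat) && (if out then b < a.2 else a.2 < b) = sflip k && (c.1 == 0 :> nat).
Proof.
rewrite nontrivialE /nontriv /= /pvtx /sflip.
have bNE : (b + (N - b) == N) by lia.
case: k c => [] [[i iM] [j jM]] /=; rewrite ?bNE; move: iM jM => /= iM jM;
  case: (eqVneq i 0) => i0; case: out => /=;
  [case: (eqVneq j.+1 b.+1)|case: (eqVneq j.+1 b.+1)|case: (eqVneq j.+1 b.+1)|case: (eqVneq j.+1 b.+1)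
  |case: (eqVneq j.+1 (N - b))|case: (eqVneq j.+1 (N - b))|case: (eqVneq j.+1 (N - b))|case: (eqVneq j.+1 (N - b))];
  move: iM jM i0 b0 bN; clear; lia.
Qed.

Definition snode (w : {set gap b.+1} + {set gap (N - b)}) : pnode pc :=
  match w with
  | inl r => existT (fun k => {set gap (psize (pc k))}) true r
  | inr r => existT (fun k => {set gap (psize (pc k))}) false r
  end.

Let d3 := restr (pc true) d.
Let d4 := restr (pc false) d.

Lemma snode_nodes w : (snode w \in pnodes pc d) = (w \in fV (splitf b d3 d4)).
Proof. by case: w => r; rewrite !inE. Qed.

Lemma snode_inj : injective snode.
Proof.
move=> w w'; case: w => r; case: w' => r' //= /eqP; rewrite ?eq_Tagged /=; first by move/eqP => ->.
by move/eqP => ->.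
Qed.

Lemma snode_surj w : exists w', w = snode w'.
Proof. by case: w => [[] r]; [exists (inl r)|exists (inr r)]. Qed.

Lemma split_arrow a : a \in d -> a = scut b0 bN \/
  (exists k, exists2 c, c \in restr (pc k) d & a = farr (pc k) c).
Proof.
move=> ad; have : a \in glue [set scut b0 bN] (fun k => restr (pc k) d) by rewrite glue_restr.
by case/mem_glue => [|[k [c cd' ->]]]; [rewrite inE => /eqP; left|right; exists k, c].
Qed.

Lemma split_edges w w' : snode w \in pnodes pc d -> snode w' \in pnodes pc d ->
  fe (f := splitf b d3 d4) w w' = fe (f := split_forest d b) (pregion (snode w)) (pregion (snode w')).
Proof.
move=> wV wV'.
have E : fe (f := splitf b d3 d4) w w' = [exists k, [exists c in restr (pc k) d,
     if sflip k && (c.1 == 0 :> nat)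
     then (snode w == existT _ k (right_region (restr (pc k) d) c)) &&
          (snode w' == existT _ k (left_region (restr (pc k) d) c))
     else (snode w == existT _ k (left_region (restr (pc k) d) c)) &&
          (snode w' == existT _ k (right_region (restr (pc k) d) c))]].
  have sE : (sflip true = ~~ out) * (sflip false = out) by rewrite /sflip; case: out.
  case: w {wV} => r; case: w' {wV'} => r'; last 1 first.
  - apply/exists_inP/existsP => [[c cD H]|[[] /exists_inP[c cD]]].
    + by exists false; apply/exists_inP; exists c => //; rewrite sE !eq_Tagged.
    + by case: ifP => _ /andP[/eqP/(congr1 (@tag _ _))].
    + by rewrite sE /= !eq_Tagged => H; exists c.
  - apply/exists_inP/existsP => [[c cD H]|[[] /exists_inP[c cD]]].
    + by exists true; apply/exists_inP; exists c => //; rewrite sE !eq_Tagged.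
    + by rewrite sE /= !eq_Tagged => H; exists c.
    + by case: ifP => _ /andP[/eqP/(congr1 (@tag _ _))].
  - apply/esym/existsP => -[k /exists_inP[c _ H]].
    by case: ifP H => _ /andP[/eqP/(congr1 (@tag _ _)) h1 /eqP/(congr1 (@tag _ _)) h2]; move: h2; rewrite -[RHS]h1.
  - apply/esym/existsP => -[k /exists_inP[c _ H]].
    by case: ifP H => _ /andP[/eqP/(congr1 (@tag _ _)) h1 /eqP/(congr1 (@tag _ _)) h2]; move: h2; rewrite -[RHS]h1.
rewrite E; apply/existsP/exists_inP => [[k /exists_inP[c cD H]]|[a ad /andP[na H]]].
  have nc : nontrivial c by move: cD; rewrite inE => /andP[].
  exists (farr (pc k) c); first by move: cD; rewrite inE => /andP[].
  have [-> ->] := sflipE nc.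
  by rewrite !(pregion_left fam dD Cd _ cD) ?(pregion_right fam dD Cd _ cD).
have [ac|[k [c cD ac]]] := split_arrow ad.
  by move: na; rewrite ac /= !eqxx.
have nc : nontrivial c by move: cD; rewrite inE => /andP[].
exists k; apply/exists_inP; exists c => //; move: H; rewrite ac.
have [_ ->] := sflipE nc.
by rewrite !(pregion_left fam dD Cd _ cD) ?(pregion_right fam dD Cd _ cD).
Qed.

Lemma split_iso : fiso n (splitf b d3 d4) (split_forest d b).
Proof.
have nc : nontrivial (scut b0 bN) := scut_nt b0 bN.
have aE : aend (scut b0 bN) = b * N + b by rewrite /aend /= subn0 modnDr modn_small //; lia.
exists (fun w => pregion (snode w)); split.
- move=> w w'; rewrite -!snode_nodes => wV wV' E.
  exact/snode_inj/(pregion_inj fam dD wV wV' E).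
- apply/setP => r; apply/imsetP/idP => [[w]|/regionsP[_ [g ->]]].
    by rewrite -snode_nodes => wV ->; apply: (pregion_regions fam dD Cd wV).
  have [k pk] := spiece_part b0 bN g; have [w wV ->] := pregion_cover fam dD Cd pk.
  by have [w' E] := snode_surj w; exists w'; rewrite -?snode_nodes -?E.
- by move=> w w'; rewrite -!snode_nodes; apply: split_edges.
- case=> r rV; apply: eqm_eq.
    have cd' := fam_cut_in fam Cd (k := true).
    apply: (lab_piece (rs' := ~~ out) (rs := ~~ out) x _ dD cd'); first by rewrite /root_compat /=; case: out.
    by move: rV; rewrite inE.
  have cd' := fam_cut_in fam Cd (k := false).
  apply: (lab_piece (rs' := ~~ out) (rs := ~~ out) x _ dD cd'); first by rewrite /root_compat /= b0; case: out => /=; lia.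
  by move: rV; rewrite inE.
- move=> w; rewrite -snode_nodes => wV.
  have H k := pregion_cut fam dD wV cd (proj2 (is_scut b0 bN k _) erefl) (spiece_gt1 b0 bN k).
  have := H true; have := H false; rewrite /= /left_region /right_region aE b0 (_ : b < N.-1); last by lia.
  move=> -> ->; rewrite /=.
  by case: (w) => r; rewrite /= ?eq_Tagged /= ?orbF.
Qed.
End Inner.
End SplitForest.

Lemma iota_recr m n : iota m n.+1 = iota m n ++ [:: m + n].
Proof. by rewrite -[n.+1]addn1 iotaD. Qed.

Lemma count_iota_gt m j : count (fun p => j < p.+1) (iota 0 m) = m - j.
Proof. by elim: m => // m IH; rewrite iota_recr count_cat IH /=; lia. Qed.

Lemma count_iota_lt m j : j <= m.+1 -> count (fun p => p.+1 < j) (iota 0 m) = j.-1.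
Proof.
move=> jm; have {jm} -> : j.-1 = minn j.-1 m by lia.
by elim: m => [|m IH]; rewrite ?iota_recr ?count_cat ?IH /=; lia.
Qed.

Lemma card_ord_count m (Q : pred nat) : #|[set p : 'I_m | Q p]| = count Q (iota 0 m).
Proof. by rewrite cardsE cardE size_filter -enumT -val_enum_ord count_map. Qed.

(** The gaps are those just after an end on [b], and just before an end on [b'], of arrows from the
    first vertex. *)
Lemma separate_breaks N i j b b' : i < N -> j < N -> b < b' -> b' < N -> nontriv N i j ->
  (0 < b -> ~~ interleave i j 0 b) -> (b' < N.-1 -> ~~ interleave i j 0 b') ->
  (i = 0 -> ~~ (b < j < b')) -> lft N i j b' b'.-1 = lft N i j b b.
Proof.
rewrite /nontriv !interleave_if /lft => iN jN bb b'N nij x1 x2 i0.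
by move: x1 x2 i0 nij; case: (eqVneq j.+1 N); case: (leqP i j) => h; case: (posnP b); case: (ltnP b' N.-1); lia.
Qed.

(** * The chain of regions at the first vertex *)

Section Breaks.
Variables (N : nat) (d : {set arrow N}).
Hypotheses (N1 : 1 < N) (dD : d \in dissections N).

(** The first and the last side are included: they correspond to the splittings in which one of the
    two polygons is trivial. The other breaks are the ends of the arrows from the first vertex, and
    [brk_num] is their number. *)
Definition is_break b := [|| b == 0, b == N.-1 | [exists a in d, (a.1 == 0 :> nat) && (a.2 == b :> nat)]].
Definition breaks := [seq b <- iota 0 N | is_break b].
Definition brk_nth p := nth 0 breaks p.
Definition brk_num := (size breaks).-2.

Lemma mem_breaks b : (b \in breaks) = (b < N) && is_break b.
Proof. by rewrite mem_filter mem_iota add0n andbC. Qed.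

Lemma breaks_sorted : sorted ltn breaks.
Proof. by apply: sorted_filter; [apply: ltn_trans|apply: iota_ltn_sorted]. Qed.

Lemma breaks_size : size breaks = brk_num.+2.
Proof.
suff : 1 < size breaks by rewrite /brk_num; case: (size _) => [|[|]].
have h : uniq [:: 0; N.-1] by rewrite /= inE; lia.
apply: (leq_trans _ (uniq_leq_size h _)) => // b.
by rewrite !inE mem_breaks /is_break => /orP[/eqP ->|/eqP ->]; rewrite eqxx ?orbT andbT; lia.
Qed.

Lemma brk_nth_lt p q : p < q -> q < brk_num.+2 -> brk_nth p < brk_nth q.
Proof.
move=> pq qm; rewrite -breaks_size in qm.
by apply: (sorted_ltn_nth ltn_trans 0 breaks_sorted) => //; rewrite inE //; apply: ltn_trans qm.
Qed.

Lemma brk_nth_ltE p q : p < brk_num.+2 -> q < brk_num.+2 -> (brk_nth p < brk_nth q) = (p < q).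
Proof.
move=> pm qm; case: (ltngtP p q) => h; first exact: brk_nth_lt.
  by apply/negbTE; rewrite -leqNgt ltnW // brk_nth_lt.
by rewrite h ltnn.
Qed.

Lemma brk_nthP p : p < brk_num.+2 -> brk_nth p < N /\ is_break (brk_nth p).
Proof. by rewrite -breaks_size => /(mem_nth 0); rewrite mem_breaks => /andP[]. Qed.

Lemma brk_index b : b < N -> is_break b -> exists2 p, p < brk_num.+2 & b = brk_nth p.
Proof.
move=> bN bb; have bs : b \in breaks by rewrite mem_breaks bN.
by exists (index b breaks); rewrite /brk_nth ?nth_index // -breaks_size index_mem.
Qed.

Lemma brk_nth0 : brk_nth 0 = 0.
Proof.
have [|p pm] := @brk_index 0 _ (erefl true); first lia.
by case: p pm => // p pm E; have := @brk_nth_lt 0 p.+1 isT pm; lia.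
Qed.

Lemma brk_nth_last : brk_nth brk_num.+1 = N.-1.
Proof.
have [||p pm E] := @brk_index N.-1; [lia|by rewrite /is_break eqxx orbT|].
have [pl|pl] := eqVneq p brk_num.+1; first by rewrite -pl.
have [h _] := @brk_nthP brk_num.+1 (leqnn _).
by have := @brk_nth_lt p brk_num.+1; lia.
Qed.

Lemma brk_arrow p : p < brk_num -> exists a, [/\ a \in d, a.1 = 0 :> nat & a.2 = brk_nth p.+1 :> nat].
Proof.
move=> pm; have [h] := @brk_nthP p.+1 (ltnW pm).
have := @brk_nth_lt 0 p.+1; have := @brk_nth_lt p.+1 brk_num.+1; rewrite brk_nth_last brk_nth0.
move=> h1 h2 /or3P[/eqP|/eqP|/exists_inP[a ad /andP[/eqP a1 /eqP a2]]]; try lia.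
by exists a.
Qed.

Lemma arrow_brk a : a \in d -> a.1 = 0 :> nat -> exists2 p, p < brk_num & a.2 = brk_nth p.+1 :> nat.
Proof.
move=> ad a1; have [dn _] := dissP _ dD; have := dn a ad; rewrite nontrivialE /nontriv a1 => na.
have ab : is_break a.2 by apply/or3P/Or33/exists_inP; exists a; rewrite // a1 !eqxx.
have [[|p] pm E] := brk_index (ltn_ord a.2) ab; first by move: na; rewrite E brk_nth0.
exists p => //; rewrite ltnS leq_eqVlt ltnS in pm; case/orP: pm => [/eqP pm|//].
by move: na; rewrite E pm brk_nth_last; case: (eqVneq N.-1.+1 N); lia.
Qed.

Definition brk_gap p : gap N := (insubd (Ordinal N1) (brk_nth p), insubd (Ordinal N1) (brk_nth p)).
Definition brk_region p := region_at d (brk_nth p * N + brk_nth p).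

Lemma brk_regionE p : p < brk_num.+2 -> brk_region p = region_at d (gpos (brk_gap p)).
Proof. by move=> /brk_nthP[h _]; rewrite /gpos /= !val_insubd h. Qed.

Lemma brk_region_regions p : p < brk_num.+2 -> brk_region p \in regions d.
Proof. by move=> pm; apply/regionsP; split=> //; exists (brk_gap p); rewrite brk_regionE. Qed.

Lemma brk_noncross a p : a \in d -> p < brk_num.+2 -> 0 < brk_nth p < N.-1 ->
  ~~ interleave a.1 a.2 0 (brk_nth p).
Proof.
move=> ad pm; have [_ dx] := dissP _ dD; have [h] := brk_nthP pm.
move=> /or3P[/eqP|/eqP|/exists_inP[c cd /andP[/eqP c1 /eqP c2]] _]; try lia.
by rewrite -c1 -c2; apply: dx.
Qed.

(** Consecutive breaks border a common region, so that the arrows from the first vertex join the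
    regions [brk_region 0, ..., brk_region brk_num] into a chain. *)
Lemma brk_region_next p : p <= brk_num ->
  region_at d (brk_nth p.+1 * N + brk_nth p.+1).-1 = brk_region p.
Proof.
move=> pm; have pm' : p < brk_num.+2 by lia.
have lt := @brk_nth_lt p p.+1 (ltnSn p) pm; have [h _] := brk_nthP (pm : p.+1 < brk_num.+2).
have hp : (brk_nth p.+1).-1 < N by lia.
pose g : gap N := (insubd (Ordinal N1) (brk_nth p.+1), insubd (Ordinal N1) (brk_nth p.+1).-1).
have -> : (brk_nth p.+1 * N + brk_nth p.+1).-1 = gpos g.
  by rewrite /gpos /= !val_insubd h hp; lia.
rewrite brk_regionE //; apply/region_eqP/regionP => a ad.
have [dn _] := dissP _ dD; have na := dn a ad.
rewrite /agree !on_leftE ?nontrivial_neq // /= !val_insubd h hp (brk_nthP pm').1; apply/eqP.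
rewrite nontrivialE in na.
apply: separate_breaks; rewrite ?ltn_ord //.
- by move=> b0; apply: brk_noncross => //; rewrite b0; lia.
- by move=> b0; apply: brk_noncross => //; rewrite b0 andbT; lia.
- move=> a1; apply/negP => /andP[h1 h2]; have [q qm qE] := arrow_brk ad a1.
  move: h1 h2; rewrite qE !brk_nth_ltE //; lia.
Qed.

Lemma brk_left p a : a \in d -> a.1 = 0 :> nat -> a.2 = brk_nth p :> nat ->
  left_region d a = brk_region p /\ right_region d a = region_at d (brk_nth p * N + brk_nth p).-1.
Proof.
move=> ad a1 a2; have aE : aend a = brk_nth p * N + brk_nth p.
  by rewrite /aend a1 a2 subn0 modnDr modn_small // -a2.
by rewrite /left_region /right_region aE.
Qed.

Lemma brk_region_inj p q : p <= brk_num -> q <= brk_num -> brk_region p = brk_region q -> p = q.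
Proof.
wlog lt : p q / p < q => [H pm qm E|].
  case: (ltngtP p q) => // h; first exact: H.
  by apply/esym; apply: H.
move=> pm qm; case: q lt qm => // q lt qm E.
have [a [ad a1 a2]] := brk_arrow qm; have [dn _] := dissP _ dD; have na := dn a ad.
have pm' : p < brk_num.+2 by lia.
have qm' : q.+1 < brk_num.+2 by lia.
have : brk_gap p \in brk_region q.+1 by rewrite -E brk_regionE // region_refl.
rewrite brk_regionE // => /regionP /(_ a ad).
rewrite /agree !on_leftE ?nontrivial_neq // /= !val_insubd a1 a2 (brk_nthP pm').1 (brk_nthP qm').1.
have := brk_nth_lt lt qm'; rewrite /lft leq0n; lia.
Qed.

End Breaks.

(** * Cancellation over the breaks of one dissection *)

Section SplitAntipode.
Variables (R : choiceType) (n N : nat) (x : nat -> R) (out : bool).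
Variables (u : words R) (X : ftree R).
Hypothesis N1 : 1 < N.

Section OneDissection.
Variable d : {set arrow N}.
Hypothesis dD : d \in dissections N.
Notation m := (brk_num d).
Notation sf := (split_forest x out d).

Definition anode := option ({set gap N} + ft X)%type.
Definition anodes : {set anode} :=
  [set w | match w with None => true | Some (inl r) => r \in regions d | Some (inr r) => r \in fV X end].
Definition alabel (w : anode) : words R :=
  match w with None => u | Some (inl r) => lab (~~ out) x d r | Some (inr r) => fl r end.
(** The edges that do not depend on the break. *)
Definition abase : rel anode := fun w w' =>
  match w, w' with
  | Some (inl r), Some (inl r') =>
      [exists a in d, [&& a.1 != 0 :> nat, r == left_region d a & r' == right_region d a]]
  | Some (inr r), Some (inr r') => fe r r'
  | None, Some (inr r) => ~~ out && fc r
  | Some (inr r), None => out && fc r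
  | _, _ => false
  end.
Definition aspecial p : anode := Some (inl (brk_region d p)).

(** The arrow ending at break [p.+1] goes from [brk_region p.+1] to [brk_region p]; removing one
    such arrow and reversing those on one side of it yields the chain of [cut_edges]. *)
Lemma sft_edges j (r r' : {set gap N}) : j < m.+2 ->
  fe (f := sf (brk_nth d j)) r r' =
  abase (Some (inl r)) (Some (inl r')) ||
  (if out then cut_edges m aspecial None j (Some (inl r)) (Some (inl r'))
   else cut_edges m aspecial None j (Some (inl r')) (Some (inl r))).
Proof.
move=> jm; have SE r1 r2 : (Some (inl r1) == Some (inl r2) :> anode) = (r1 == r2) by [].
have cE r1 r2 : cut_edges m aspecial None j (Some (inl r1)) (Some (inl r2)) =
    [exists p : 'I_m, ((p.+1 < j) && (r1 == brk_region d p.+1) && (r2 == brk_region d p)) ||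
                      ((j < p.+1) && (r1 == brk_region d p) && (r2 == brk_region d p.+1))].
  have SN (s : {set gap N}) : (Some (inl s) == None :> anode) = false by [].
  by rewrite /cut_edges !SN !andbF /= orbF; apply: eq_existsb => p; rewrite /aspecial !SE.
rewrite !cE; apply/exists_inP/orP => [[a ad /andP[na H]]|[/exists_inP[a ad /and3P[a1 h1 h2]]|H]].
- case: (eqVneq (val a.1) 0) H na => /= a1 H na; last first.
    by left; apply/exists_inP; exists a; rewrite // a1.
  right; have [p pm a2] := arrow_brk N1 dD ad a1.
  have [lE rE] := brk_left ad a1 a2; rewrite lE rE (brk_region_next N1 dD (ltnW pm)) a2 in H.
  rewrite a2 in na; have pm' : p.+1 < m.+2 by lia.
  have ne : p.+1 != j by apply: contraNneq na => ->.
  have := brk_nth_ltE N1 dD jm pm'; have := brk_nth_ltE N1 dD pm' jm => E1 E2.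
  move: H; rewrite E1 E2; case: (out) => /=; case: ifP => lt /andP[h1 h2]; apply/existsP; exists (Ordinal pm) => /=;
    rewrite ?h1 ?h2 ?lt ?andbT ?orbT //; apply/orP; [left|right]; lia.
- by exists a => //; rewrite (negbTE a1) /= h1.
- suff [p [pm ne H']] : exists p, [/\ p < m, p.+1 != j & if (if out then j < p.+1 else p.+1 < j)
     then (r == brk_region d p) && (r' == brk_region d p.+1)
     else (r == brk_region d p.+1) && (r' == brk_region d p)].
    have [a [ad a1 a2]] := brk_arrow N1 dD pm.
    have [lE rE] := brk_left ad a1 a2; have pm' : p.+1 < m.+2 by lia.
    exists a => //; rewrite lE rE (brk_region_next N1 dD (ltnW pm)) a1 a2 eqxx /=.
    rewrite (brk_nth_ltE N1 dD jm pm') (brk_nth_ltE N1 dD pm' jm) H' andbT.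
    apply: contraNneq ne => E; have := brk_nth_ltE N1 dD jm pm'; have := brk_nth_ltE N1 dD pm' jm.
    by rewrite E ltnn; lia.
  move: H; case: (out) => /existsP[p /orP[/andP[/andP[lt h1] h2]|/andP[/andP[lt h1] h2]]]; exists p;
    rewrite ltn_ord ?h1 ?h2; split=> //; try lia; first [by rewrite lt|by rewrite ifF //; lia].
Qed.

Lemma sft_chosen j (r : {set gap N}) : j < m.+2 ->
  fc (f := sf (brk_nth d j)) r =
  ((0 < j) && (r == brk_region d j.-1)) || ((j <= m) && (r == brk_region d j)).
Proof.
move=> jm /=; congr (_ || _); last first.
  congr (_ && _); rewrite -(brk_nth_last N1 dD) (brk_nth_ltE N1 dD) //.
case: j jm => [|j] jm; first by rewrite (brk_nth0 N1 dD).
by rewrite -[X in X < _](brk_nth0 N1 dD) (brk_nth_ltE N1 dD) //= (brk_region_next N1 dD).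
Qed.

Lemma cut_None_l j (r : {set gap N}) : j < m.+2 ->
  cut_edges m aspecial None j None (Some (inl r)) = fc (f := sf (brk_nth d j)) r.
Proof.
move=> jm; rewrite sft_chosen // /cut_edges !eqxx !andbT.
by case: existsP => // -[p /orP[] /andP[/andP[_ /eqP]]].
Qed.

Lemma cut_None_r j w : cut_edges m aspecial None j w None = false.
Proof. by apply/negP => /or3P[/existsP[p /orP[] /andP[_ /eqP]]|/andP[_ /eqP]|/andP[_ /eqP]]. Qed.

Lemma cut_inr_l j s w : cut_edges m aspecial None j (Some (inr s)) w = false.
Proof. by apply/negP => /or3P[/existsP[p /orP[] /andP[/andP[_ /eqP]]]|/andP[/andP[_ /eqP]]|/andP[/andP[_ /eqP]]]. Qed.

Lemma cut_inr_r j s w : cut_edges m aspecial None j w (Some (inr s)) = false.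
Proof. by apply/negP => /or3P[/existsP[p /orP[] /andP[_ /eqP]]|/andP[_ /eqP]|/andP[_ /eqP]]. Qed.

Lemma sft_antipode :
  eqm n (\sum_(j < m.+2) (-1) ^+ j *: gstar out u (sf (brk_nth d j)) X)%R 0%R.
Proof.
have AS := @antipode_sum R anode anodes alabel m aspecial None abase out.
apply: eqm_trans (eqm_eq _ (AS _ _ _)).
- apply: eqm_sum => -[j jm] _; apply: eqmZ; apply: LamE_eq => [w w' _ _|w _]; last first.
    by case: w => [[r|r]|]; apply: eqm_refl.
  rewrite /cut_rel; case: w => [[r|r]|]; case: w' => [[r'|r']|] //.
  + by rewrite -sft_edges.
  + by rewrite !(cut_inr_l, cut_inr_r) /abase /=; case: (out).
  + rewrite cut_None_r cut_None_l // -[LHS]/(~~ out && fc (f := sf (brk_nth d j)) r).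
    by rewrite /abase /=; case: (out).
  + by rewrite !(cut_inr_l, cut_inr_r) /abase /=; case: (out).
  + by rewrite !(cut_inr_l, cut_inr_r) /abase /=; case: (out); rewrite ?orbF.
  + by rewrite !(cut_inr_l, cut_inr_r) /abase /=; case: (out); rewrite ?orbF.
  + by rewrite cut_None_r cut_None_l.
  + by rewrite !(cut_inr_l, cut_inr_r) /abase /=; case: (out); rewrite ?orbF.
  + by rewrite !cut_None_r /=; case: (out).
- by rewrite inE.
- by move=> p pm; rewrite in_set; apply: brk_region_regions => //; lia.
- by move=> p q pm qm [E]; apply: brk_region_inj E.
Qed.

End OneDissection.
End SplitAntipode.

Section SplitSum.
Variables (R : choiceType) (n N : nat) (x : nat -> R) (out : bool).
Hypothesis N1 : 1 < N.

Definition reversed_count (d : {set arrow N}) b :=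
  #|[set a in d | (a.1 == 0 :> nat) && (if out then b < a.2 else a.2 < b)]|.

Lemma cnt_brk (d : {set arrow N}) j : d \in dissections N -> j < (brk_num d).+2 ->
  reversed_count d (brk_nth d j) = if out then brk_num d - j else j.-1.
Proof.
move=> dD jm; set m := brk_num d in jm *.
have N0 : 0 < N by move: N1; clear; lia.
have ltm (p : 'I_m) : p.+1 < m.+2 by have := ltn_ord p; lia.
pose phi (p : 'I_m) : arrow N := (Ordinal N0, insubd (Ordinal N0) (brk_nth d p.+1)).
have phi2 (p : 'I_m) : (phi p).2 = brk_nth d p.+1 :> nat.
  by rewrite val_insubd (brk_nthP N1 dD (ltm p)).1.
have phi_inj : injective phi.
  move=> p q E; apply: val_inj; have := phi2 p; rewrite E phi2 => E2.
  have := brk_nth_ltE N1 dD (ltm p) (ltm q); have := brk_nth_ltE N1 dD (ltm q) (ltm p).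
  by rewrite E2 ltnn /=; lia.
have -> : reversed_count d (brk_nth d j) = #|phi @: [set p : 'I_m | if out then j < p.+1 else p.+1 < j]|.
  apply: eq_card => a; rewrite inE; apply/and3P/imsetP => [[ad /eqP a1 H]|[p pP ->]].
    have [p pm a2] := arrow_brk N1 dD ad a1; exists (Ordinal pm).
      rewrite inE; move: H; rewrite a2.
      by rewrite !(brk_nth_ltE N1 dD) //; lia.
    have := phi2 (Ordinal pm); rewrite -a2.
    by case: (a) a1 => i k /= a1 E; congr (_, _); apply: val_inj; rewrite ?a1.
  have [c [cd c1 c2]] := brk_arrow N1 dD (ltn_ord p); split.
  - suff -> : phi p = c by [].
    have := phi2 p; rewrite -c2.
    by case: (c) c1 => i k /= a1 E; congr (_, _); apply: val_inj; rewrite ?a1.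
  - by [].
  - by move: pP; rewrite inE phi2 !(brk_nth_ltE N1 dD).
rewrite card_imset //; case: (out).
  by rewrite (card_ord_count m (fun p => j < p.+1)) count_iota_gt.
by rewrite (card_ord_count m (fun p => p.+1 < j)) count_iota_lt.
Qed.

(** The factor of [bsign] that depends on the side to be summed over. *)
Definition split_sign b : rat := if b == (if out then N.-1 else 0) then 1%R else (-1)%R.

(** The factor -1 acts as one more reversed arrow, which makes the exponent equal to [j], or to
    [(brk_num d).+1 - j] if [out] holds. *)
Lemma ssgn_cnt (d : {set arrow N}) j : d \in dissections N -> j < (brk_num d).+2 ->
  (split_sign (brk_nth d j) * (-1) ^+ reversed_count d (brk_nth d j) =
   (if out then (-1) ^+ (brk_num d).+1 else 1) * (-1) ^+ j)%R.
Proof.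
move=> dD jm; rewrite cnt_brk // /split_sign; move: jm (brk_nth_last N1 dD) (brk_nth0 N1 dD).
have lt p q : p < (brk_num d).+2 -> q < (brk_num d).+2 -> _ := @brk_nth_ltE N d N1 dD p q.
case: (out) => jm hl h0.
  rewrite -hl; have [E|ne] := eqVneq (brk_nth d j) (brk_nth d (brk_num d).+1).
    have -> : j = (brk_num d).+1.
      by have := lt _ _ jm (ltnSn _); rewrite E ltnn; lia.
    by rewrite (_ : brk_num d - _ = 0) ?mul1r; [rewrite expr0 -exprD addnn -signr_odd odd_double|lia].
  have jm' : j <= brk_num d by rewrite -ltnS ltn_neqAle -ltnS jm andbT; apply: contraNneq ne => ->.
  rewrite mulN1r -mulN1r -exprS -exprD -[LHS]signr_odd -[RHS]signr_odd.
  by congr (_ ^+ nat_of_bool _)%R; rewrite oddD /= oddB //; case: (odd j); case: (odd _).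
rewrite -{1}h0; have [E|ne] := eqVneq (brk_nth d j) (brk_nth d 0).
  have -> : j = 0 by have := lt _ _ (ltn0Sn _) jm; rewrite E ltnn; lia.
  by rewrite expr0.
case: j jm ne => [|j] jm ne; first by rewrite eqxx in ne.
by rewrite mul1r -exprS.
Qed.

Variables (u : words R) (X : ftree R).

Definition split_term M3 M4 b (d3 : {set arrow M3}) (d4 : {set arrow M4}) : words R :=
  ((if out then psgn true d4 else psgn true d3) *: gstar out u (splitf x out b d3 d4) X)%R.

Definition split_terms M3 M4 b : words R :=
  (\sum_(d3 in dissections M3) \sum_(d4 in dissections M4) split_term b d3 d4)%R.

Definition split_at b : words R :=
  (\sum_(d in dissections N | is_break d b) (-1) ^+ reversed_count d b *: gstar out u (split_forest x out d b) X)%R.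

Section Inner.
Variable b : nat.
Hypotheses (b0 : 0 < b) (bN : b.+1 < N).
Notation pc := (spiece b0 bN).
Notation c0 := (scut b0 bN).

Lemma brk_inner (d : {set arrow N}) : is_break d b = (c0 \in d).
Proof.
have [h0 hN] : (b == 0) = false /\ (b == N.-1) = false by move: b0 bN; clear; lia.
rewrite /is_break h0 hN.
apply/exists_inP/idP => [[a ad /andP[/eqP a1 /eqP a2]]|cd]; last by exists c0; rewrite //= !eqxx.
suff <- : a = c0 by [].
by case: a a1 a2 {ad} => i j /= a1 a2; congr (_, _); apply: val_inj.
Qed.

Lemma cnt_restr (d : {set arrow N}) : d \in dissections N -> c0 \in d ->
  reversed_count d b = #|[set a in restr (pc (~~ out)) d | true && (a.1 == 0 :> nat)]|.
Proof.
move=> dD cd; rewrite -[RHS](card_in_imset (f := farr (pc (~~ out)))); last first.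
  move=> a a'; rewrite !inE => /andP[/andP[na _] _] /andP[/andP[na' _] _] E.
  exact: (farr_inj E na na').
apply: eq_card => a; rewrite inE; apply/andP/imsetP => [[ad H]|[c]].
  have [ac|[k [c cD ac]]] := split_arrow dD cd ad.
    by move: H; rewrite ac /= ltnn; case: (out).
  have nc : nontrivial c by move: cD; rewrite inE => /andP[].
  have [_ E] := sflipE out dD cd nc; rewrite ac E in H; case/andP: H => ko c1.
  have kE : k = ~~ out by move: ko; rewrite /=; case: (k); case: (out).
  by subst k; exists c; rewrite // inE cD.
rewrite inE => /andP[cD /= c1] ->; have nc : nontrivial c by move: cD; rewrite inE => /andP[].
have [_ E] := sflipE out dD cd nc; rewrite E c1 andbT; split; last by case: (out).
by move: cD; rewrite inE => /andP[].
Qed.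

Lemma split_inner : eqm n (split_terms b.+1 (N - b) b) (split_at b).
Proof.
pose T := ({set arrow b.+1} * {set arrow (N - b)})%type.
pose delta (t : T) (k : bool) : {set arrow (psize (pc k))} :=
  match k as k0 return {set arrow (psize (pc k0))} with true => t.1 | false => t.2 end.
pose Phi (d : {set arrow N}) : T := (restr (pc true) d, restr (pc false) d).
pose F (d : {set arrow N}) := split_term b (restr (pc true) d) (restr (pc false) d).
have fam := spiece_family b0 bN.
have GS := @glue_sum R N _ pc _ fam T delta Phi F _ _.
apply: (@eqm_trans R n (\sum_(d in dissections N | [set c0] \subset d) F d)%R).
  apply: eqm_eq; rewrite GS.
  - rewrite /split_terms pair_big /=; apply: eq_big => [[d3 d4]|[d3 d4] /andP[d3D d4D]] /=.
      apply/andP/forallP => [[h1 h2] []//|H]; by have := H true; have := H false.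
    have tD k : delta (d3, d4) k \in dissections (psize (pc k)) by case: k.
    by rewrite /F !(restr_glue fam tD).
  - by move=> d [].
  - move=> [d3 d4] d H; have := H true; have := H false.
    by rewrite /Phi /= => -> ->.
have -> : split_at b = (\sum_(d in dissections N | [set c0] \subset d)
    (-1) ^+ reversed_count d b *: gstar out u (split_forest x out d b) X)%R.
  by apply: eq_bigl => d; rewrite sub1set brk_inner.
apply: eqm_sum => d /andP[dD]; rewrite sub1set => cd; rewrite /F /split_term.
have -> : (if out then psgn true (restr (pc false) d) else psgn true (restr (pc true) d)) = ((-1) ^+ reversed_count d b)%R.
  by rewrite (cnt_restr dD cd) /psgn; case: (out).
apply: eqmZ; apply: gstar_iso; [exact: eqm_refl|exact: split_iso|exact: fiso_refl].
Qed.
End Inner.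

Lemma dissections1 (d : {set arrow 1}) : (d \in dissections 1) = (d == set0).
Proof.
apply/idP/eqP => [/dissP[dn _]|->]; last by apply/dissP; split=> a; rewrite inE.
apply/setP => a; rewrite inE; apply/negP => /dn /nontrivial_neq.
by rewrite (ord1 a.1) (ord1 a.2) eqxx.
Qed.

Lemma regions1 (d : {set arrow 1}) : regions d = set0.
Proof. by apply/setP => r; rewrite in_set0; apply/negP => /regionsP[]. Qed.

Lemma psgn_set0 M : psgn true (set0 : {set arrow M}) = 1%R.
Proof. by rewrite /psgn eq_card0 // => a; rewrite !inE. Qed.

Lemma split_first : eqm n (split_terms 1 N 0) (split_at 0).
Proof.
rewrite /split_terms (big_pred1 set0) ?/split_at; last by move=> d; rewrite dissections1.
rewrite [X in eqm n _ X](eq_bigl (mem (dissections N))); last by move=> d; rewrite /is_break eqxx andbT.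
apply: eqm_sum => d dD; have [dn _] := dissP _ dD; rewrite /split_term psgn_set0.
have -> : (if out then psgn true d else 1%R) = ((-1) ^+ reversed_count d 0)%R.
  rewrite /reversed_count /psgn; case: (out).
    congr (_ ^+ _)%R; apply: eq_card => a; rewrite !inE; case: (boolP (a \in d)) => //= /dn.
    by rewrite nontrivialE /nontriv; clear; lia.
  by rewrite eq_card0 ?expr0 // => a; rewrite !inE ltn0 !andbF.
apply: eqmZ; apply: gstar_iso; [exact: eqm_refl| |exact: fiso_refl].
have eV w : w \in fV (splitf x out 0 (set0 : {set arrow 1}) d) -> exists2 r, w = inr r & r \in regions d.
  by case: w => r; rewrite inE /= ?regions1 ?inE // => rV; exists r.
exists (fun w => match w with inl _ => set0 | inr r => r end); split.
- by move=> w w' /eV[r -> _] /eV[r' -> _] ->.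
- apply/setP => r; apply/imsetP/idP => [[w /eV[r' -> r'V] ->] //|rV].
  by exists (inr r) => //; rewrite inE.
- move=> w w' /eV[r -> _] /eV[r' -> _] /=; apply: eq_existsb => a.
  case: (boolP (a \in d)) => //= /dn; rewrite nontrivialE /nontriv => na.
  case: (boolP (a.1 == 0 :> nat)) => //= [/eqP a1|_]; last by rewrite andbF.
  rewrite a1 in na; case/andP: na => na _.
  by rewrite ltn0 lt0n na; case: (out).
- by move=> w /eV[r -> _]; apply: eqm_refl.
- by move=> w /eV[r -> _] /=; rewrite mul0n addn0 (_ : 0 < N.-1) //; move: N1; clear; lia.
Qed.

Lemma split_last : eqm n (split_terms N 1 N.-1) (split_at N.-1).
Proof.
rewrite /split_terms exchange_big (big_pred1 set0) ?/split_at; last by move=> d; rewrite dissections1.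
rewrite [X in eqm n _ X](eq_bigl (mem (dissections N))); last by move=> d; rewrite /is_break eqxx orbT andbT.
apply: eqm_sum => d dD; have [dn _] := dissP _ dD; rewrite /split_term psgn_set0.
have nN a : a \in d -> (a.1 == 0 :> nat) -> a.2 < N.-1.
  move=> /dn; rewrite nontrivialE /nontriv; have := ltn_ord a.2.
  by move=> h1 h2 /eqP h3; move: h1 h2; rewrite h3; clear; case: (eqVneq a.2.+1 N); lia.
have -> : (if out then 1%R else psgn true d) = ((-1) ^+ reversed_count d N.-1)%R.
  rewrite /reversed_count /psgn; case: (out).
    rewrite eq_card0 ?expr0 // => a; rewrite !inE; apply/negP => /and3P[ad a1].
    by have := nN a ad a1; clear; lia.
  congr (_ ^+ _)%R; apply: eq_card => a; rewrite !inE; case: (boolP (a \in d)) => //= ad.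
  by case: eqP => //= /eqP a1; rewrite (nN a ad a1).
apply: eqmZ; apply: gstar_iso; [exact: eqm_refl| |exact: fiso_refl].
have eV w : w \in fV (splitf x out N.-1 d (set0 : {set arrow 1})) -> exists2 r, w = inl r & r \in regions d.
  by case: w => r; rewrite inE /= ?regions1 ?inE // => rV; exists r.
exists (fun w => match w with inl r => r | inr _ => set0 end); split.
- by move=> w w' /eV[r -> _] /eV[r' -> _] ->.
- apply/setP => r; apply/imsetP/idP => [[w /eV[r' -> r'V] ->] //|rV].
  by exists (inl r) => //; rewrite inE.
- move=> w w' /eV[r -> _] /eV[r' -> _] /=; apply: eq_existsb => a.
  case: (boolP (a \in d)) => //= ad; case: (boolP (a.1 == 0 :> nat)) => //= a1; last by rewrite andbF.
  have lt := nN a ad a1; rewrite lt (_ : (a.2 == N.-1 :> nat) = false); last by move: lt; clear; lia.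
  by rewrite (_ : (N.-1 < a.2) = false) ?andbT; [case: (out)|move: lt; clear; lia].
- by move=> w /eV[r -> _]; apply: eqm_refl.
- move=> w /eV[r -> _] /=; rewrite ltnn orbF (_ : 0 < N.-1) //=; last by move: N1; clear; lia.
  have N0 : 0 < N by move: N1; clear; lia.
  have h1 : N.-1 < N by move: N1; clear; lia.
  have h2 : N.-2 < N by move: N1; clear; lia.
  have -> : (N * N).-1 = gpos ((Ordinal h1, Ordinal h1) : gap N).
    by rewrite /gpos /=; case: (N) N0 => // k _; rewrite mulSn mulnS /=; clear; lia.
  have -> : (N.-1 * N + N.-1).-1 = gpos ((Ordinal h1, Ordinal h2) : gap N) by rewrite /gpos /=; move: N1; clear; lia.
  (* The last two gaps of the root side could only be separated by the arrow from the first vertex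
     to this side, which is trivial. *)
  congr (_ == _); apply/region_eqP/regionP => a ad.
  have na := dn a ad; rewrite /agree !on_leftE ?nontrivial_neq //=.
  move: na; rewrite nontrivialE /nontriv /lft; have := ltn_ord a.1; have := ltn_ord a.2.
  case: a {ad} => -[i iN] [j jN] /=; move: N1 iN jN; clear; case: (leqP i j) => h; case: (eqVneq j.+1 N) => E *; apply/eqP; lia.
Qed.

(** A pair of dissections for the splitting at [b] is a dissection of the whole polygon with a break
    at [b]. Exchanging the sums, one sums over the breaks of a fixed dissection. *)
Lemma split_antipode : eqm n (\sum_(b < N) split_sign b *: split_terms b.+1 (N - b) b)%R 0%R.
Proof.
apply: (@eqm_trans R n (\sum_(b < N) split_sign b *: split_at b)%R).
  apply: eqm_sum => -[b bN] _ /=; apply: eqmZ; case: (posnP b) => [->|b0].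
    by rewrite subn0; apply: split_first.
  have [bN'|bN'] := ltnP b.+1 N; first exact: split_inner.
  have -> : b = N.-1 by move: bN bN'; clear; lia.
  rewrite prednK; last by move: N1; clear; lia.
  rewrite (_ : N - N.-1 = 1); last by move: N1; clear; lia.
  exact: split_last.
have -> : (\sum_(b < N) split_sign b *: split_at b = \sum_(d in dissections N)
    (if out then (-1) ^+ (brk_num d).+1 else 1) *:
    \sum_(j < (brk_num d).+2) (-1) ^+ j *: gstar out u (split_forest x out d (brk_nth d j)) X)%R.
  rewrite -(big_mkord xpredT (fun b => split_sign b *: split_at b)%R).
  under eq_bigr do rewrite /split_at scaler_sumr.
  rewrite (exchange_big_dep (fun d => d \in dissections N)) /=; last by move=> b d _ /andP[].
  apply: eq_bigr => d dD; rewrite scaler_sumr.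
  rewrite (eq_bigl (is_break d)); last by move=> b; rewrite dD.
  rewrite /index_iota subn0 -big_filter -/(breaks d) (big_nth 0) big_mkord (breaks_size N1 dD).
  apply: eq_bigr => -[j jm] _ /=; rewrite !scalerA; congr (_ *: _)%R.
  by rewrite -ssgn_cnt.
apply: (@eqm_trans R n (\sum_(d in dissections N)
    (if out then (-1) ^+ (brk_num d).+1 else 1) *: (0 : words R))%R); last first.
  by apply: eqm_eq; rewrite big1 // => d _; rewrite scaler0.
by apply: eqm_sum => d dD; apply: eqmZ; apply: sft_antipode.
Qed.

End SplitSum.

(** * Conclusion *)

Section BigonAntipodes.
Variables (R : choiceType) (n : nat).
Implicit Types (u : words R) (y : nat -> R).

(** [bigon_sum] with the sizes of the four polygons as independent parameters. *)
Definition bterms M1 M2 M3 M4 y1 y2 y3 y4 u : words R :=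
  (\sum_(d1 in dissections M1) \sum_(d2 in dissections M2)
   \sum_(d3 in dissections M3) \sum_(d4 in dissections M4)
     (psgn true d1 * psgn true d4) *:
     gstar true u
       (fsum (pft y3 false false true d3) (pft y4 false true false d4))
       (fsum (pft y1 true true true d1) (pft y2 true false false d2)))%R.

Lemma bigon_sumE N x a v b u : bigon_sum N x a v b u =
  bterms a.+1 (v - a) (b.+1 - v) (N - b) (fun j => x (0 + j)) (fun j => x (a + j))
    (fun j => x (v + j)) (fun j => x (b + j)) u.
Proof. by []. Qed.

Lemma bterms_eqm M1 M2 M3 M4 y1 y2 y3 y4 u u' : eqm n u u' ->
  eqm n (bterms M1 M2 M3 M4 y1 y2 y3 y4 u) (bterms M1 M2 M3 M4 y1 y2 y3 y4 u').
Proof.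
move=> uu; apply: eqm_sum => d1 _; apply: eqm_sum => d2 _; apply: eqm_sum => d3 _.
apply: eqm_sum => d4 _; apply: eqmZ; apply: gstar_iso => //; exact: fiso_refl.
Qed.

Lemma btermsB M1 M2 M3 M4 y1 y2 y3 y4 u u' :
  bterms M1 M2 M3 M4 y1 y2 y3 y4 (u - u')%R =
  (bterms M1 M2 M3 M4 y1 y2 y3 y4 u - bterms M1 M2 M3 M4 y1 y2 y3 y4 u')%R.
Proof.
rewrite /bterms -sumrB; apply: eq_bigr => d1 _; rewrite -sumrB; apply: eq_bigr => d2 _.
rewrite -sumrB; apply: eq_bigr => d3 _; rewrite -sumrB; apply: eq_bigr => d4 _.
by rewrite gstarB scalerBr.
Qed.

Lemma bterms_split34 M1 M2 M3 M4 y1 y2 y b u :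
  bterms M1 M2 M3 M4 y1 y2 y (fun j => y (b + j)) u =
  (\sum_(d1 in dissections M1) \sum_(d2 in dissections M2) psgn true d1 *:
    split_terms y true u (fsum (pft y1 true true true d1) (pft y2 true false false d2)) M3 M4 b)%R.
Proof.
apply: eq_bigr => d1 _; apply: eq_bigr => d2 _; rewrite scaler_sumr; apply: eq_bigr => d3 _.
by rewrite scaler_sumr; apply: eq_bigr => d4 _; rewrite /split_term scalerA.
Qed.

(** By [gstar_swap] the polygons before [v] become the first argument, with [out] false, and fall
    under the same cancellation as those after [v]. *)
Lemma bterms_split12 M1 M2 M3 M4 y y3 y4 a u :
  eqm n (bterms M1 M2 M3 M4 y (fun j => y (a + j)) y3 y4 u)
  (\sum_(d3 in dissections M3) \sum_(d4 in dissections M4) psgn true d4 *: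
    split_terms y false u (fsum (pft y3 false false true d3) (pft y4 false true false d4)) M1 M2 a)%R.
Proof.
pose F d1 d2 d3 d4 : words R := ((psgn true d1 * psgn true d4) *: gstar true u
       (fsum (pft y3 false false true d3) (pft y4 false true false d4))
       (fsum (pft y true true true d1) (pft (fun j => y (a + j)) true false false d2)))%R.
apply: (@eqm_trans R n (\sum_(d3 in dissections M3) \sum_(d4 in dissections M4)
    \sum_(d1 in dissections M1) \sum_(d2 in dissections M2) F M1 M2 M3 M4 d1 d2 d3 d4)%R).
  apply: eqm_eq; transitivity (\sum_(d1 in dissections M1) \sum_(d3 in dissections M3)
    \sum_(d4 in dissections M4) \sum_(d2 in dissections M2) F M1 M2 M3 M4 d1 d2 d3 d4)%R.
    apply: eq_bigr => d1 _; rewrite exchange_big; apply: eq_bigr => d3 _.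
    by rewrite exchange_big.
  rewrite exchange_big; apply: eq_bigr => d3 _.
  by rewrite exchange_big.
apply: eqm_sum => d3 _; apply: eqm_sum => d4 _; rewrite scaler_sumr.
apply: eqm_sum => d1 _; rewrite scaler_sumr; apply: eqm_sum => d2 _.
rewrite /F /split_term mulrC -scalerA; do 2!apply: eqmZ.
exact: gstar_swap.
Qed.

Lemma bterms_antipode34 M M1 M2 y1 y2 y u : 1 < M ->
  eqm n (\sum_(b < M) split_sign M true b *: bterms M1 M2 b.+1 (M - b) y1 y2 y (fun j => y (b + j)%N) u)%R 0%R.
Proof.
move=> M1'; pose X (d1 : {set arrow M1}) (d2 : {set arrow M2}) :=
  fsum (pft y1 true true true d1) (pft y2 true false false d2).
apply: (@eqm_trans R n (\sum_(d1 in dissections M1) \sum_(d2 in dissections M2) psgn true d1 *: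
   \sum_(b < M) split_sign M true b *: split_terms y true u (X d1 d2) b.+1 (M - b) b)%R).
  apply: eqm_eq; under eq_bigr => b _.
    rewrite bterms_split34 scaler_sumr; under eq_bigr do rewrite scaler_sumr.
    over.
  rewrite exchange_big; apply: eq_bigr => d1 _; rewrite exchange_big; apply: eq_bigr => d2 _.
  rewrite scaler_sumr; apply: eq_bigr => b _; by rewrite !scalerA mulrC.
apply: (@eqm_trans R n (\sum_(d1 in dissections M1) \sum_(d2 in dissections M2) psgn true d1 *: (0 : words R))%R).
  by apply: eqm_sum => d1 _; apply: eqm_sum => d2 _; apply: eqmZ; apply: split_antipode.
by apply: eqm_eq; rewrite big1 // => d1 _; rewrite big1 // => d2 _; rewrite scaler0.
Qed.

Lemma bterms_antipode12 M M3 M4 y y3 y4 u : 1 < M ->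
  eqm n (\sum_(a < M) split_sign M false a *: bterms a.+1 (M - a) M3 M4 y (fun j => y (a + j)%N) y3 y4 u)%R 0%R.
Proof.
move=> M1'; pose X (d3 : {set arrow M3}) (d4 : {set arrow M4}) :=
  fsum (pft y3 false false true d3) (pft y4 false true false d4).
apply: (@eqm_trans R n (\sum_(d3 in dissections M3) \sum_(d4 in dissections M4) psgn true d4 *:
   \sum_(a < M) split_sign M false a *: split_terms y false u (X d3 d4) a.+1 (M - a) a)%R).
  apply: (@eqm_trans R n (\sum_(a < M) split_sign M false a *: \sum_(d3 in dissections M3) \sum_(d4 in dissections M4)
     psgn true d4 *: split_terms y false u (X d3 d4) a.+1 (M - a) a)%R).
    by apply: eqm_sum => a _; apply: eqmZ; apply: bterms_split12.
  apply: eqm_eq; under eq_bigr => a _.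
    rewrite scaler_sumr; under eq_bigr do rewrite scaler_sumr.
    over.
  rewrite exchange_big; apply: eq_bigr => d1 _; rewrite exchange_big; apply: eq_bigr => d2 _.
  rewrite scaler_sumr; apply: eq_bigr => b _; by rewrite !scalerA mulrC.
apply: (@eqm_trans R n (\sum_(d1 in dissections M3) \sum_(d2 in dissections M4) psgn true d2 *: (0 : words R))%R).
  by apply: eqm_sum => d1 _; apply: eqm_sum => d2 _; apply: eqmZ; apply: split_antipode.
by apply: eqm_eq; rewrite big1 // => d1 _; rewrite big1 // => d2 _; rewrite scaler0.
Qed.

Variables (N : nat) (x : nat -> R).
Let eps (a : nat) : rat := (if a == 0%N then 1 else -1)%R.
Let eps' (b : nat) : rat := (if b == N.-1 then 1 else -1)%R.

(** The polygons after [v] are the parts of the polygon with sides [v, ..., N.-1] split at its side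
    [b - v]; the hypothesis makes that polygon non-trivial. *)
Lemma bigon_antipode34 a v u : v.+1 < N ->
  eqm n (\sum_(b < N | (v <= b)%N) eps' b *: bigon_sum N x a v b u)%R 0%R.
Proof.
move=> vN; have vN1 : 1 < N - v by move: vN; clear; lia.
apply: eqm_trans (bterms_antipode34 a.+1 (v - a) (fun j => x (0 + j)) (fun j => x (a + j))
  (fun j => x (v + j)) u vN1).
apply: eqm_eq; rewrite -(big_geq_mkord v N xpredT (fun b => eps' b *: bigon_sum N x a v b u)%R).
rewrite -{1}[v]add0n big_addn big_mkord; apply: eq_bigr => -[b bN] _ /=.
rewrite bigon_sumE; congr (_ *: _)%R.
  by rewrite /eps' /split_sign; have -> : (b + v == N.-1) = (b == (N - v).-1) by move: bN vN; clear; lia.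
have -> : (b + v).+1 - v = b.+1 by clear; lia.
have -> : N - (b + v) = N - v - b by clear; lia.
by congr bterms; apply: funext => j; rewrite addnA [v + b]addnC.
Qed.

(** The polygons before [v] are the parts of the polygon with sides [0, ..., v.-1] split at [a]. *)
Lemma bigon_antipode12 v b u : 1 < v -> v <= N ->
  eqm n (\sum_(a < N | (a < v)%N) eps a *: bigon_sum N x a v b u)%R 0%R.
Proof.
move=> v1 vN; apply: eqm_trans (bterms_antipode12 (b.+1 - v) (N - b) (fun j => x (0 + j))
  (fun j => x (v + j)) (fun j => x (b + j)) u v1).
apply: eqm_eq; rewrite -(big_ord_widen N (fun a => eps a *: bigon_sum N x a v b u)%R vN).
by apply: eq_bigr => a _; rewrite bigon_sumE /split_sign.
Qed.

End BigonAntipodes.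

(** * Reduction of the sum over triples to the extreme positions of [v] *)

Section Collapse.
Variables (R : choiceType) (n : nat) (x : nat -> R).
Hypothesis n2 : 1 < n.
Notation N := n.+1.
Notation G := (bigon_sum n.+1 x).
Notation gon := (gon2 x).

Definition fgon a : words R := (gon a 0 - gon 0 a)%R.
Let eps (a : nat) : rat := (if a == 0%N then 1 else -1)%R.
Let eps' (b : nat) : rat := (if b == N.-1 then 1 else -1)%R.

Lemma gon2_split a b : eqm n (gon a b - gon b a)%R (fgon a - fgon b)%R.
Proof.
apply: eqm_sym; apply: ideal_sum_gen; left; exists (x a), (x b), (x 0).
rewrite /fgon -!/(gon2 x _ _).
move: (gon a 0) (gon 0 a) (gon b 0) (gon 0 b) (gon a b) (gon b a) => p q r s t w.
by rewrite !opprB !addrA addrAC.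
Qed.

Lemma bigon_sum_eqm a v b u u' : eqm n u u' -> eqm n (G a v b u) (G a v b u').
Proof. exact: bterms_eqm. Qed.

Lemma bigon_sumB a v b u u' : G a v b (u - u')%R = (G a v b u - G a v b u')%R.
Proof. exact: btermsB. Qed.

Lemma bsignE a b : bsign N a b = (eps a * eps' b)%R.
Proof. by []. Qed.

(** Here the inserted element is constant in [b], so that only [v = n], hence [b = n], survives. The
    term [a = 0] vanishes with [fgon 0], and the others have sign -1. *)
Lemma first_sum :
  eqm n (\sum_(p : triple N | ordered p) bsign N p.1.1 p.2 *: G p.1.1 p.1.2 p.2 (fgon p.1.1))%R
        (- \sum_(1 <= a < n) G a n n (fgon a))%R.
Proof.
have -> : (\sum_(p : triple N | ordered p) bsign N p.1.1 p.2 *: G p.1.1 p.1.2 p.2 (fgon p.1.1) =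
    \sum_(q : 'I_N * 'I_N | (q.1 < q.2)%N) eps q.1 *: \sum_(b < N | (q.2 <= b)%N) eps' b *: G q.1 q.2 b (fgon q.1))%R.
  under [RHS]eq_bigr do rewrite scaler_sumr.
  by rewrite pair_big_dep /=; apply: eq_bigr => p _; rewrite bsignE scalerA.
apply: (@eqm_trans R n (\sum_(q : 'I_N * 'I_N | (q.1 < q.2)%N)
    if q.2 == ord_max then eps q.1 *: G q.1 n n (fgon q.1) else 0)%R).
  apply: eqm_sum => -[a v] /= av; case: eqP => [->|/eqP vn].
    apply: eqmZ; rewrite (big_pred1 ord_max) /=; last first.
      by move=> b; apply/idP/eqP => [h|->//]; apply: val_inj => /=; have := ltn_ord b; lia.
    by rewrite /eps' eqxx scale1r; apply: eqm_refl.
  have vN : v.+1 < N by move: vn; rewrite -val_eqE /=; have := ltn_ord v; clear; lia.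
  have := eqmZ (eps a) (bigon_antipode34 n x a (fgon a) vN).
  by rewrite scaler0.
apply: eqm_eq; rewrite -big_mkcondr /=.
rewrite -(pair_big_dep xpredT (fun a v : 'I_N => (a < v) && (v == ord_max))
  (fun a _ => eps a *: G a n n (fgon a))%R) /=.
transitivity (\sum_(a < N | (a < n)%N) eps a *: G a n n (fgon a))%R.
  rewrite [RHS]big_mkcond; apply: eq_bigr => a _.
  case: ifP => an.
    by rewrite (big_pred1 ord_max) // => v; rewrite /= andbC; case: eqP => // ->.
  by rewrite big1 // => v /andP[av /eqP E]; rewrite E an in av.
rewrite -(big_ord_widen N (fun a => eps a *: G a n n (fgon a))%R (leqnSn n)).
rewrite -(big_mkord xpredT (fun a => eps a *: G a n n (fgon a))%R) big_ltn; last by lia.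
have -> : G 0 n n (fgon 0) = 0%R by rewrite /fgon bigon_sumB subrr.
rewrite scaler0 add0r -sumrN; apply: eq_big_nat => a /andP[a1 _].
by rewrite /eps (_ : (a == 0) = false) ?scaleN1r //; move: a1; clear; lia.
Qed.

(** Here the inserted element is constant in [a], so that only [v = 1], hence [a = 0], survives; the
    sum over [b] remains, with sign 1 for [b = n] only. *)
Lemma second_sum :
  eqm n (\sum_(p : triple N | ordered p) bsign N p.1.1 p.2 *: G p.1.1 p.1.2 p.2 (fgon p.2))%R
        (G 0 1 n (fgon n) - \sum_(1 <= b < n) G 0 1 b (fgon b))%R.
Proof.
pose h (q : triple N) : triple N := ((q.2, q.1.1), q.1.2).
have hK : bijective h by exists (fun p : triple N => ((p.1.2, p.2), p.1.1)) => -[[a b] c].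
rewrite (reindex h); last exact: onW_bij.
have -> : (\sum_(q | ordered (h q)) bsign N (h q).1.1 (h q).2 *: G (h q).1.1 (h q).1.2 (h q).2 (fgon (h q).2) =
    \sum_(q : 'I_N * 'I_N | (q.1 <= q.2)%N) eps' q.2 *: \sum_(a < N | (a < q.1)%N) eps a *: G a q.1 q.2 (fgon q.2))%R.
  under [RHS]eq_bigr do rewrite scaler_sumr.
  rewrite pair_big_dep /=; apply: eq_big => [p|p _]; first by rewrite /ordered /= andbC.
  by rewrite bsignE scalerA mulrC.
apply: (@eqm_trans R n (\sum_(q : 'I_N * 'I_N | (q.1 <= q.2)%N)
    if q.1 == 1%N :> nat then eps' q.2 *: G 0 1 q.2 (fgon q.2) else 0)%R).
  apply: eqm_sum => -[v b] /= vb; case: (ltngtP v 1) => v1.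
  - rewrite big1 ?scaler0; first exact: eqm_refl.
    by move=> a; move: v1; clear; lia.
  - have vN : v <= N by apply: ltnW.
    have := eqmZ (eps' b) (bigon_antipode12 n x b (fgon b) v1 vN).
    by rewrite scaler0.
  - rewrite v1; apply: eqmZ; rewrite (big_pred1 ord0) /=; first by rewrite scale1r; apply: eqm_refl.
    by move=> a; rewrite ltnS leqn0.
apply: eqm_eq; rewrite -big_mkcondr /=.
transitivity (\sum_(b < N | (1 <= b)%N) eps' b *: G 0 1 b (fgon b))%R.
  rewrite (reindex (fun q : 'I_N * 'I_N => (q.2, q.1))) /=; last first.
    by apply: onW_bij; exists (fun q => (q.2, q.1)) => -[].
  rewrite -(pair_big_dep xpredT (fun b v : 'I_N => (v <= b) && (v == 1%N :> nat))
    (fun b _ => eps' b *: G 0 1 b (fgon b))%R) /=.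
  have N1 : 1 < N by lia.
  rewrite [RHS]big_mkcond; apply: eq_bigr => b _; case: ifP => b1.
    rewrite (big_pred1 (Ordinal N1)) // => v; rewrite /= -val_eqE /= andbC.
    by case: eqP => // ->.
  by rewrite big1 // => v /andP[vb /eqP E]; rewrite E b1 in vb.
rewrite -(big_geq_mkord 1 N xpredT (fun b => eps' b *: G 0 1 b (fgon b))%R).
rewrite big_nat_recr /=; last by lia.
rewrite [in LHS]/eps' eqxx scale1r addrC; congr (_ + _)%R; rewrite -sumrN.
apply: eq_big_nat => b /andP[_ bn].
by rewrite (_ : (b == n) = false) ?scaleN1r //; move: bn; clear; lia.
Qed.

Lemma collapse :
  eqm n (\sum_(p : triple N | ordered p) bsign N p.1.1 p.2 *:
           G p.1.1 p.1.2 p.2 (gon p.1.1 p.2 - gon p.2 p.1.1))%R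
   (\sum_(1 <= k < n) (G 0 1 k (gon k n - gon n k) - G k n n (gon k 0 - gon 0 k)))%R.
Proof.
apply: (@eqm_trans R n (\sum_(p : triple N | ordered p) bsign N p.1.1 p.2 *: G p.1.1 p.1.2 p.2 (fgon p.1.1)
    - \sum_(p : triple N | ordered p) bsign N p.1.1 p.2 *: G p.1.1 p.1.2 p.2 (fgon p.2))%R).
  apply: (@eqm_trans R n (\sum_(p : triple N | ordered p) bsign N p.1.1 p.2 *: G p.1.1 p.1.2 p.2 (fgon p.1.1 - fgon p.2))%R).
    by apply: eqm_sum => p _; apply: eqmZ; apply: bigon_sum_eqm; apply: gon2_split.
  by apply: eqm_eq; rewrite -sumrB; apply: eq_bigr => p _; rewrite bigon_sumB scalerBr.
apply: eqm_trans (eqmB first_sum second_sum) _.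
(* With the constant [fgon n] inserted, the sum over [b] for [a = 0] and [v = 1] cancels as well,
   since the polygon after the vertex 1 has [n > 1] sides. This trades the exceptional term [b = n]
   for the correction of [fgon k] by [fgon n]. *)
have Z : eqm n (G 0 1 n (fgon n) - \sum_(1 <= b < n) G 0 1 b (fgon n))%R 0%R.
  have N2 : 2 < N by lia.
  apply: eqm_trans _ (bigon_antipode34 n x 0 (fgon n) N2); apply: eqm_eq.
  rewrite -(big_geq_mkord 1 N xpredT (fun b => eps' b *: G 0 1 b (fgon n))%R).
  rewrite big_nat_recr /=; last by lia.
  rewrite [in RHS]/eps' eqxx scale1r addrC; congr (_ + _)%R; rewrite -sumrN.
  apply: eq_big_nat => b /andP[_ bn].
  by rewrite (_ : (b == n) = false) ?scaleN1r //; move: bn; clear; lia.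
apply: (@eqm_trans R n (\sum_(1 <= k < n) (G 0 1 k (fgon k - fgon n) - G k n n (fgon k)))%R); last first.
  apply: eqm_sum => k _; apply: eqmB; last exact: eqm_refl.
  by apply: bigon_sum_eqm; apply: eqm_sym; apply: gon2_split.
rewrite [X in eqm _ _ X]sumrB; under [X in eqm _ _ (X - _)%R]eq_bigr do rewrite bigon_sumB.
rewrite sumrB; move: Z.
move: (\sum_(1 <= i < n) G i n n (fgon i))%R (G 0 1 n (fgon n)) (\sum_(1 <= b < n) G 0 1 b (fgon n))%R
  (\sum_(1 <= b < n) G 0 1 b (fgon b))%R => a d e c Z.
have := eqmB (eqm_refl n (- a - (d - c))%R) (eqmN Z); rewrite oppr0 subr0 opprK => H.
apply: eqm_trans (eqm_sym H) _; apply: eqm_eq.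
by rewrite opprB -addrA subrKA addrC.
Qed.

End Collapse.

(** * Identification with both sides of the theorem *)

Section Ends.
Variables (R : choiceType) (n : nat).
Implicit Types (u : words R) (y : nat -> R).

Lemma big_dissections1 (F : {set arrow 1} -> words R) : (\sum_(d in dissections 1) F d)%R = F set0.
Proof. by rewrite (big_pred1 set0) // => d; rewrite dissections1. Qed.

Lemma fiso_void y y' rs fl l rs' fl' l' (d d' : {set arrow 1}) :
  fiso n (fvoid R) (fsum (pft y rs fl l d) (pft y' rs' fl' l' d')).
Proof.
exists (of_void _); split=> [[]||[]|[]|[]] //.
apply/setP => w; have -> : (w \in fV (fsum (pft y rs fl l d) (pft y' rs' fl' l' d'))) = false.
  by case: w => r; rewrite inE /= regions1 inE.
by apply/negbTE/imsetP => -[[]].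
Qed.

Lemma fiso_sumC (F F' : ftree R) : fiso n (fsum F F') (fsum F' F).
Proof.
exists (fun w => match w with inl a => inr a | inr b => inl b end); split.
- by move=> [a|b] [a'|b'] _ _ // [->].
- apply/setP => w; rewrite inE; apply/imsetP/idP => [[[a|b]]|]; rewrite ?inE; try by move=> h ->.
  by case: w => r rV; [exists (inr r)|exists (inl r)]; rewrite ?inE.
- by move=> [a|b] [a'|b'].
- by move=> [a|b] _; apply: eqm_refl.
- by move=> [a|b].
Qed.

(** For [a = 0] and [v = 1] the two polygons before [v] are trivial and the 2-gon only has outgoing
    edges. *)
Lemma bterms_prec M3 M4 y1 y2 y3 y4 u :
  eqm n (bterms 1 1 M3 M4 y1 y2 y3 y4 u)
   (\sum_(d3 in dissections M3) \sum_(d4 in dissections M4) psgn true d4 *: gstar true u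
       (fsum (pft y3 false false true d3) (pft y4 false true false d4)) (fvoid R))%R.
Proof.
rewrite /bterms !big_dissections1; apply: eqm_sum => d3 _; apply: eqm_sum => d4 _.
rewrite psgn_set0 mul1r; apply: eqmZ; apply: eqm_sym.
by apply: gstar_iso; [exact: eqm_refl|exact: fiso_refl|exact: fiso_void].
Qed.

(** For [v = b = n] the two polygons after [v] are trivial and the 2-gon only has incoming edges. *)
Lemma bterms_succ M1 M2 y1 y2 y3 y4 u :
  eqm n (bterms M1 M2 1 1 y1 y2 y3 y4 u)
   (\sum_(d2 in dissections M2) \sum_(d1 in dissections M1) psgn true d1 *: gstar false u
       (fsum (pft y2 true false false d2) (pft y1 true true true d1)) (fvoid R))%R.
Proof.
rewrite exchange_big; apply: eqm_sum => d1 _; apply: eqm_sum => d2 _.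
rewrite !big_dissections1 psgn_set0 mulr1; apply: eqmZ; apply: eqm_trans (gstar_swap _ _ _ _ _) _.
by apply: eqm_sym; apply: gstar_iso; [exact: eqm_refl|exact: fiso_sumC|exact: fiso_void].
Qed.

Definition gen_sum rs y N : words R :=
  (\sum_(d in dissections N) psgn true d *: LamE (regions d) (tree_rel y d) (lab rs y d))%R.

Lemma phifv_gen_sum (Y : seq R) x0 y : (forall j, j < size Y -> nth x0 Y j = y j) ->
  eqm n (Lambda_gen phifv Y) (gen_sum false y (size Y)).
Proof. by move=> yE; apply: eqm_trans (Lambda_gen_RE n yE) _; apply: eqm_refl. Qed.

Lemma phisfv_gen_sum (Y : seq R) x0 y :
  (forall j, j < size Y -> nth x0 Y j = y (nsucc (size Y) j)) ->
  eqm n (Lambda_gen phisfv Y) (gen_sum true y (size Y)).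
Proof. by move=> yE; apply: eqm_trans (Lambda_gen_RS n yE) _; apply: eqm_refl. Qed.

Lemma difference_gen_sum y N : N <= n.+1 ->
  eqm n (gen_sum false y N - gen_sum true y N)%R
   (\sum_(p : triple N | ordered p) bsign N p.1.1 p.2 *:
      bigon_sum N y p.1.1 p.1.2 p.2 (gon2 y p.1.1 p.2 - gon2 y p.2 p.1.1))%R.
Proof.
move=> Nn; apply: eqm_trans _ (difference_sum y Nn); apply: eqm_eq.
by rewrite -sumrB; apply: eq_bigr => d _; rewrite -scalerBr.
Qed.

Lemma r_tilde_sum (I : Type) (s : seq I) (P : pred I) (F : I -> words R) :
  (\sum_(i <- s | P i) r_tilde n (F i) = r_tilde n (\sum_(i <- s | P i) F i))%R.
Proof. by rewrite /r_tilde raddf_sum. Qed.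

End Ends.

Local Open Scope ring_scope.

Theorem theorem87 (R : choiceType) (n : nat) (P : n.+1.-tuple R)
    (hn : (2 <= n)%N) :
  let x (i : nat) : R := nth (thead P) P i.-1 in
  let seg (i j : nat) : seq R := [seq x k | k <- index_iota i j.+1] in
  let Al (i : nat) : seq R := seg i n.+1 in
  let Ar (i : nat) : seq R := seg 2%N i in
  let Bl (i : nat) : seq R := rcons (seg i.+1 n) (x i) in
  let Br (i : nat) : seq R := rcons (seg 2%N i) (x 1%N) in
  let gon2 (a b : R) : words R := pword [:: a; b] in
  r_tilde n (Lambda_gen phifv P - Lambda_gen phisfv (rot 1 P)) =
  \sum_(2 <= i < n.+1)
    r_tilde n
      (insert_prec (gon2 (x i) (x n.+1) - gon2 (x n.+1) (x i)) (Ar i) (Al i)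
       - insert_succ (gon2 (x i) (x 1%N) - gon2 (x 1%N) (x i)) (Bl i) (Br i)).
Proof.
move=> x seg Al Ar Bl Br gon.
pose y j := x j.+1.
have sizeP : size P = n.+1 by rewrite size_tuple.
have size_seg i j : size (seg i j) = (j.+1 - i)%N by rewrite size_map size_iota.
have nth_seg i j k : (k < j.+1 - i)%N -> nth (thead P) (seg i j) k = x (i + k)%N.
  by move=> kj; rewrite (nth_map 0%N) ?size_iota // nth_iota.
have fv : eqm n (Lambda_gen phifv P) (gen_sum false y n.+1).
  have H := @phifv_gen_sum R n P (thead P) y; rewrite sizeP in H; exact: H.
have sfv : eqm n (Lambda_gen phisfv (rot 1 P)) (gen_sum true y n.+1).
  have sz : size (rot 1 P) = n.+1 by rewrite size_rot.
  have H := @phisfv_gen_sum R n (rot 1 P) (thead P) y; rewrite sz in H; apply: H => j jn.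
  rewrite /rot nth_cat size_drop sizeP /nsucc nth_drop /y /x /=.
  case: ifP => h; first by rewrite add1n (_ : (j.+1 == n.+1) = false) //; move: h; clear; lia.
  have -> : j = n by move: h jn; clear; lia.
  by rewrite eqxx subSS subn0 subnn nth_take.
rewrite r_tilde_sum; apply: eqm_pi.
apply: eqm_trans (eqmB fv sfv) _.
apply: eqm_trans (difference_gen_sum y (leqnn n.+1)) _.
apply: eqm_trans (collapse y hn) _.
(* With sides numbered from 0, the term [i = k.+1] belongs to side [k]. *)
rewrite [X in eqm _ _ X]big_add1 [n.+1.-1]/=; rewrite [X in eqm _ X _]big_nat [X in eqm _ _ X]big_nat.
apply: eqm_sum => k /andP[k1 kn]; apply: eqmB; apply: eqm_sym.
- have sAr : size (Ar k.+1) = (k.+1 - 1)%N by rewrite size_seg subSS.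
  have sAl : size (Al k.+1) = (n.+1 - k)%N by rewrite size_seg subSS.
  have hr : forall j, (j < size (Ar k.+1))%N -> nth (thead P) (Ar k.+1) j = y (1 + j)%N.
    by move=> j; rewrite sAr => jk; rewrite nth_seg // subSS -subSS.
  have hl : forall j, (j < size (Al k.+1))%N -> nth (thead P) (Al k.+1) j = y (k + j)%N.
    by move=> j; rewrite sAl => jk; rewrite nth_seg // subSS.
  apply: eqm_trans (insert_prec_eqm n _ hr hl) _; rewrite sAr sAl.
  apply: eqm_sym; exact: bterms_prec.
- have sBl : size (Bl k.+1) = (n - k)%N by rewrite size_rcons size_seg; move: kn; clear; lia.
  have sBr : size (Br k.+1) = k.+1 by rewrite size_rcons size_seg subSS subn1.
  (* [Bl] and [Br] list their sides in rotated form: their root side is side 0 of the corresponding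
     polygons before [v]. *)
  have hl : forall j, (j < size (Bl k.+1))%N -> nth (thead P) (Bl k.+1) j = y (k + nsucc (size (Bl k.+1)) j)%N.
    move=> j; rewrite sBl => jk; rewrite nth_rcons size_seg /nsucc.
    have [jk'|jk'] := ltnP j (n.+1 - k.+2).
      rewrite nth_seg // (_ : (j.+1 == n - k)%N = false); last by move: jk'; clear; lia.
      by rewrite /y !addSn addnS.
    have -> : j = (n.+1 - k.+2)%N by move: jk jk' kn; clear; lia.
    rewrite eqxx (_ : ((n.+1 - k.+2).+1 == n - k)%N) ?addn0 //; move: kn; clear; lia.
  have hr : forall j, (j < size (Br k.+1))%N -> nth (thead P) (Br k.+1) j = y (0 + nsucc (size (Br k.+1)) j)%N.
    move=> j; rewrite sBr => jk; rewrite nth_rcons size_seg subSS subn1 /nsucc eqSS add0n.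
    rewrite [k.+1.-1]/=; case: (ltngtP j k) => [jk'|jk'|_] //; last by move: jk jk'; clear; lia.
    by rewrite nth_seg // subSS subn1.
  apply: eqm_trans (insert_succ_eqm n _ hl hr) _; rewrite sBl sBr.
  apply: eqm_sym.
  rewrite bigon_sumE (_ : n.+1 - n = 1)%N; last by clear; lia.
  exact: bterms_succ.
Qed.
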